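(* Let $n\ge 2$, let $\Omega\subset\mathbb{R}^n$ be a bounded, strictly convex domain with smooth boundary, let $f\in C^\infty(\overline\Omega)$ be positive, let $\phi\in C^\infty(\overline\Omega)$, and let $\Theta\in\left[\frac{(n-2)\pi}{2},\frac{n\pi}{2}\right)$ be a constant. Then there exist constants $\varepsilon_0>0$ and $C>0$, depending only on $|\phi|_{C^3}$, $|f|_{C^1}$, $|f^{-1}|_{L^\infty}$, $n$, $\Theta$, $|\partial\Omega|_{C^2}$ and the uniform convexity of $\partial\Omega$ (a positive lower bound for its principal curvatures), such that for every $\varepsilon\in(0,\varepsilon_0)$ and every $C^3(\overline\Omega)$ solution $u$ of $$\sum_{i=1}^n \arctan\frac{\lambda_i(D^2u)}{f(x)}=\Theta\quad\text{in }\Omega,\qquad u_\nu=-\varepsilon u+\phi(x)\quad\text{on }\partial\Omega,$$ one has $$\max_{\overline\Omega}|Du|\le C.$$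
   Context: For a symmetric matrix $A$, $\lambda_1(A),\dots,\lambda_n(A)$ denote its eigenvalues. $\nu$ is the unit outward normal of $\partial\Omega$ and $u_\nu$ is the derivative of $u$ in the direction $\nu$. Strictly convex means that all principal curvatures of $\partial\Omega$ are positive. $|\partial\Omega|_{C^2}$ stands for a bound on the $C^2$ geometry of the domain $\Omega$. *)

(* Defs.v *)
From HB Require Import structures.
From mathcomp Require Import all_boot all_order all_algebra.
From mathcomp Require Import all_classical all_reals all_analysis.

Set Implicit Arguments.
Unset Strict Implicit.
Unset Printing Implicit Defensive.

Import Order.TTheory GRing.Theory Num.Theory.
Import numFieldNormedType.Exports.

Local Open Scope classical_set_scope.
Local Open Scope ring_scope.

(* Points of R^n are row vectors. The library norm on 'rV[R]_n is the sup norm,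
   so [ball p r] is a cube (same topology); Euclidean lengths use [enorm]. *)

Definition dotp (R : realType) (n : nat) (v w : 'rV[R]_n) : R :=
  \sum_(i < n) v 0 i * w 0 i.

Definition enorm (R : realType) (n : nat) (v : 'rV[R]_n) : R :=
  Num.sqrt (dotp v v).

Definition boundary (T : topologicalType) (A : set T) : set T :=
  closure A `\` interior A.

Definition partial (R : realType) (n : nat) (i : 'I_n) (u : 'rV[R]_n -> R) :
    'rV[R]_n -> R :=
  fun x => 'D_(delta_mx 0 i) u x.

(* [dpart [:: i1; ..; ik] u] is D_i1 (... (D_ik u)). *)
Fixpoint dpart (R : realType) (n : nat) (s : seq 'I_n) (u : 'rV[R]_n -> R) :
    'rV[R]_n -> R :=
  if s is i :: s' then partial i (dpart s' u) else u.

Definition grad (R : realType) (n : nat) (u : 'rV[R]_n -> R) (x : 'rV[R]_n) :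
    'rV[R]_n :=
  \row_(i < n) dpart [:: i] u x.

Definition hessian (R : realType) (n : nat) (u : 'rV[R]_n -> R)
    (x : 'rV[R]_n) : 'M[R]_n :=
  \matrix_(i < n, j < n) dpart [:: i; j] u x.

(* All partial derivatives of order < k can be differentiated on A
   (A is meant to be open). *)
Definition partials_exist (R : realType) (n : nat) (k : nat)
    (A : set 'rV[R]_n) (u : 'rV[R]_n -> R) : Prop :=
  forall (s : seq 'I_n) (i : 'I_n) (x : 'rV[R]_n),
    (size s < k)%N -> A x -> derivable (dpart s u) x (delta_mx 0 i).

Definition smooth_on (R : realType) (n : nat) (A : set 'rV[R]_n)
    (u : 'rV[R]_n -> R) : Prop :=
  (forall k : nat, partials_exist k A u) /\
  (forall (s : seq 'I_n) (x : 'rV[R]_n), A x -> {for x, continuous (dpart s u)}).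

(* C^k of the closure of an open set A: u is C^k in A and all its partial
   derivatives of order <= k extend continuously to the closure. Only the values
   of u on the closure of A matter. *)
Definition Ck_closure (R : realType) (n : nat) (k : nat) (A : set 'rV[R]_n)
    (u : 'rV[R]_n -> R) : Prop :=
  [/\ {within closure A, continuous u},
      partials_exist k A u &
      forall s : seq 'I_n, (size s <= k)%N ->
        exists g : 'rV[R]_n -> R,
          {within closure A, continuous g} /\
          (forall x, A x -> g x = dpart s u x)].

Definition smooth_closure (R : realType) (n : nat) (A : set 'rV[R]_n)
    (u : 'rV[R]_n -> R) : Prop :=
  forall k : nat, Ck_closure k A u.

(* The gradient on the closure of A: at a boundary point, the value of the
   continuous extension from A (in A itself, the usual gradient when u is C^1). *)
Definition grad_closure (R : realType) (n : nat) (A : set 'rV[R]_n)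
    (u : 'rV[R]_n -> R) (x : 'rV[R]_n) : 'rV[R]_n :=
  \row_(i < n) lim (dpart [:: i] u y @[y --> within A (nbhs x)]).

(* For continuous functions on the closure of an open A this is the L^oo norm. *)
Definition sup_norm (R : realType) (n : nat) (A : set 'rV[R]_n)
    (u : 'rV[R]_n -> R) : \bar R :=
  ereal_sup [set (`|u x|)%:E | x in A].

Definition Ck_norm (R : realType) (n : nat) (k : nat) (A : set 'rV[R]_n)
    (u : 'rV[R]_n -> R) : \bar R :=
  ereal_sup [set sup_norm A (dpart s u) | s in [set s : seq 'I_n | (size s <= k)%N]].

(* l lists the eigenvalues of M with their multiplicities. *)
Definition eigenvalues (R : realType) (n : nat) (M : 'M[R]_n) (l : 'I_n -> R) :
    Prop :=
  char_poly M = \prod_(i < n) ('X - (l i)%:P).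

Definition domain (R : realType) (n : nat) (Om : set 'rV[R]_n) : Prop :=
  [/\ open Om, connected Om & Om !=set0].

(* rho is a smooth defining function of Om in the cube of radius r around p;
   since grad rho <> 0, the boundary of Om is {rho = 0} there. *)
Definition local_defining (R : realType) (n : nat) (Om : set 'rV[R]_n)
    (p : 'rV[R]_n) (r : R) (rho : 'rV[R]_n -> R) : Prop :=
  [/\ 0 < r,
      smooth_on (ball p r) rho,
      forall x, ball p r x -> grad rho x != 0 &
      forall x, ball p r x -> (Om x <-> rho x < 0)].

Definition smooth_boundary (R : realType) (n : nat) (Om : set 'rV[R]_n) : Prop :=
  forall p, boundary Om p -> exists r rho, local_defining Om p r rho.

Definition unit_grad (R : realType) (n : nat) (rho : 'rV[R]_n -> R)
    (x : 'rV[R]_n) : 'rV[R]_n :=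
  (enorm (grad rho x))^-1 *: grad rho x.

Definition outward_normal (R : realType) (n : nat) (Om : set 'rV[R]_n)
    (p nu : 'rV[R]_n) : Prop :=
  exists r rho, local_defining Om p r rho /\ nu = unit_grad rho p.

(* k is an eigenvalue of the shape operator v |-> D_v nu on the tangent space at
   the boundary point p, for the outward normal nu; spheres bounding balls have
   positive curvatures. *)
Definition principal_curvature (R : realType) (n : nat) (Om : set 'rV[R]_n)
    (p : 'rV[R]_n) (k : R) : Prop :=
  exists r rho, local_defining Om p r rho /\
    exists v : 'rV[R]_n,
      [/\ v != 0, dotp v (unit_grad rho p) = 0 &
          'D_v (unit_grad rho) p = k *: v].

Definition strictly_convex (R : realType) (n : nat) (Om : set 'rV[R]_n) : Prop :=
  forall p k, boundary Om p -> principal_curvature Om p k -> 0 < k.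

Definition curvatures_ge (R : realType) (n : nat) (Om : set 'rV[R]_n) (k0 : R) :
    Prop :=
  forall p k, boundary Om p -> principal_curvature Om p k -> k0 <= k.

(* Bound K on the C^2 geometry of Om: near each boundary point, on a scale 1/K,
   Om has a defining function with C^2 norm at most K and gradient of length at
   least 1/K. Only first and second derivatives are controlled. *)
Definition C2_boundary_le (R : realType) (n : nat) (Om : set 'rV[R]_n) (K : R) :
    Prop :=
  forall p, boundary Om p ->
    exists rho, [/\ local_defining Om p K^-1 rho,
      (Ck_norm 2 (ball p K^-1) rho <= K%:E)%E &
      forall x, ball p K^-1 x -> K^-1 <= enorm (grad rho x)].

Definition solves_neumann (R : realType) (n : nat) (Om : set 'rV[R]_n)
    (f phi : 'rV[R]_n -> R) (Theta eps : R) (u : 'rV[R]_n -> R) : Prop :=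
  (forall x, Om x -> exists l : 'I_n -> R,
      eigenvalues (hessian u x) l /\ \sum_(i < n) atan (l i / f x) = Theta) /\
  (forall x nu, boundary Om x -> outward_normal Om x nu ->
      dotp (grad_closure Om u x) nu = - eps * u x + phi x).

(* Main.v *)
Require Import Defs.
From mathcomp Require Import all_boot all_order all_algebra.
From mathcomp Require Import all_classical all_reals all_analysis.
From mathcomp Require Import ring lra.
Import Order.TTheory GRing.Theory Num.Theory.
Import numFieldNormedType.Exports.
Local Open Scope classical_set_scope.
Local Open Scope ring_scope.
Set Implicit Arguments.
Unset Strict Implicit.
Unset Printing Implicit Defensive.

(** Why the estimate holds.  Let [H] be the Hessian of [u] and [nu] the outward normal.

    The equation enters in two ways.  First, as [Theta >= (n - 2) pi / 2], no two eigenvalues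
    of [H] have a negative sum, so [H] has a nonnegative trace on every plane
    ([two_plane_trace_ge0]).  Secondly, the derivative of [H] in a unit direction cannot be
    very negative ([phase_third_derivative]): lowering all eigenvalues at unit speed lowers
    the phase at speed [\sum_i (1 + x i ^+ 2)^-1 / f], where [x i] are the quotients of the
    eigenvalues by [f], and this dominates the effect of the variation of [f], which is
    proportional to [\sum_i x i / (1 + x i ^+ 2)], by [phase_sum_bound].

    The hypotheses on the boundary give its convexity ([convex_domain]), a diameter of at
    most [2 / kappa] ([diameter_le]) and a ball in [Om] of controlled radius [r1] around some
    [x1] ([interior_ball]); by convexity [x - x1] has a normal component of at least [r1] at
    every boundary point [x] ([starshaped]).

    Comparison of [u] and [- u] with paraboloids bounds [eps * u], though not [u] itself
    ([neumann_upper_bound]).  The normal derivative of [u] is therefore bounded by a constant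
    [B0], and [v = u - A |x - x1|^2 / 2] with [A = B0 / r1] has a normal derivative
    between some [- B1] and 0.  The sign is the point of this choice.

    Consider a maximum of [|Dv| + A' |x - x1|^2 / 2] with a large constant [A'].  It is not
    interior, since there the derivative of [H] in the direction of [Dv] would be at most
    [- A'].  At a boundary maximum write [Dv = w + a nu] with [w] tangential.  Differentiating
    the Neumann condition along [w] gives [H(w, nu) <= C1 |w| - kappa |w|^2]; the quadratic
    term is the curvature of the boundary.  That the maximum has a nonnegative outward
    derivative bounds [H(w, nu) + a H(nu, nu)] from below by a term of first order in
    [|Dv|], so [a H(nu, nu)] is at least of the order of [|w|^2]; as [-B1 <= a <= 0],
    [H(nu, nu)] is very negative for a long [w].  The tangential first-order condition
    bounds [H(w, w)] by a multiple of [|w|^2].  Both together contradict the nonnegative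
    trace on the plane of [w] and [nu], unless [w] is bounded ([boundary_scalars]).

    Points of the closure are handled with first-order expansions relative to the closed
    domain ([has_grad]), which exist at boundary points because [Om] is convex
    ([has_grad_closure]). *)

(** * Euclidean length and sup norm *)

Section Euclid.
Context {R : realType} {n : nat}.
Implicit Types (u v w : 'rV[R]_n) (H : 'M[R]_n).

Lemma dotpE u v : dotp u v = (u *m v^T) 0 0.
Proof. by rewrite mxE; apply: eq_bigr => i _; rewrite mxE. Qed.
Lemma dotpC u v : dotp u v = dotp v u.
Proof. by apply: eq_bigr => i _; rewrite mulrC. Qed.
Lemma dotpDl u v w : dotp (u + v) w = dotp u w + dotp v w.
Proof. by rewrite !dotpE mulmxDl mxE. Qed.
Lemma dotpZl a u v : dotp (a *: u) v = a * dotp u v.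
Proof. by rewrite !dotpE -scalemxAl mxE. Qed.
Lemma dotpNl u v : dotp (- u) v = - dotp u v.
Proof. by rewrite -scaleN1r dotpZl mulN1r. Qed.
Lemma dotpBl u v w : dotp (u - v) w = dotp u w - dotp v w.
Proof. by rewrite dotpDl dotpNl. Qed.
Lemma dotp0l v : dotp 0 v = 0.
Proof. by rewrite -(scale0r 0) dotpZl mul0r. Qed.
Lemma dotpDr u v w : dotp u (v + w) = dotp u v + dotp u w.
Proof. by rewrite dotpC dotpDl !(dotpC u). Qed.
Lemma dotpZr a u v : dotp u (a *: v) = a * dotp u v.
Proof. by rewrite dotpC dotpZl dotpC. Qed.
Lemma dotpNr u v : dotp u (- v) = - dotp u v.
Proof. by rewrite dotpC dotpNl dotpC. Qed.
Lemma dotpBr u v w : dotp u (v - w) = dotp u v - dotp u w.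
Proof. by rewrite dotpDr dotpNr. Qed.
Lemma dotp0r v : dotp v 0 = 0.
Proof. by rewrite dotpC dotp0l. Qed.

Lemma dotp_sumr (I : finType) v (F : I -> 'rV[R]_n) : dotp v (\sum_i F i) = \sum_i dotp v (F i).
Proof. by elim/big_rec2 : _ => [|i a b _ <-]; rewrite ?dotp0r ?dotpDr. Qed.
Lemma dotp_deltal v i : dotp (delta_mx 0 i) v = v 0 i.
Proof.
rewrite /dotp (bigD1 i) //= mxE !eqxx mul1r big1 ?addr0 // => j ji.
by rewrite mxE (negbTE ji) andbF mul0r.
Qed.

Definition dotp_linE := (dotpDl, dotpDr, dotpBl, dotpBr, dotpNl, dotpNr, dotpZl, dotpZr, dotp0l, dotp0r).

Lemma dotp_ge0 v : 0 <= dotp v v.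
Proof. by apply: sumr_ge0 => i _; rewrite -expr2 sqr_ge0. Qed.
Lemma dotp_eq0 v : (dotp v v == 0) = (v == 0).
Proof.
apply/eqP/eqP => [h|->]; last exact: dotp0l.
apply/rowP => i; rewrite mxE; apply/eqP; rewrite -sqrf_eq0; apply/eqP.
move: h => /eqP; rewrite psumr_eq0 => [|j _]; last by rewrite -expr2 sqr_ge0.
by move/allP => /(_ i (mem_index_enum _)) /eqP <-; rewrite expr2.
Qed.
Lemma dotp_gt0 v : (0 < dotp v v) = (v != 0).
Proof. by rewrite lt0r dotp_eq0 dotp_ge0 andbT. Qed.
Lemma sqr_enorm v : enorm v ^+ 2 = dotp v v.
Proof. by rewrite sqr_sqrtr // dotp_ge0. Qed.
Lemma enorm_ge0 v : 0 <= enorm v.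
Proof. exact: sqrtr_ge0. Qed.
Lemma enorm_gt0 v : (0 < enorm v) = (v != 0).
Proof. by rewrite sqrtr_gt0 dotp_gt0. Qed.
Lemma enorm_eq0 v : (enorm v == 0) = (v == 0).
Proof. by rewrite -[LHS]negbK -[RHS]negbK -enorm_gt0 lt0r enorm_ge0 andbT. Qed.
Lemma enormZ a v : enorm (a *: v) = `|a| * enorm v.
Proof. by rewrite /enorm dotpZl dotpZr mulrA -expr2 sqrtrM ?sqr_ge0 // sqrtr_sqr. Qed.
Lemma enormN v : enorm (- v) = enorm v.
Proof. by rewrite -scaleN1r enormZ normrN1 mul1r. Qed.

Lemma dotp_le u v : dotp u v <= enorm u * enorm v.
Proof.
have [->|u0] := eqVneq u 0; first by rewrite dotp0l mulr_ge0 // enorm_ge0.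
have [->|v0] := eqVneq v 0; first by rewrite dotp0r mulr_ge0 // enorm_ge0.
move: u0 v0; rewrite -!enorm_gt0 => u0 v0.
set w := (enorm u)^-1 *: u - (enorm v)^-1 *: v.
rewrite -subr_ge0; have -> : enorm u * enorm v - dotp u v =
  (enorm u * enorm v) / 2 * dotp w w.
  rewrite /w !dotp_linE -!sqr_enorm (dotpC v u).
  by field; rewrite !gt_eqF.
apply: mulr_ge0 (dotp_ge0 _).
by apply: divr_ge0 => //; apply: mulr_ge0; apply: ltW.
Qed.
Lemma enormD u v : enorm (u + v) <= enorm u + enorm v.
Proof.
rewrite -(ler_pXn2r (n:=2)) ?nnegrE ?addr_ge0 ?enorm_ge0 //.
rewrite sqr_enorm !dotp_linE -!sqr_enorm (dotpC v u).
by have := dotp_le u v; nra.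
Qed.
Lemma enormB u v : enorm (u - v) <= enorm u + enorm v.
Proof. by rewrite -(enormN v) enormD. Qed.

(** Neighbourhoods are measured in the sup norm, lengths and curvatures in the Euclidean one;
    these comparisons pass between the two. *)
Lemma coord_le_enorm v i : `|v 0 i| <= enorm v.
Proof.
rewrite -sqrtr_sqr ler_wsqrtr // /dotp (bigD1 i) //= -expr2 lerDl.
by apply: sumr_ge0 => j _; rewrite -expr2 sqr_ge0.
Qed.
Lemma coord_le_norm v i : `|v 0 i| <= `|v|.
Proof.
by rewrite /Num.norm/= mx_normrE; apply: (le_bigmax _ (fun ij => `|v ij.1 ij.2|) (0, i)).
Qed.
Lemma norm_rV_le v (c : R) : 0 <= c -> (forall i, `|v 0 i| <= c) -> `|v| <= c.
Proof.
move=> c0 vc; rewrite [leLHS]/Num.norm /= mx_normrE; apply: bigmax_le => // -[i j] _.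
by rewrite /= (ord1 i).
Qed.
Lemma norm_delta_le1 i : `|delta_mx 0 i : 'rV[R]_n| <= 1.
Proof. by apply: norm_rV_le => // j; rewrite mxE; case: (_ && _); rewrite ?normr1 ?normr0. Qed.
Lemma norm_le_enorm v : `|v| <= enorm v.
Proof. by apply: norm_rV_le (enorm_ge0 v) (coord_le_enorm v). Qed.
Lemma dotp_le_norm u v : `|dotp u v| <= n%:R * (`|u| * `|v|).
Proof.
apply: le_trans (ler_norm_sum _ _ _) _.
apply: le_trans (_ : \sum_(i < n) (`|u| * `|v|) <= _); last first.
  by rewrite sumr_const card_ord -[X in X <= _]mulr_natl.
by apply: ler_sum => i _; rewrite normrM ler_pM ?coord_le_norm.
Qed.
Lemma enorm_le_norm v : enorm v <= n%:R * `|v|.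
Proof.
rewrite -(ler_pXn2r (n:=2)) ?nnegrE ?mulr_ge0 ?enorm_ge0 //.
rewrite sqr_enorm; apply: le_trans (ler_norm _) _.
apply: le_trans (dotp_le_norm _ _) _; rewrite exprMn.
rewrite -expr2 ler_wpM2r ?sqr_ge0 // -natrX ler_nat.
by case: (n) => // k; rewrite expnS leq_pmulr // expn1.
Qed.

Lemma dotp_normalize v : v != 0 -> dotp ((enorm v)^-1 *: v) ((enorm v)^-1 *: v) = 1.
Proof. by move=> v0; rewrite dotpZl dotpZr -sqr_enorm; field; rewrite enorm_eq0. Qed.
Lemma dotp_unit_le v w (D : R) : dotp w w = 1 -> enorm v <= D -> dotp v w <= D.
Proof.
move=> w1 vD; apply: le_trans (dotp_le _ _) _.
by rewrite [enorm w]/enorm w1 sqrtr1 mulr1.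
Qed.
Lemma dotp_ge v w (D : R) : enorm v <= D -> - (D * enorm w) <= dotp v w.
Proof.
move=> vD; rewrite lerNl -dotpNl; apply: le_trans (dotp_le _ _) _.
by rewrite enormN ler_wpM2r // enorm_ge0.
Qed.

Lemma dotp_mulmx_sym v w H : H^T = H -> dotp (v *m H) w = dotp (w *m H) v.
Proof.
move=> symH; rewrite !dotpE; transitivity ((v *m H *m w^T)^T 0 0); first by rewrite [RHS]mxE.
by rewrite !trmx_mul trmxK symH mulmxA.
Qed.

(** Estimates made coordinate by coordinate become uniform in the coordinates through this
    lemma; [N] is a distance to the point under consideration. *)
Lemma common_radius (I : finType) (T : Type) (N : T -> R) (P : I -> T -> Prop) :
  (forall i, exists2 d : R, 0 < d & forall y, N y < d -> P i y) ->
  exists2 d : R, 0 < d & forall i y, N y < d -> P i y.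
Proof.
move=> hP; have /choice [d hd] : forall i, exists d : R, 0 < d /\ forall y, N y < d -> P i y.
  by move=> i; have [d d0 hd] := hP i; exists d.
exists (\big[Num.min/1]_i d i).
  by apply/bigmin_gtP; split=> [|i _]; [exact: ltr01 | case: (hd i)].
by move=> i y /bigmin_gtP [_ yd]; exact: (hd i).2 _ (yd i isT).
Qed.
End Euclid.

(** * Sums of arctangents *)

Section Arctangent.
Context {R : realType}.
Implicit Types x t : R.

Lemma atan_above t : t < pi / 2 -> exists2 X : R, 0 <= X & t < atan X.
Proof.
move=> tpi; pose s := Num.max t 0.
have pi0 : 0 < pi / 2 :> R by rewrite divr_gt0 // pi_gt0.
have [st s0] : t <= s /\ 0 <= s by rewrite /s !le_max !lexx orbT.
have spi : s < pi / 2 by rewrite /s gt_max tpi.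
have itv : (s + pi / 2) / 2 \in `](- (pi / 2)), (pi / 2)[.
  by rewrite in_itv /=; lra.
have K := tanK itv.
exists (tan ((s + pi / 2) / 2)); last by rewrite K; lra.
rewrite leNgt; apply/negP => /lt_atan; rewrite K atan0; lra.
Qed.

Lemma atan_inv x : 0 < x -> atan x^-1 = pi / 2 - atan x.
Proof.
move=> x0; have := lt_atan x0; rewrite atan0 => a0.
rewrite -[RHS]tanK; last first.
  by rewrite in_itv /=; have := atan_ltpi2 x; have := pi_gt0 R; lra.
have -> : pi / 2 - atan x = - (atan x - pi / 2) by rewrite opprB.
rewrite /tan sinN cosN sinBpihalf cosBpihalf opprK.
by rewrite -[in LHS](atanK x) /tan invf_div.
Qed.

(** By the mean value theorem [atan z] is [z] times a slope of atan on [0, z], and such a slope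
    lies between [1 / (1 + z ^+ 2)] and 1. *)
Lemma atan_ge0_approx (z : R) : 0 <= z -> atan z <= z /\ `|z / (1 + z ^+ 2) - atan z| <= z ^+ 3.
Proof.
move=> z0; have [c] : exists2 c, c \in `[0, z]%R & atan z - atan 0 = (1 + c ^+ 2)^-1 * (z - 0).
  apply: MVT_segment => //.
  by apply: derivable_within_continuous => x _; exact: derivable_atan.
rewrite atan0 !subr0 in_itv /= => /andP[c0 cz] ->.
have c1 : 0 < 1 + c ^+ 2 by nra.
have z1 : 0 < 1 + z ^+ 2 by nra.
have h1 : (1 + c ^+ 2)^-1 <= 1 by rewrite invf_le1 //; nra.
have h2 : (1 + z ^+ 2)^-1 <= (1 + c ^+ 2)^-1 by rewrite lef_pV2 ?posrE //; nra.
have h3 : 1 - z ^+ 2 <= (1 + z ^+ 2)^-1 by rewrite -[leRHS]mul1r ler_pdivlMr //; nra.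
split; first by nra.
have -> : z / (1 + z ^+ 2) - (1 + c ^+ 2)^-1 * z =
    z * ((1 + z ^+ 2)^-1 - (1 + c ^+ 2)^-1) by ring.
rewrite normrM (ger0_norm z0) ler0_norm; last by lra.
by rewrite (exprS z 2) ler_wpM2l //; lra.
Qed.

Lemma rational_part_bound x : `|x / (1 + x ^+ 2)| <= 1.
Proof.
have x1 : 0 < 1 + x ^+ 2 by nra.
rewrite normrM normfV (gtr0_norm x1) ler_pdivrMr // mul1r ler_norml.
by apply/andP; split; nra.
Qed.

Section PhaseSum.
Variables (n : nat) (Theta : R) (hn : (2 <= n)%N).
Hypothesis (hTheta : (n%:R - 2) * pi / 2 <= Theta < n%:R * pi / 2).

(** Put [T = \sum_i (1 + x i ^+ 2)^-1]; the left side is at most [n], so one bounded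
    entry [x k] suffices, its term bounding [T] below.  The least entry [x k] is at most
    [X], because the mean of the arctangents is below pi/2.  If it is very negative, the
    hypothesis on [Theta] forces every other entry to be at least [- x k].  With [z i] the inverse
    of [|x i|], the summands are [+- z i] up to [z i ^+ 3], hence [+- atan (z i)] up to
    the order of [z k ^+ 2], and the signed sum of the [atan (z i)] equals [- g], where
    [g] is the excess of [Theta] over [(n - 2) pi / 2].  If [g = 0], only the error
    remains, and it is comparable with [(1 + x k ^+ 2)^-1]; if [g > 0], then
    [g <= atan (z k)] keeps [x k] bounded after all. *)
Lemma phase_sum_bound : exists2 C : R, 0 <= C &
  forall x : 'I_n -> R, \sum_i atan (x i) = Theta ->
    `|\sum_i x i / (1 + x i ^+ 2)| <= C * \sum_i (1 + x i ^+ 2)^-1.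
Proof.
have /andP[hT1 hT2] := hTheta.
have n0 : 0 < n%:R :> R by rewrite ltr0n (leq_trans _ hn).
have [X X0 hX] : exists2 X : R, 0 <= X & Theta / n%:R < atan X.
  by apply: atan_above; rewrite ltr_pdivrMr //; lra.
pose g := Theta - (n%:R - 2) * pi / 2.
have g0 : 0 <= g by rewrite /g; lra.
have sq0 (y : R) : 0 < 1 + y ^+ 2 by nra.
exists (n%:R * (1 + X ^+ 2) + n%:R * 4 + n%:R * (1 + g^-1 ^+ 2)).
  by rewrite !addr_ge0 // mulr_ge0 // ltW.
move=> x xT; set S := \sum_i _; set T := \sum_i (1 + _)^-1.
have Tk k : (1 + x k ^+ 2)^-1 <= T.
  by rewrite /T (bigD1 k) //= lerDl; apply: sumr_ge0 => i _; rewrite invr_ge0 ltW.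
have Sn : `|S| <= n%:R.
  apply: le_trans (ler_norm_sum _ _ _) _.
  apply: le_trans (_ : \sum_(i < n) 1 <= _); first by apply: ler_sum => i _; exact: rational_part_bound.
  by rewrite sumr_const card_ord.
(* one bounded entry suffices *)
have bounded_case k (Y : R) : `|x k| <= Y -> `|S| <= n%:R * (1 + Y ^+ 2) * T.
  move=> xY; apply: le_trans Sn _; rewrite -mulrA ler_peMr ?(ltW n0) //.
  have Y1 := sq0 Y; rewrite -[leLHS](mulfV (lt0r_neq0 Y1)) ler_pM2l //.
  apply: le_trans (Tk k); rewrite lef_pV2 ?posrE // lerD2l -[x k ^+ 2]real_normK ?num_real //.
  by rewrite ler_pXn2r ?nnegrE //; apply: le_trans xY.
have T0 : 0 <= T by apply: sumr_ge0 => i _; rewrite invr_ge0 ltW.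
have [C1 C2 C3] : [/\ 0 <= n%:R * (1 + X ^+ 2) * T, 0 <= n%:R * 4 * T & 0 <= n%:R * (1 + g^-1 ^+ 2) * T].
  by split; rewrite !mulr_ge0 // ltW.
rewrite !mulrDl.
case: (@arg_minP _ _ _ (Ordinal (leq_trans (isT : (0 < 2)%N) hn) : 'I_n) xpredT x isT) => k _ kmin.
have xkX : x k <= X.
  rewrite leNgt; apply/negP => Xk.
  have : \sum_(i < n) atan X <= Theta.
    rewrite -xT; apply: ler_sum => i _; apply: le_atan.
    exact: le_trans (ltW Xk) (kmin i isT).
  by rewrite sumr_const card_ord -mulr_natl -ler_pdivlMl // mulrC leNgt hX.
have [xk1|xk1] := lerP (-1) (x k).
  have [xk0|xk0] := lerP 0 (x k).
    have := bounded_case k X; rewrite ger0_norm // => /(_ xkX); lra.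
  have := bounded_case k 1; rewrite ler0_norm; last lra.
  by move=> /(_ ltac:(lra)); rewrite expr1n; lra.
pose z i := if i == k then (- x k)^-1 else (x i)^-1.
have zk : z k = (- x k)^-1 by rewrite /z eqxx.
have zk01 : 0 < z k <= 1 by rewrite zk invr_gt0 invf_le1; lra.
have sumw : \sum_(i | i != k) (pi / 2 - atan (x i)) = atan (z k) - g.
  rewrite zk atan_inv; last lra.
  rewrite sumrB atanN /g -[in RHS]xT [in RHS](bigD1 k) //=.
  rewrite sumr_const cardC1 card_ord.
  have -> : (pi / 2) *+ n.-1 = (n%:R - 1) * (pi / 2) :> R.
    by rewrite -mulr_natl -subn1 natrB // (ltnW hn).
  lra.
have w0 i : 0 < pi / 2 - atan (x i) by have := atan_ltpi2 (x i); lra.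
have gz : g <= atan (z k).
  by rewrite -subr_ge0 -sumw; apply: sumr_ge0 => i _; apply: ltW.
(* no other arctangent misses pi/2 by more than atan (x k) exceeds - pi/2 *)
have xi i : i != k -> - x k <= x i.
  move=> ik; have : pi / 2 - atan (x i) <= atan (z k).
    apply: le_trans (_ : \sum_(i | i != k) (pi / 2 - atan (x i)) <= _); last by rewrite sumw; lra.
    by rewrite (bigD1 i) //= lerDl; apply: sumr_ge0 => j _; apply: ltW.
  rewrite zk atan_inv; last lra.
  move=> h; rewrite leNgt; apply/negP => /lt_atan; lra.
have hz i : `|x i / (1 + x i ^+ 2) - (if i == k then - atan (z i) else atan (z i))| <= z k ^+ 2.
  have zi : 0 <= z i <= z k.
    have [->|ik] := eqVneq i k; first lra.
    have := xi i ik => h; rewrite zk /z (negbTE ik) invr_ge0 lef_pV2 ?posrE; lra.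
  have zcub : z i ^+ 3 <= z k ^+ 2.
    apply: le_trans (_ : z i ^+ 2 <= _); last by nra.
    by rewrite exprS ler_piMl ?sqr_ge0 //; lra.
  have [_ h] := atan_ge0_approx (proj1 (andP zi)).
  have E (y : R) : y != 0 -> y^-1 / (1 + y^-1 ^+ 2) = y / (1 + y ^+ 2).
    by move=> y0; field; rewrite y0 !gt_eqF //; have := sq0 y; rewrite addrC.
  apply: le_trans zcub; apply: le_trans h.
  have [ik|ik] := eqVneq i k.
    rewrite ik zk E; last by lra.
    by rewrite sqrrN mulNr -normrN opprD !opprK.
  by rewrite /z (negbTE ik) E //; have := xi i ik; lra.
have Sle : `|S| <= g + n%:R * z k ^+ 2.
  pose s := \sum_i (if i == k then - atan (z i) else atan (z i)).
  have sE : s = - g.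
    rewrite /s (bigD1 k) //= eqxx (eq_bigr (fun i => pi / 2 - atan (x i))) ?sumw; first lra.
    by move=> i ik; rewrite (negbTE ik) /z (negbTE ik) atan_inv //; have := xi i ik; lra.
  rewrite -(subrK s S); apply: le_trans (ler_normD _ _) _.
  rewrite sE normrN (ger0_norm g0) addrC lerD2l opprK -(opprK g) -sE -sumrB.
  apply: le_trans (ler_norm_sum _ _ _) _.
  apply: le_trans (_ : \sum_(i < n) z k ^+ 2 <= _); first by apply: ler_sum => i _; exact: hz.
  by rewrite sumr_const card_ord mulr_natl.
have [g00|gp] := eqVneq g 0.
  apply: le_trans Sle _; rewrite g00 add0r.
  suff : n%:R * z k ^+ 2 <= n%:R * 4 * T by lra.
  rewrite -mulrA ler_pM2l //; apply: le_trans (_ : 4 * (1 + x k ^+ 2)^-1 <= _); last by rewrite ler_pM2l.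
  have -> : x k ^+ 2 = (z k ^+ 2)^-1 by rewrite zk exprVn invrK sqrrN.
  have : z k ^+ 2 <= 1 by nra.
  have : 0 < z k ^+ 2 by nra.
  move: (z k ^+ 2) => q q0 q1.
  rewrite ler_pdivlMr; last by rewrite addr_gt0 ?invr_gt0.
  by rewrite mulrDr mulfV ?gt_eqF //; nra.
have gpos : 0 < g by rewrite lt0r gp.
have := bounded_case k g^-1; rewrite ler0_norm; last lra.
have : - x k <= g^-1.
  rewrite -[leLHS]invrK -zk lef_pV2 ?posrE; [|lra|lra].
  apply: le_trans gz _.
  by have [] := atan_ge0_approx (_ : 0 <= z k); lra.
by move=> h /(_ h); lra.
Qed.
End PhaseSum.
End Arctangent.

(** * Eigenvalues of real symmetric matrices *)

Section Spectral.
Context {R : realType}.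

(** [P] is the reflection that exchanges [v] with the first basis vector; being a symmetric
    involution, it is its own inverse. *)
Lemma householder n (v : 'rV[R]_n.+1) : dotp v v = 1 ->
  exists P : 'M[R]_n.+1, [/\ P^T = P, P *m P = 1%:M & delta_mx 0 0 *m P = v].
Proof.
move=> v1; pose e : 'rV[R]_n.+1 := delta_mx 0 0.
have e1 (w : 'rV[R]_n.+1) : dotp e w = w 0 0 by exact: dotp_deltal.
have [ve|ve] := eqVneq v e.
  by exists 1%:M; rewrite trmx1 mulmx1 mulmx1 ve.
pose w := v - e; pose c := dotp w w.
have c0 : c != 0 by rewrite dotp_eq0 subr_eq0.
have cE : c = 2 - 2 * v 0 0.
  by rewrite /c /w dotpBl !dotpBr v1 (dotpC v e) !e1 /e mxE !eqxx /=; ring.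
have ww : w *m w^T = c%:M by rewrite [LHS]mx11_scalar -dotpE.
have wE : w = v - e by [].
clearbody c; clearbody w.
pose P := 1%:M - (2 / c) *: (w^T *m w).
exists P; split.
- by rewrite /P linearB /= trmx1 linearZ /= trmx_mul trmxK.
- rewrite /P mulmxBl mul1mx mulmxBr mulmx1 -scalemxAl -scalemxAr.
  rewrite mulmxA -(mulmxA w^T) ww mul_mx_scalar -scalemxAl !scalerA.
  have -> : 2 / c * (2 / c * c) = 2 / c + 2 / c by field.
  rewrite scalerDl; move: (_ *: (_ *m _)) => K.
  by rewrite opprB addrK subrK.
rewrite -/e /P mulmxBr mulmx1 -scalemxAr mulmxA [e *m w^T]mx11_scalar -dotpE e1.
rewrite mul_scalar_mx scalerA.
have -> : 2 / c * w 0 0 = -1.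
  rewrite wE !mxE !eqxx /= cE; field; rewrite -cE //.
by rewrite scaleN1r opprK wE addrC subrK.
Qed.

(** Deflation: a reflection moves a unit eigenvector for the first listed eigenvalue to the
    first basis vector, which leaves a block matrix.  Following the list [l] keeps the diagonal
    in the given order. *)
Lemma spectral_real n (H : 'M[R]_n) (l : 'I_n -> R) : H^T = H -> eigenvalues H l ->
  exists Q : 'M[R]_n, Q *m Q^T = 1%:M /\ H = Q^T *m diag_mx (\row_i l i) *m Q.
Proof.
elim: n H l => [|n IH] H l symH eigH.
  by exists 1%:M; split; apply/matrixP => -[].
have [v vH v1] : exists2 v : 'rV[R]_n.+1, v *m H = l 0 *: v & dotp v v = 1.
  have : root (char_poly H) (l 0).
    by rewrite eigH big_ord_recl rootM root_XsubC eqxx.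
  rewrite -eigenvalue_root_char => /eigenvalueP [v vH v0].
  exists ((enorm v)^-1 *: v); first by rewrite -scalemxAl vH !scalerA mulrC.
  exact: dotp_normalize.
have [P [symP PP Pv]] := householder v1.
pose H' : 'M[R]_(1 + n) := P *m H *m P.
have symH' : H'^T = H' by rewrite /H' !trmx_mul symP symH mulmxA.
have H'e : (delta_mx 0 0 : 'rV_(1 + n)) *m H' = l 0 *: delta_mx 0 0.
  by rewrite /H' !mulmxA Pv vH -scalemxAl -Pv -mulmxA PP mulmx1.
have cpH : char_poly H = char_poly H'.
  have PPp : map_mx polyC P *m map_mx polyC P = 1%:M by rewrite -map_mxM PP map_mx1.
  rewrite /char_poly.
  have -> : char_poly_mx H' = map_mx polyC P *m char_poly_mx H *m map_mx polyC P.
    rewrite /char_poly_mx mulmxBr mulmxBl !map_mxM /=.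
    by rewrite mul_mx_scalar -scalemxAl PPp scale_scalar_mx mulr1.
  by rewrite !det_mulmx [RHS]mulrAC -det_mulmx PPp det1 mul1r.
have HE : H = P *m H' *m P by rewrite /H' !mulmxA PP mul1mx -mulmxA PP mulmx1.
clearbody H'.
have H'0 j : H' 0 j = l 0 *+ (0 == j).
  have /rowP/(_ j) := H'e; rewrite -rowE !mxE => ->.
  by rewrite eqxx eq_sym /=; case: (_ == _); rewrite /= ?mulr1 ?mulr0.
pose H1 := drsubmx H'.
have H'E : H' = block_mx (l 0)%:M 0 0 H1.
  rewrite -[H']submxK; congr block_mx.
  - apply/matrixP => i j; rewrite !ord1 !mxE.
    have -> : lshift n (0 : 'I_1) = 0 by apply: val_inj.
    by rewrite H'0 !eqxx.
  - apply/matrixP => i j; rewrite ord1 !mxE.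
    have -> : lshift n (0 : 'I_1) = 0 by apply: val_inj.
    by rewrite H'0.
  - apply/matrixP => i j; rewrite ord1 !mxE -symH' mxE.
    have -> : lshift n (0 : 'I_1) = 0 by apply: val_inj.
    by rewrite H'0.
have symH1 : H1^T = H1.
  by have := symH'; rewrite {1}H'E tr_block_mx H'E => /eq_block_mx [].
have eigH1 : eigenvalues H1 (fun i => l (lift 0 i)).
  have : char_poly H' = ('X - (l 0)%:P) * char_poly H1.
    rewrite H'E /char_poly char_block_diag_mx det_ublock; congr (_ * _).
    by rewrite /char_poly_mx det_mx11 !mxE.
  rewrite -cpH eigH big_ord_recl => E.
  by apply: (@mulfI _ ('X - (l 0)%:P)); [rewrite polyXsubC_eq0 | exact: esym E].
have [Q1 [QQ1 H1E]] := IH H1 _ symH1 eigH1.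
pose B : 'M[R]_(1 + n) := block_mx 1%:M 0 0 Q1.
have BB : B *m B^T = 1%:M.
  rewrite /B tr_block_mx mulmx_block !trmx0 trmx1 !mulmx0 !mul0mx !addr0 !add0r mulmx1 QQ1.
  by rewrite -scalar_mx_block.
exists (B *m P); split.
  by rewrite trmx_mul symP mulmxA -(mulmxA B) PP mulmx1 BB.
rewrite HE.
have DE (D : 'M[R]_(1 + n)) : D = diag_mx (\row_i l i) ->
    D = block_mx (l 0)%:M 0 0 (diag_mx (\row_i l (lift 0 i))).
  move=> DE; rewrite -[LHS](submxK D); congr block_mx; apply/matrixP => i j;
    rewrite ?ord1 DE !mxE //=.
  - by rewrite (_ : lshift n (0 : 'I_1) = 0) //; apply: val_inj.
  - by rewrite -[rshift 1 i == _](inj_eq val_inj) /= -(inj_eq val_inj i) /= eqSS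
       (_ : rshift 1 i = lift 0 i) //; apply: val_inj.
rewrite (DE _ erefl); set D := block_mx _ _ _ _.
have -> : (B *m P)^T *m D *m (B *m P) = P *m (B^T *m D *m B) *m P.
  by rewrite trmx_mul symP !mulmxA.
congr (_ *m _ *m _); rewrite /D.
rewrite H'E /B tr_block_mx !mulmx_block !trmx0 trmx1.
by rewrite !mulmx0 !mul0mx !addr0 !add0r mul1mx mulmx1 !mul0mx -H1E.
Qed.

Lemma dotp_orthogonal n (Q : 'M[R]_n) (v w : 'rV[R]_n) : Q *m Q^T = 1%:M ->
  dotp (v *m Q^T) (w *m Q^T) = dotp v w.
Proof.
move=> QQ; have [_ QQ'] := mulmx1_unit QQ.
by rewrite !dotpE trmx_mul trmxK mulmxA -(mulmxA v) (mulmx1C QQ) mulmx1.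
Qed.

Lemma quadratic_form_spectral n (H Q : 'M[R]_n) (l : 'I_n -> R) (v : 'rV[R]_n) :
  H = Q^T *m diag_mx (\row_i l i) *m Q ->
  dotp (v *m H) v = \sum_i l i * ((v *m Q^T) 0 i) ^+ 2.
Proof.
move=> ->; rewrite dotpE !mulmxA -mulmxA.
have -> : Q *m v^T = (v *m Q^T)^T by rewrite trmx_mul trmxK.
rewrite -dotpE; apply: eq_bigr => i _.
by rewrite mul_mx_diag !mxE expr2; ring.
Qed.

(** The dimension count behind the comparison of eigenvalues. *)
Lemma common_kernel n m (M : 'M[R]_(n, m)) : (m < n)%N ->
  exists2 v : 'rV[R]_n, v != 0 & v *m M = 0.
Proof.
move=> mn; have : kermx M != 0.
  rewrite kermx_eq0 /row_free neq_ltn (leq_ltn_trans (rank_leq_col M)) //.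
by move=> /rowV0Pn [v /sub_kermxP vM v0]; exists v.
Qed.

(** Otherwise some nonzero vector would lie both in the span of the eigenvectors of [H1] with
    eigenvalue above [x] and in that of the eigenvectors of [H0] with eigenvalue at most [x +
    d], and the two quadratic forms at this vector would contradict the hypothesis. *)
Lemma eigenvalue_count n (H0 H1 : 'M[R]_n) (l0 l1 : 'I_n -> R) (d x : R) :
  H0^T = H0 -> H1^T = H1 -> eigenvalues H0 l0 -> eigenvalues H1 l1 ->
  (forall v, dotp (v *m H1) v <= dotp (v *m H0) v - d * dotp v v) ->
  (#|[pred i | (x < l1 i)%R]| <= #|[pred i | (x < l0 i - d)%R]|)%N.
Proof.
move=> s0 s1 e0 e1 le10.
have [Q0 [QQ0 H0E]] := spectral_real s0 e0.
have [Q1 [QQ1 H1E]] := spectral_real s1 e1.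
rewrite leqNgt; apply/negP => lt01.
pose I := [pred i | ~~ (x < l1 i)]; pose J := [pred i | (x < l0 i - d)%R].
pose M := row_mx (\matrix_(i < n, k < #|I|) Q1 (enum_val k) i)
                 (\matrix_(i < n, k < #|J|) Q0 (enum_val k) i).
have [] := common_kernel M.
  have : (#|I| + #|J| < #|[pred i | (x < l1 i)%R]| + #|I|)%N by rewrite addnC ltn_add2r.
  by rewrite cardC card_ord.
move=> v v0; rewrite mul_mx_row => /eqP; rewrite row_mx_eq0 => /andP[/eqP vI /eqP vJ].
have cI i : ~~ (x < l1 i) -> (v *m Q1^T) 0 i = 0.
  move=> iI; have /rowP/(_ (enum_rank_in (iI : i \in I) i)) := vI.
  rewrite !mxE => E; rewrite -[RHS]E; apply: eq_bigr => j _.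
  by rewrite !mxE enum_rankK_in.
have cJ i : x < l0 i - d -> (v *m Q0^T) 0 i = 0.
  move=> iJ; have /rowP/(_ (enum_rank_in (iJ : i \in J) i)) := vJ.
  rewrite !mxE => E; rewrite -[RHS]E; apply: eq_bigr => j _.
  by rewrite !mxE enum_rankK_in.
have := le10 v; rewrite leNgt => /negP; apply.
rewrite (quadratic_form_spectral _ H0E) (quadratic_form_spectral _ H1E).
apply: le_lt_trans (_ : x * dotp v v < _).
  rewrite -{1}(dotp_orthogonal v v QQ0) -(dotp_orthogonal v v QQ0).
  rewrite /dotp !mulr_sumr -sumrB; apply: ler_sum => i _.
  have [iJ|iJ] := ltP x (l0 i - d); first by rewrite cJ // !expr2 !mulr0 subrr.
  by have := sqr_ge0 ((v *m Q0^T) 0 i); nra.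
have vn0 : v *m Q1^T != 0 by rewrite -dotp_eq0 dotp_orthogonal // dotp_eq0.
have [k vk] : exists k, (v *m Q1^T) 0 k != 0.
  apply/existsP; apply: contraNT vn0; rewrite negb_exists => /forallP h.
  by apply/eqP/rowP => i; rewrite [RHS]mxE; apply/eqP; move: (h i); rewrite negbK.
rewrite -(dotp_orthogonal v v QQ1) /dotp mulr_sumr (bigD1 k) //= [X in _ < X](bigD1 k) //=.
apply: ltr_leD.
  have [xk|xk] := ltP x (l1 k); last by case/negP: vk; apply/eqP/cI; rewrite -leNgt.
  have : 0 < ((v *m Q1^T) 0 k) ^+ 2 by rewrite exprn_even_gt0.
  by rewrite expr2; nra.
apply: ler_sum => i _; have [xi|xi] := ltP x (l1 i); last by rewrite cI -?leNgt // !expr2 !mulr0.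
by have := sqr_ge0 ((v *m Q1^T) 0 i); nra.
Qed.

(** After sorting, the entries are compared place by place: if the [k]-th one of [a] exceeded
    that of [b], counting the entries above the latter would contradict the hypothesis. *)
Lemma sum_le_of_count n (a b : 'I_n -> R) (g : R -> R) :
  {homo g : x y / x <= y} ->
  (forall x, (#|[pred i | (x < a i)%R]| <= #|[pred i | (x < b i)%R]|)%N) ->
  \sum_i g (a i) <= \sum_i g (b i).
Proof.
move=> gm cnt.
pose st (c : 'I_n -> R) := sort <=%R (codom c).
have szc c : size (st c) = n by rewrite size_sort size_codom card_ord.
have sumst (c : 'I_n -> R) : \sum_i g (c i) = \sum_(k < n) g (nth 0 (st c) k).
  have -> : \sum_i g (c i) = \sum_(y <- codom c) g y by rewrite big_map enumT.
  rewrite (perm_big (st c)); last by rewrite perm_sym; apply/permPl/perm_sort.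
  by rewrite (big_nth 0) szc big_mkord.
have cntst (c : 'I_n -> R) x : count (fun y => x < y) (st c) = #|[pred i | (x < c i)%R]|.
  rewrite count_sort /codom /image_mem count_map cardE -size_filter.
  by rewrite /enum_mem -filter_predI; congr (size _); apply: eq_filter => i; rewrite /= !inE andbT.
have le_nth c i j : (i <= j)%N -> (j < n)%N -> nth 0 (st c) i <= nth 0 (st c) j.
  move=> ij jn; apply: (sorted_leq_nth le_trans le_refl); rewrite ?inE ?szc //.
    by apply: sort_sorted; exact: le_total.
  exact: leq_ltn_trans jn.
rewrite (sumst a) (sumst b); apply: ler_sum => k _; apply: gm.
rewrite leNgt; apply/negP => lt_ba.
have := cnt (nth 0 (st b) k); rewrite -!cntst leqNgt => /negP; apply.
set x := nth 0 (st b) k.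
have hb : (count (fun y => (x < y)%R) (st b) <= n - k.+1)%N.
  rewrite -(cat_take_drop k.+1 (st b)) count_cat.
  rewrite (_ : count _ (take _ _) = 0%N) ?add0n.
    by apply: leq_trans (count_size _ _) _; rewrite size_drop szc.
  apply/eqP; rewrite eqn0Ngt -has_count; apply/negP => /(has_nthP 0) [i].
  rewrite size_takel ?szc ?ltn_ord // ltnS => ik; rewrite nth_take ?ltnS //.
  by rewrite ltNge le_nth.
have ha : (n - k <= count (fun y => (x < y)%R) (st a))%N.
  have szd : size (drop k (st a)) = (n - k)%N by rewrite size_drop szc.
  rewrite -(cat_take_drop k (st a)) count_cat -szd.
  apply: leq_trans (leq_addl _ _); suff : all (fun y => (x < y)%R) (drop k (st a)).
    by rewrite all_count => /eqP ->.
  apply/(all_nthP 0) => i; rewrite size_drop szc => ik; rewrite nth_drop.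
  by apply: lt_le_trans lt_ba _; apply: le_nth; rewrite ?leq_addr // -ltn_subRL.
by apply: leq_ltn_trans hb (leq_trans _ ha); rewrite ltn_sub2l.
Qed.

(** Weyl's monotonicity of eigenvalues, summed up: in this form no ordering of the eigenvalues
    has to be followed from one matrix to the other. *)
Lemma loewner_sum n (H0 H1 : 'M[R]_n) (l0 l1 : 'I_n -> R) (d : R) (g : R -> R) :
  {homo g : x y / x <= y} ->
  H0^T = H0 -> H1^T = H1 -> eigenvalues H0 l0 -> eigenvalues H1 l1 ->
  (forall v, dotp (v *m H1) v <= dotp (v *m H0) v - d * dotp v v) ->
  \sum_i g (l1 i) <= \sum_i g (l0 i - d).
Proof.
move=> gm s0 s1 e0 e1 h; apply: (sum_le_of_count (b := fun i => l0 i - d)) gm _ => x.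
exact: eigenvalue_count h.
Qed.

(** The other [n - 2] arctangents are below pi/2, so the two of the pair have a nonnegative sum. *)
Lemma phase_pair_ge0 n (l : 'I_n -> R) (Theta f : R) i k : 0 < f ->
  (n%:R - 2) * pi / 2 <= Theta -> \sum_i atan (l i / f) = Theta -> i != k ->
  0 <= l i + l k.
Proof.
move=> f0 hT sumT ik.
have S : \sum_j (pi / 2 - atan (l j / f)) = n%:R * (pi / 2) - Theta.
  by rewrite sumrB sumT sumr_const card_ord -[X in X - _]mulr_natl.
have : - atan (l k / f) <= atan (l i / f).
  move: S; rewrite (bigD1 k) //= (bigD1 i) //= => S.
  have : 0 <= \sum_(j < n | (j != k) && (j != i)) (pi / 2 - atan (l j / f)).
    by apply: sumr_ge0 => j _; rewrite subr_ge0; apply/ltW/atan_ltpi2.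
  lra.
rewrite -atanN => h'.
have : - (l k / f) <= l i / f by rewrite leNgt; apply/negP => /lt_atan; lra.
by rewrite -mulNr ler_pM2r ?invr_gt0 //; lra.
Qed.

(** In an eigenbasis the trace on the plane is [\sum_i l i * w i] with weights between 0 and 1
    of total 2.  At most one eigenvalue [l k] is negative; each other one is at least [- l k],
    and together they carry the weight [2 - w k], which is at least [w k]. *)
Lemma two_plane_trace_ge0 n (H : 'M[R]_n) (l : 'I_n -> R) (Theta f : R) (e1 e2 : 'rV[R]_n) :
  H^T = H -> eigenvalues H l -> 0 < f ->
  (n%:R - 2) * pi / 2 <= Theta -> \sum_i atan (l i / f) = Theta ->
  dotp e1 e1 = 1 -> dotp e2 e2 = 1 -> dotp e1 e2 = 0 ->
  0 <= dotp (e1 *m H) e1 + dotp (e2 *m H) e2.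
Proof.
move=> symH eigH f0 hT sumT e11 e22 e12.
have [Q [QQ HE]] := spectral_real symH eigH.
rewrite !(quadratic_form_spectral _ HE) -big_split /=.
pose w i := ((e1 *m Q^T) 0 i) ^+ 2 + ((e2 *m Q^T) 0 i) ^+ 2.
rewrite (eq_bigr (fun i => l i * w i)); last by move=> i _; rewrite /w mulrDr.
have w2 : \sum_i w i = 2.
  rewrite big_split /= (_ : \sum_i _ = dotp e1 e1); last first.
    by rewrite -(dotp_orthogonal _ _ QQ) /dotp; apply: eq_bigr => i _; rewrite expr2.
  rewrite (_ : \sum_i _ = dotp e2 e2); last first.
    by rewrite -(dotp_orthogonal _ _ QQ) /dotp; apply: eq_bigr => i _; rewrite expr2.
  by rewrite e11 e22.
have w0 i : 0 <= w i by rewrite addr_ge0 // sqr_ge0.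
have w1 i : w i <= 1.
  pose q := row i Q; pose a := dotp e1 q; pose b := dotp e2 q.
  have qE e : (e *m Q^T) 0 i = dotp e q by rewrite mxE; apply: eq_bigr => j _; rewrite !mxE.
  have q1 : dotp q q = 1.
    transitivity ((Q *m Q^T) i i); last by rewrite QQ mxE eqxx.
    by rewrite mxE; apply: eq_bigr => j _; rewrite !mxE.
  rewrite /w !qE -/a -/b.
  have := dotp_ge0 (q - (a *: e1 + b *: e2)).
  rewrite !dotp_linE q1 e11 e22 e12 (dotpC e2 e1) e12 (dotpC q e1) (dotpC q e2) -/a -/b.
  by lra.
have [k lk|lpos] := pickP [pred k | l k < 0]; last first.
  by apply: sumr_ge0 => i _; rewrite mulr_ge0 // leNgt; have /= -> := lpos i.
rewrite (bigD1 k) //=.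
have : \sum_(i | i != k) - l k * w i <= \sum_(i | i != k) l i * w i.
  apply: ler_sum => i ik; rewrite ler_wpM2r //.
  have := phase_pair_ge0 f0 hT sumT ik; lra.
rewrite -mulr_sumr; move: w2; rewrite (bigD1 k) //= => w2.
by have := w1 k; move: lk => /=; nra.
Qed.

Lemma eigenvalue_ge n (H : 'M[R]_n) (l : 'I_n -> R) (B : R) :
  eigenvalues H l -> (forall v, B * dotp v v <= dotp (v *m H) v) ->
  forall i, B <= l i.
Proof.
move=> eigH hB i.
have : root (char_poly H) (l i).
  by rewrite eigH (bigD1 i) //= rootM root_XsubC eqxx.
rewrite -eigenvalue_root_char => /eigenvalueP [v vH v0].
by have := hB v; rewrite vH dotpZl ler_pM2r // dotp_gt0.
Qed.

End Spectral.

(** * First-order expansions relative to a set *)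

Section Gradients.
Context {R : realType} {n : nat}.
Implicit Types (A : set 'rV[R]_n) (h k : 'rV[R]_n -> R) (x y v w g : 'rV[R]_n).

(** With [A] the whole space this is differentiability at [x]; with [A] a closed domain and [x]
    on its boundary it is differentiability up to the boundary. *)
Definition has_grad A h x g := forall e : R, 0 < e ->
  exists2 d : R, 0 < d & forall y, A y -> `|y - x| < d ->
    `|h y - h x - dotp g (y - x)| <= e * `|y - x|.

(** One-sided neighbourhoods of 0, in the explicit form in which they combine with the radii of
    [has_grad]. *)
Definition right0 (P : R -> Prop) :=
  exists2 d : R, 0 < d & forall t, 0 < t < d -> P t.

(** Derivatives from the right at 0, for curves that stay in a domain for positive times only. *)
Definition rdiff {V : normedModType R} (c : R -> V) (x v : V) :=
  forall e : R, 0 < e -> right0 (fun t => `|c t - x - t *: v| <= e * t).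

Lemma half_pos (d : R) : 0 < d -> 0 < d / 2.
Proof. by move=> ?; lra. Qed.

Lemma right0_lt (d : R) : 0 < d -> right0 (fun t => 0 < t < d).
Proof. by move=> d0; exists d. Qed.

Lemma right0_and (P Q : R -> Prop) : right0 P -> right0 Q -> right0 (fun t => P t /\ Q t).
Proof.
move=> [d d0 hP] [d' d'0 hQ]; exists (Num.min d d'); first by rewrite lt_min d0.
by move=> t /andP[t0]; rewrite lt_min => /andP[td td']; split; [apply: hP|apply: hQ]; rewrite t0.
Qed.

Lemma right0_ex (P : R -> Prop) : right0 P -> exists2 t : R, 0 < t & P t.
Proof. by move=> [d d0 hd]; exists (d / 2); [lra | apply: hd; lra]. Qed.

Lemma has_grad_subset A B h x g : A `<=` B -> has_grad B h x g -> has_grad A h x g.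
Proof. by move=> AB hh e /hh [d d0 hd]; exists d => // y /AB; exact: hd. Qed.

Lemma has_grad_cst A (c : R) x : has_grad A (fun=> c) x 0.
Proof.
by move=> e e0; exists 1 => // y _ _; rewrite dotp0l subrr subr0 normr0 mulr_ge0 // ltW.
Qed.

Lemma has_gradD A h k x g g' : has_grad A h x g -> has_grad A k x g' ->
  has_grad A (fun y => h y + k y) x (g + g').
Proof.
move=> hh hk e e0; have [d d0 hd] := hh (e / 2) ltac:(lra).
have [d' d'0 hd'] := hk (e / 2) ltac:(lra).
exists (Num.min d d'); first by rewrite lt_min d0.
move=> y Ay; rewrite lt_min => /andP[yd yd'].
rewrite dotpDl (_ : _ - _ - _ = (h y - h x - dotp g (y - x)) + (k y - k x - dotp g' (y - x))); last ring.
apply: le_trans (ler_normD _ _) _; have := hd y Ay yd; have := hd' y Ay yd'; lra.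
Qed.

Lemma has_gradZ A (c : R) h x g : has_grad A h x g -> has_grad A (fun y => c * h y) x (c *: g).
Proof.
move=> hh e e0; have [d d0 hd] := hh (e / (`|c| + 1)) ltac:(by rewrite divr_gt0 // ltr_wpDl).
exists d => // y Ay yd; rewrite dotpZl -!mulrBr normrM.
have := hd y Ay yd => h1; have c1 : 0 < `|c| + 1 by rewrite ltr_wpDl.
apply: le_trans (_ : (`|c| + 1) * (e / (`|c| + 1) * `|y - x|) <= _).
  by apply: ler_pM => //; rewrite lerDl.
by rewrite !mulrA (mulrC _ e) mulrK // unitfE gt_eqF.
Qed.

Lemma has_grad_sum A (I : finType) (h : I -> 'rV[R]_n -> R) x (g : I -> 'rV[R]_n) :
  (forall i, has_grad A (h i) x (g i)) ->
  has_grad A (fun y => \sum_i h i y) x (\sum_i g i).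
Proof.
move=> hh; elim: (index_enum I) => [|i s IH].
  by rewrite big_nil (_ : (fun _ => _) = fun=> 0) ?funeqE => [|y]; rewrite ?big_nil //; exact: has_grad_cst.
rewrite big_cons (_ : (fun _ => _) = fun y => h i y + \sum_(j <- s) h j y).
  exact: has_gradD.
by rewrite funeqE => y; rewrite big_cons.
Qed.

Lemma has_grad_cont A h x g : has_grad A h x g -> forall e : R, 0 < e ->
  exists2 d : R, 0 < d & forall y, A y -> `|y - x| < d -> `|h y - h x| <= e.
Proof.
move=> hh e e0; have [d d0 hd] := hh 1 ltac:(lra).
pose L := n%:R * `|g| + 1; have L0 : 0 < L by rewrite /L ltr_wpDl // mulr_ge0.
exists (Num.min d (e / L)); first by rewrite lt_min d0 divr_gt0.
move=> y Ay; rewrite lt_min => /andP[yd ye].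
rewrite -(subrK (dotp g (y - x)) (h y - h x)); apply: le_trans (ler_normD _ _) _.
have := hd y Ay yd; have := dotp_le_norm g (y - x) => h1 h2.
move: ye; rewrite ltr_pdivlMr // /L => ye; nra.
Qed.

Lemma has_grad_comp A h x g (phi : R -> R) (d : R) :
  is_derive (h x) 1 phi d -> has_grad A h x g -> has_grad A (phi \o h) x (d *: g).
Proof.
move=> dphi hh e e0.
pose L := n%:R * `|g| + 1; have L0 : 0 < L by rewrite /L ltr_wpDl // mulr_ge0.
have e1 : 0 < e / (2 * L) by rewrite divr_gt0 // mulr_gt0.
have [d1 d10 hd1] : exists2 d1 : R, 0 < d1 & forall s, `|s| < d1 ->
    `|phi (h x + s) - phi (h x) - d * s| <= e / (2 * L) * `|s|.
  have : (fun s => s^-1 *: (phi (s *: 1 + h x) - phi (h x))) @ 0^' --> d.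
    by have [+ <-] := dphi.
  move=> /cvgrPdist_le /(_ _ e1); rewrite /prop_near1 /= => /nbhs_ballP [d1 /= d10 hd1].
  exists d1 => // s sd; have [->|s0] := eqVneq s 0.
    by rewrite addr0 subrr mulr0 subr0 normr0 mulr0.
  have := hd1 s; rewrite /ball /= sub0r normrN => /(_ sd s0).
  rewrite distrC [s *: 1]mulr1 [_ *: (_ : R)]mulrC (addrC s) -(ler_pM2r (_ : 0 < `|s|)) ?normr_gt0 //.
  by rewrite -normrM mulrBl divfK.
have [d2 d20 hd2] := has_grad_cont hh (half_pos d10).
have [d3 d30 hd3] := hh (Num.min 1 (e / (2 * (`|d| + 1)))) ltac:(by rewrite lt_min ltr01 divr_gt0 // mulr_gt0 // ltr_wpDl).
exists (Num.min d2 d3); first by rewrite lt_min d20.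
move=> y Ay; rewrite lt_min => /andP[y2 y3].
have h2 := hd2 y Ay y2; have h3 := hd3 y Ay y3.
have y1 : `|h y - h x| < d1 by lra.
have := hd1 _ y1; rewrite (addrC (h x) (h y - h x)) subrK /= => h1.
rewrite dotpZl.
have -> : phi (h y) - phi (h x) - d * dotp g (y - x) =
  (phi (h y) - phi (h x) - d * (h y - h x)) + d * (h y - h x - dotp g (y - x)) by ring.
apply: le_trans (ler_normD _ _) _; rewrite normrM.
have hL : `|h y - h x| <= L * `|y - x|.
  rewrite -(subrK (dotp g (y - x)) (h y - h x)); apply: le_trans (ler_normD _ _) _.
  have := dotp_le_norm g (y - x); have := ge_min 1 1 (e / (2 * (`|d| + 1))).
  rewrite lexx /= => m1 h4; rewrite /L mulrDl mul1r addrC -mulrA; apply: lerD => //.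
  by apply: le_trans h3 _; rewrite ler_piMl.
have A1 : e / (2 * L) * `|h y - h x| <= e / 2 * `|y - x|.
  apply: le_trans (_ : e / (2 * L) * (L * `|y - x|) <= _).
    by rewrite ler_pM2l.
  by rewrite mulrA ler_wpM2r // invfM mulrA divfK // gt_eqF.
have A2 : `|d| * `|h y - h x - dotp g (y - x)| <= e / 2 * `|y - x|.
  apply: le_trans (_ : (`|d| + 1) * (e / (2 * (`|d| + 1)) * `|y - x|) <= _).
    apply: ler_pM => //; first by rewrite lerDl.
    by apply: le_trans h3 _; rewrite ler_wpM2r // ge_min lexx orbT.
  rewrite mulrA ler_wpM2r // mulrC invfM mulrA divfK // gt_eqF // ltr_wpDl //.
by move: h1 A1 A2; lra.
Qed.

Lemma has_gradV A h x g : h x != 0 -> has_grad A h x g ->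
  has_grad A (fun y => (h y)^-1) x (- (h x) ^- 2 *: g).
Proof.
move=> hx hh; apply: (has_grad_comp (phi := fun s => s^-1)) hh.
apply: DeriveDef; first exact: (derivableV (f := id)).
by rewrite (deriveV (f := id)) // derive_id /GRing.scale /= mulr1.
Qed.

Lemma has_gradM A h k x g g' : has_grad A h x g -> has_grad A k x g' ->
  has_grad A (fun y => h y * k y) x (h x *: g' + k x *: g).
Proof.
move=> hh hk.
(* polarisation reduces products to squares *)
have sq (f : 'rV[R]_n -> R) gf : has_grad A f x gf -> has_grad A (fun y => f y ^+ 2) x ((2 * f x) *: gf).
  move=> hf; apply: (has_grad_comp (phi := fun s => s ^+ 2) _ hf).
  by apply: is_derive_eq; rewrite /GRing.scale /=; ring.
have := has_gradD (has_gradZ 2^-1 (sq _ _ (has_gradD hh hk)))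
   (has_gradD (has_gradZ (- 2^-1) (sq _ _ hh)) (has_gradZ (- 2^-1) (sq _ _ hk))).
rewrite (_ : (fun _ => _) = fun y => h y * k y); last by rewrite funeqE => y; field.
rewrite (_ : _ + _ = h x *: g' + k x *: g) //.
by apply/rowP => i; rewrite !mxE; field.
Qed.

Lemma has_grad_affine A (b : 'rV[R]_n) x x0 : has_grad A (fun y => dotp b (y - x0)) x b.
Proof.
move=> e e0; exists 1 => // y _ _.
by rewrite -dotpBr -dotpBr opprB addrA subrK subrr dotp0r normr0 mulr_ge0 // ltW.
Qed.

Lemma has_grad_coord A x i : has_grad A (fun y => y 0 i) x (delta_mx 0 i).
Proof.
rewrite (_ : (fun y => _) = fun y => dotp (delta_mx 0 i) (y - 0)); first exact: has_grad_affine.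
by rewrite funeqE => y; rewrite subr0 dotp_deltal.
Qed.

Lemma has_grad_sqdist A x x0 : has_grad A (fun y => dotp (y - x0) (y - x0) / 2) x (x - x0).
Proof.
move=> e e0; exists (e / (n%:R + 1)); first by rewrite divr_gt0 // ltr_wpDl.
move=> y _; rewrite ltr_pdivlMr ?ltr_wpDl // => ye.
have -> : dotp (y - x0) (y - x0) / 2 - dotp (x - x0) (x - x0) / 2 - dotp (x - x0) (y - x)
   = dotp (y - x) (y - x) / 2.
  by rewrite !dotp_linE (dotpC x y) (dotpC x0 y) (dotpC x0 x); field.
have := dotp_le_norm (y - x) (y - x); have := normr_ge0 (y - x); move: ye.
rewrite normrM (ger0_norm (_ : 0 <= 2^-1)) //; move: `|y - x| `|dotp _ _| => a b ae a0 ba.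
have : n%:R * a * a <= e * a by rewrite ler_wpM2r //; nra.
have := normr_ge0 (dotp (y - x) (y - x)); nra.
Qed.

Lemma rdiff_comp A h x g (c : R -> 'rV[R]_n) v : has_grad A h x g -> rdiff c x v ->
  right0 (fun t => A (c t)) ->
  rdiff (h \o c) (h x) (dotp g v).
Proof.
move=> hh hc hA e e0.
pose L := `|v| + 1; have L0 : 0 < L by rewrite ltr_wpDl.
pose G := n%:R * `|g| + 1; have G0 : 0 < G by rewrite ltr_wpDl // mulr_ge0.
have [d1 d10 hd1] := hh (e / (2 * L)) ltac:(by rewrite divr_gt0 // mulr_gt0).
have hd2 := hc 1 ltr01.
have hd3 := hc (e / (2 * G)) ltac:(by rewrite divr_gt0 // mulr_gt0).
have := right0_and (right0_and hd2 hd3) (right0_and hA (right0_lt (divr_gt0 d10 L0))).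
move=> [d d0 hd]; exists d => // t td; have [[h2 h3] [At /andP[t0 td1]]] := hd t td.
have cx : `|c t - x| <= L * t.
  rewrite -(subrK (t *: v) (c t - x)); apply: le_trans (ler_normD _ _) _.
  by rewrite normrZ (gtr0_norm t0) /L mulrDl addrC (mulrC t) lerD2l mul1r -[leRHS]mul1r.
have := hd1 (c t) At (le_lt_trans cx _); rewrite -ltr_pdivlMl // mulrC => /(_ td1) h1.
rewrite /= (_ : h (c t) - h x - t *: dotp g v =
  (h (c t) - h x - dotp g (c t - x)) + dotp g (c t - x - t *: v)); last first.
  by rewrite (dotpBr g (c t - x)) dotpZr addrA subrK.
apply: le_trans (ler_normD _ _) _.
have B1 : e / (2 * L) * `|c t - x| <= e / 2 * t.
  apply: le_trans (_ : e / (2 * L) * (L * t) <= _).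
    by rewrite ler_pM2l // divr_gt0 // mulr_gt0.
  by rewrite mulrA ler_wpM2r ?(ltW t0) // invfM mulrA divfK // gt_eqF.
have B2 : `|dotp g (c t - x - t *: v)| <= e / 2 * t.
  apply: le_trans (dotp_le_norm _ _) _; rewrite mulrA.
  apply: le_trans (_ : G * (e / (2 * G) * t) <= _).
    by apply: ler_pM; rewrite ?mulr_ge0 // /G lerDl.
  by rewrite mulrA ler_wpM2r ?(ltW t0) // mulrC invfM mulrA divfK // gt_eqF.
by move: h1 B1 B2; lra.
Qed.

Lemma rdiff_le (f k : R -> R) (c a b : R) : rdiff f c a -> rdiff k c b ->
  right0 (fun t => f t <= k t) -> a <= b.
Proof.
move=> hf hk hle; rewrite leNgt; apply/negP => ab.
have e0 : 0 < (a - b) / 4 by lra.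
have [d d0 hd] := right0_and (right0_and (hf _ e0) (hk _ e0)) hle.
have [] := hd (d / 2) ltac:(lra); rewrite /GRing.scale /=.
have : 0 < d / 2 by lra.
move: (d / 2) => t t0; rewrite !ler_norml => [[/andP[h1 _] /andP[_ h2]] h3].
nra.
Qed.

Lemma rdiff_cst (c : R) : rdiff (fun=> c) c 0.
Proof. by move=> e e0; exists 1 => // t /andP[t0 _]; rewrite scaler0 !subr0 subrr normr0 mulr_ge0 // ltW. Qed.

Lemma rdiff_line x v : rdiff (fun t : R => x + t *: v) x v.
Proof.
move=> e e0; exists 1 => // t /andP[t0 _].
by rewrite (addrC x) addrK subrr normr0 mulr_ge0 // ltW.
Qed.

Lemma rdiff_quadratic x v w : rdiff (fun t : R => x + t *: v + t ^+ 2 *: w) x v.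
Proof.
move=> e e0; have W0 : 0 < `|w| + 1 by rewrite ltr_wpDl.
exists (e / (`|w| + 1)); first exact: divr_gt0.
move=> t /andP[t0]; rewrite ltr_pdivlMr // => te.
have -> : x + t *: v + t ^+ 2 *: w - x - t *: v = t ^+ 2 *: w.
  by apply/rowP => i; rewrite !mxE; ring.
rewrite normrZ ger0_norm ?sqr_ge0 // expr2 -mulrA mulrC ler_wpM2r ?ltW //.
by have := normr_ge0 w; nra.
Qed.

Lemma is_derive_line A h x v t g : has_grad A h (x + t *: v) g ->
  (exists2 d : R, 0 < d & forall s, `|s| < d -> A (x + (t + s) *: v)) ->
  is_derive t 1 (fun s => h (x + s *: v)) (dotp g v).
Proof.
move=> hh [d d0 hA].
have lim : (fun s => s^-1 *: ((fun s => h (x + s *: v)) (s *: 1 + t) - h (x + t *: v))) @ 0^' --> dotp g v.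
  apply/cvgrPdist_le => e e0.
  have V0 : 0 < `|v| + 1 by rewrite ltr_wpDl.
  have [d1 d10 hd1] := hh (e / (`|v| + 1)) ltac:(exact: divr_gt0).
  rewrite /prop_near1 /=; apply/nbhs_ballP; exists (Num.min d (d1 / (`|v| + 1))).
    by rewrite /= lt_min d0 divr_gt0.
  move=> s; rewrite /ball /= sub0r normrN lt_min => /andP[sd sd1] s0.
  have E : x + (t + s) *: v - (x + t *: v) = s *: v.
    by apply/rowP => i; rewrite !mxE; ring.
  have := hd1 (x + (t + s) *: v) (hA s sd); rewrite E normrZ.
  rewrite ltr_pdivlMr // in sd1.
  have sv : `|s| * `|v| < d1 by apply: le_lt_trans sd1; rewrite ler_wpM2l // lerDl.
  move=> /(_ sv); rewrite dotpZr [s *: 1]mulr1 (addrC s) => h1.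
  rewrite distrC -(ler_pM2r (_ : 0 < `|s|)) ?normr_gt0 //.
  rewrite -normrM mulrBl /GRing.scale /= mulrAC mulVf // mul1r [dotp g v * s]mulrC.
  apply: le_trans h1 _; rewrite (mulrC `|s|) mulrA ler_wpM2r //.
  by rewrite -mulrA ler_piMr ?(ltW e0) // mulrC ler_pdivrMr // mul1r lerDl.
by apply: DeriveDef; [apply/cvg_ex; exists (dotp g v) | exact: cvg_lim].
Qed.

Lemma has_grad_derive A h x v g : has_grad A h x g ->
  (exists2 d : R, 0 < d & forall y, `|y - x| < d -> A y) -> is_derive x v h (dotp g v).
Proof.
move=> hh [d d0 hA].
have V0 : 0 < `|v| + 1 by rewrite ltr_wpDl.
have [] := is_derive_line (t := 0) (x := x) (v := v) (h := h) (A := A) (g := g).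
- by rewrite scale0r addr0.
- exists (d / (`|v| + 1)); first exact: divr_gt0.
  move=> s; rewrite ltr_pdivlMr // => sd; apply: hA.
  rewrite add0r addrC addKr normrZ; apply: le_lt_trans sd.
  by rewrite ler_wpM2l // lerDl.
have E : (fun s : R => h (x + s *: v)) = (fun s => h (s *: v + x)).
  by rewrite funeqE => s; rewrite addrC.
rewrite E => d1 d2; apply: DeriveDef; first exact: (proj2 (derivable1P _ _ _)) d1.
rewrite -d2 /derive; set q1 := fun s : R => s^-1 *: _.
set q2 := fun s : R => s^-1 *: _.
suff -> : q1 = q2 by [].
by rewrite /q1 /q2 funeqE => s /=; rewrite addr0 scale0r add0r [s%:A]mulr1.
Qed.

End Gradients.

(** * Mean value theorems and Taylor expansion *)

Section MeanValue.
Context {R : realType} {n : nat}.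
Implicit Types (A : set 'rV[R]_n) (h k : 'rV[R]_n -> R) (x y v w g : 'rV[R]_n).

(** The endpoints are not ordered because increments of coordinates have no sign. *)
Lemma mvt_unordered (F dF : R -> R) (a b : R) :
  (forall t, Num.min a b <= t <= Num.max a b -> is_derive t 1 F (dF t)) ->
  exists2 t, Num.min a b <= t <= Num.max a b & F b - F a = dF t * (b - a).
Proof.
have ord (a' b' : R) : a' <= b' -> (forall t, a' <= t <= b' -> is_derive t 1 F (dF t)) ->
    exists2 t, a' <= t <= b' & F b' - F a' = dF t * (b' - a').
  move=> ab dF'; have [||t] := @MVT_segment R F dF a' b' ab.
  - by move=> t; rewrite in_itv /= => /andP[h1 h2]; apply: dF'; rewrite !ltW.
  - by apply: derivable_within_continuous => t; rewrite in_itv /= => /dF' [].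
  by rewrite in_itv /= => ht E; exists t.
have [ab|ba] := leP a b; first exact: ord.
move=> /(ord _ _ (ltW ba)) [t ht E]; exists t => //.
by rewrite -opprB E -mulrN opprB.
Qed.

Lemma mvt_line h (G : 'rV[R]_n -> 'rV[R]_n) x v :
  (forall t : R, 0 <= t <= 1 -> has_grad setT h (x + t *: v) (G (x + t *: v))) ->
  exists2 t : R, 0 <= t <= 1 & h (x + v) - h x = dotp (G (x + t *: v)) v.
Proof.
move=> hG; have [|t ht E] := @mvt_unordered (fun s => h (x + s *: v))
    (fun s => dotp (G (x + s *: v)) v) 0 1.
  move=> t; rewrite min_l // max_r // => /hG ht.
  by apply: is_derive_line ht _; exists 1.
exists t; first by move: ht; rewrite min_l // max_r.
by move: E; rewrite scale1r scale0r addr0 subr0 mulr1.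
Qed.

Lemma derivable_line h x v (t : R) : derivable h (x + t *: v) v ->
  is_derive t 1 (fun s => h (x + s *: v)) ('D_v h (x + t *: v)).
Proof.
have E : (fun s : R => s^-1 *: (((fun s => h (x + s *: v)) \o shift t) s%:A - h (x + t *: v))) =
    (fun s : R => s^-1 *: ((h \o shift (x + t *: v)) (s *: v) - h (x + t *: v))).
  by rewrite funeqE => s /=; rewrite [s%:A]mulr1 scalerDl addrCA.
by move=> dh; apply: DeriveDef; rewrite /derivable /derive E.
Qed.

(** The classical passage from [x] to [y] one coordinate at a time, each step being a mean value
    of one partial derivative. *)
Lemma has_grad_partials h x (r : R) : 0 < r ->
  (forall y i, `|y - x| < r -> derivable h y (delta_mx 0 i)) ->
  (forall i, {for x, continuous (partial i h)}) ->
  has_grad setT h x (grad h x).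
Proof.
move=> r0 dh cont e e0.
have N0 : 0 < n%:R + 1 :> R by rewrite ltr_wpDl.
pose e' := e / (n%:R + 1); have e'0 : 0 < e' by exact: divr_gt0.
have [d d0 hd] : exists2 d : R, 0 < d & forall i y, `|y - x| < d -> `|partial i h y - partial i h x| <= e'.
  apply: common_radius => i; have /cvgrPdist_le /(_ _ e'0) := cont i.
  move=> /nbhs_ballP [d /= d0 hd]; exists d => // y yd.
  by rewrite distrC; apply: hd; rewrite -ball_normE /= distrC.
exists (Num.min d r); first by rewrite lt_min d0.
move=> y _; rewrite lt_min => /andP[yd yr].
pose z (m : nat) : 'rV[R]_n := \row_i (if (i < m)%N then y 0 i else x 0 i).
have zS (k : 'I_n) : z k.+1 = z k + (y 0 k - x 0 k) *: delta_mx 0 k.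
  apply/rowP => i; rewrite !mxE eqxx /= ltnS leq_eqVlt -[(i == k :> nat)]/(i == k).
  have [->|ik] /= := eqVneq i k; first by rewrite ltnn mulr1 addrC subrK.
  by rewrite mulr0 addr0.
have near_z (k : 'I_n) (t : R) : Num.min 0 (y 0 k - x 0 k) <= t <= Num.max 0 (y 0 k - x 0 k) ->
    `|z k + t *: delta_mx 0 k - x| <= `|y - x|.
  move=> ht; apply: norm_rV_le => // j.
  rewrite !mxE eqxx /=; have := coord_le_norm (y - x) j; rewrite !mxE.
  have [jk|jk] := eqVneq j k.
    rewrite jk ltnn mulr1 (addrC (x 0 k)) addrK; apply: le_trans.
    move: ht; case: (leP 0 (y 0 k - x 0 k)) => h0 /andP[h1 h2].
      by rewrite !ger0_norm.
    by rewrite !ler0_norm //; lra.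
  rewrite mulr0 addr0; case: ifP => // _ _.
  by rewrite subrr normr0.
have step (k : 'I_n) : `|h (z k.+1) - h (z k) - partial k h x * (y 0 k - x 0 k)| <= e' * `|y - x|.
  have [|t ht] := @mvt_unordered (fun s => h (z k + s *: delta_mx 0 k))
    (fun s => partial k h (z k + s *: delta_mx 0 k)) 0 (y 0 k - x 0 k).
    move=> t ht; apply: derivable_line; apply: dh.
    exact: le_lt_trans (near_z k t ht) yr.
  rewrite scale0r addr0 subr0 -zS => ->; rewrite -mulrBl normrM.
  apply: ler_pM => //.
    by apply: hd; apply: le_lt_trans (near_z k t ht) yd.
  by have := coord_le_norm (y - x) k; rewrite !mxE.
have z0 : z 0%N = x by apply/rowP => i; rewrite !mxE.
have zn : z n = y by apply/rowP => i; rewrite !mxE ltn_ord.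
have -> : h y - h x - dotp (grad h x) (y - x) =
    \sum_(k < n) (h (z k.+1) - h (z k) - partial k h x * (y 0 k - x 0 k)).
  rewrite sumrB -(big_mkord xpredT (fun k : nat => h (z k.+1) - h (z k))).
  rewrite (telescope_sumr (fun k : nat => h (z k))) // zn z0.
  by congr (_ - _); apply: eq_bigr => k _; rewrite !mxE.
apply: le_trans (ler_norm_sum _ _ _) _.
apply: le_trans (_ : \sum_(k < n) (e' * `|y - x|) <= _); first by apply: ler_sum.
rewrite sumr_const card_ord -mulr_natl mulrA ler_wpM2r // /e' mulrCA.
by rewrite ler_piMr ?ltW // ltr_pdivrMr // mul1r ltrDl.
Qed.

(** Only the segment from [x] to [x + v] enters, so that inside a convex domain the bound
    applies arbitrarily close to the boundary. *)
Lemma mvt_le h (G : 'rV[R]_n -> 'rV[R]_n) x v g (e : R) :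
  (forall t : R, 0 <= t <= 1 -> has_grad setT h (x + t *: v) (G (x + t *: v)) /\
     `|G (x + t *: v) - g| <= e) ->
  `|h (x + v) - h x - dotp g v| <= n%:R * e * `|v|.
Proof.
move=> hG; have [t ht ->] := @mvt_line h G x v (fun t ht => (hG t ht).1).
rewrite -dotpBl; apply: le_trans (dotp_le_norm _ _) _; rewrite -mulrA.
by rewrite ler_wpM2l // ler_wpM2r // (hG t ht).2.
Qed.

(** On the segment, [h] minus its Taylor polynomial has a derivative of order [o(|v| ^+ 2)], by
    the first-order expansion of the gradient at [x]. *)
Lemma taylor2 h (G : 'rV[R]_n -> 'rV[R]_n) (H : 'M[R]_n) x (r : R) : 0 < r ->
  (forall y, `|y - x| < r -> has_grad setT h y (G y)) ->
  (forall i, has_grad setT (fun y => G y 0 i) x (col i H)^T) ->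
  forall e : R, 0 < e -> exists2 d : R, 0 < d & forall v, `|v| < d ->
    `|h (x + v) - h x - dotp (G x) v - dotp (v *m H) v / 2| <= e * `|v| ^+ 2.
Proof.
move=> r0 hG hH e e0.
have N0 : 0 < n%:R + 1 :> R by rewrite ltr_wpDl.
pose e' := e / (n%:R + 1); have e'0 : 0 < e' by exact: divr_gt0.
have [d d0 hd] : exists2 d : R, 0 < d & forall i y, `|y - x| < d ->
    `|G y 0 i - G x 0 i - dotp (col i H)^T (y - x)| <= e' * `|y - x|.
  by apply: common_radius => i; have [d d0 hd] := hH i e' e'0; exists d => // y; exact: hd.
exists (Num.min d r); first by rewrite lt_min d0.
move=> v; rewrite lt_min => /andP[vd vr].
have tv (t : R) : 0 <= t <= 1 -> `|t *: v| <= `|v|.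
  by move=> /andP[t0 t1]; rewrite normrZ ger0_norm // ler_piMl.
pose F s := h (x + s *: v) - s * dotp (G x) v - s ^+ 2 * (dotp (v *m H) v / 2).
pose dF s := dotp (G (x + s *: v)) v - dotp (G x) v - s * dotp (v *m H) v.
have [|t ht] := @mvt_unordered F dF 0 1.
  move=> t; rewrite min_l // max_r // => ht.
  have dh : is_derive t 1 (fun s => h (x + s *: v)) (dotp (G (x + t *: v)) v).
    apply: (is_derive_line (A := setT)); last by exists 1.
    by apply: hG; rewrite addrC addKr; apply: le_lt_trans vr; exact: tv.
  by apply: is_derive_eq; rewrite /dF /GRing.scale /=; field.
rewrite min_l // max_r // in ht.
rewrite /F scale1r scale0r addr0 expr1n !mul1r mul0r expr0n /= mul0r !subr0 mulr1 => E.
have -> : h (x + v) - h x - dotp (G x) v - dotp (v *m H) v / 2 = dF t by rewrite -E; ring.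
pose q : 'rV[R]_n := \row_i (G (x + t *: v) 0 i - G x 0 i - dotp (col i H)^T (t *: v)).
have -> : dF t = dotp q v.
  have -> : q = G (x + t *: v) - G x - t *: (v *m H).
    apply/rowP => i; rewrite !mxE dotpZr; congr (_ - _ * _).
    by apply: eq_bigr => j _; rewrite !mxE mulrC.
  by rewrite !dotp_linE.
have qe : `|q| <= e' * `|v|.
  apply: norm_rV_le => [|j]; first by rewrite mulr_ge0 // ltW.
  rewrite mxE.
  have := hd j (x + t *: v); rewrite addrC addKr => /(_ (le_lt_trans (tv t ht) vd)) h1.
  by apply: le_trans h1 _; rewrite ler_pM2l // tv.
apply: le_trans (dotp_le_norm _ _) _.
apply: le_trans (_ : n%:R * (e' * `|v| * `|v|) <= _).
  by rewrite ler_wpM2l // ler_wpM2r.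
rewrite -mulrA -expr2 mulrA ler_wpM2r ?sqr_ge0 // /e' mulrCA.
by rewrite ler_piMr ?ltW // ltr_pdivrMr // mul1r ltrDl.
Qed.
End MeanValue.

(** * Symmetry of second derivatives *)

Section Young.
Context {R : realType} {n : nat}.
Implicit Types (A : set 'rV[R]_n) (h k : 'rV[R]_n -> R) (x y v w g : 'rV[R]_n).

(** The increment along the [i]-th direction of [h(. + t e_j) - h] is a mean value of the [i]-th
    partial derivative, whose expansion at [x] yields [t ^+ 2 * H j i]. *)
Lemma second_difference h (G : 'rV[R]_n -> 'rV[R]_n) (H : 'M[R]_n) x (r : R) i j : 0 < r ->
  (forall y, `|y - x| < r -> has_grad setT h y (G y)) ->
  (forall i, has_grad setT (fun y => G y 0 i) x (col i H)^T) ->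
  forall e : R, 0 < e -> right0 (fun t =>
    `|h (x + t *: delta_mx 0 i + t *: delta_mx 0 j) - h (x + t *: delta_mx 0 i) -
      h (x + t *: delta_mx 0 j) + h x - t ^+ 2 * H j i| <= 4 * e * t ^+ 2).
Proof.
move=> r0 hG hH e e0; have [d d0 hd] := hH i e e0.
pose a : 'rV[R]_n := delta_mx 0 i; pose b : 'rV[R]_n := delta_mx 0 j.
exists (Num.min (d / 3) (r / 3)); first by rewrite lt_min; apply/andP; split; lra.
move=> t; rewrite lt_min => /andP[t0 /andP[td tr]].
have near_w (s c : R) : 0 <= s <= t -> 0 <= c <= t -> `|s *: a + c *: b| <= 2 * t.
  move=> /andP[s0 st] /andP[c0 ct]; apply: le_trans (ler_normD _ _) _.
  rewrite !normrZ (ger0_norm s0) (ger0_norm c0).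
  by have := @norm_delta_le1 R n i; have := @norm_delta_le1 R n j; rewrite -/a -/b; nra.
pose F s := h (x + s *: a + t *: b) - h (x + s *: a).
pose dF s := (G (x + s *: a + t *: b) - G (x + s *: a)) 0 i.
have ga g : dotp g a = g 0 i by rewrite dotpC dotp_deltal.
have [|s] := @mvt_unordered _ F dF 0 t.
  move=> s; rewrite min_l ?(ltW t0) // max_r ?(ltW t0) // => hs.
  have tt : 0 <= t <= t by rewrite lexx ltW.
  have zt : (0 : R) <= 0 <= t by rewrite lexx ltW.
  have d1 : is_derive s 1 (fun s => h ((x + t *: b) + s *: a)) (dotp (G ((x + t *: b) + s *: a)) a).
    apply: (is_derive_line (A := setT)); last by exists 1.
    apply: hG; have -> : x + t *: b + s *: a - x = s *: a + t *: b.
      by apply/rowP => p; rewrite !mxE; ring.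
    by apply: le_lt_trans (near_w _ _ hs tt) _; lra.
  have d2 : is_derive s 1 (fun s => h (x + s *: a)) (dotp (G (x + s *: a)) a).
    apply: (is_derive_line (A := setT)); last by exists 1.
    apply: hG; rewrite addrC addKr -(addr0 (s *: a)) -(scale0r b).
    by apply: le_lt_trans (near_w _ _ hs zt) _; lra.
  rewrite (_ : F = (fun s => h ((x + t *: b) + s *: a)) - (fun s => h (x + s *: a))); last first.
    by rewrite funeqE => u; rewrite /F addrAC.
  by apply: is_derive_eq; rewrite /dF !ga (addrAC x) !mxE.
rewrite min_l ?(ltW t0) // max_r ?(ltW t0) // => hs E.
have tt : 0 <= t <= t by rewrite lexx ltW.
have zt : (0 : R) <= 0 <= t by rewrite lexx ltW.
rewrite (_ : _ - t ^+ 2 * H j i = t * (dF s - t * H j i)); last first.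
  rewrite [RHS]mulrBr [t * dF s]mulrC -[dF s * t](_ : F t - F 0 = _); last by rewrite E subr0.
  by rewrite /F scale0r addr0 -/a -/b; ring.
have h1 := hd (x + (s *: a + t *: b)) I; rewrite addrC addKr in h1.
have h2 := hd (x + (s *: a + 0 *: b)) I; rewrite addrC addKr in h2.
have n1 := near_w s t hs tt; have n2 := near_w s 0 hs zt.
have t2d : 2 * t < d by lra.
have {}h1 := h1 (le_lt_trans n1 t2d); have {}h2 := h2 (le_lt_trans n2 t2d).
have cb : dotp (col i H)^T b = H j i by rewrite dotpC dotp_deltal !mxE.
have -> : dF s - t * H j i =
    (G (x + (s *: a + t *: b)) 0 i - G x 0 i - dotp (col i H)^T (s *: a + t *: b)) -
    (G (x + (s *: a + 0 *: b)) 0 i - G x 0 i - dotp (col i H)^T (s *: a + 0 *: b)).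
  rewrite !dotpDr !dotpZr cb /dF scale0r addr0 addrA !mxE; ring.
rewrite normrM gtr0_norm // expr2 [leRHS]mulrA [leRHS]mulrC ler_pM2l //.
apply: le_trans (ler_normB _ _) _.
have := le_trans h1 (ler_wpM2l (ltW e0) n1); have := le_trans h2 (ler_wpM2l (ltW e0) n2).
lra.
Qed.

(** The second difference is symmetric in its two directions, while its leading term is [H j i]
    or [H i j] according to their order. *)
Lemma symmetric_second_derivative h (G : 'rV[R]_n -> 'rV[R]_n) (H : 'M[R]_n) x (r : R) : 0 < r ->
  (forall y, `|y - x| < r -> has_grad setT h y (G y)) ->
  (forall i, has_grad setT (fun y => G y 0 i) x (col i H)^T) -> H^T = H.
Proof.
move=> r0 hG hH; apply/matrixP => i j; rewrite mxE.
apply/eqP/negP => /negP Hij; have {}Hij : 0 < `|H j i - H i j|.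
  by rewrite normr_gt0 subr_eq0.
have e0 : 0 < `|H j i - H i j| / 16 by lra.
have [t t0 [h1 h2]] := right0_ex (right0_and (second_difference i j r0 hG hH e0)
   (second_difference j i r0 hG hH e0)).
move: h1 h2; rewrite (addrAC x (t *: delta_mx 0 j)).
set E := h _ - _ - _ + _; set E' := h _ - _ - _ + _.
have -> : E' = E by rewrite /E /E'; ring.
move=> h1 h2; have t2 : 0 < t ^+ 2 by rewrite exprn_gt0.
have : `|t ^+ 2 * (H j i - H i j)| <= t ^+ 2 * (`|H j i - H i j| / 2).
  have -> : t ^+ 2 * (H j i - H i j) = (E - t ^+ 2 * H i j) - (E - t ^+ 2 * H j i) by ring.
  by apply: le_trans (ler_normB _ _) _; lra.
rewrite normrM gtr0_norm // ler_pM2l //; lra.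
Qed.
End Young.

Section ClassicalDerivatives.
Context {R : realType} {n : nat}.
Implicit Types (A : set 'rV[R]_n) (u : 'rV[R]_n -> R) (x y v w g : 'rV[R]_n).

Lemma open_ballP A x : open A -> A x -> exists2 r : R, 0 < r & forall y, `|y - x| < r -> A y.
Proof.
move=> oA Ax; have /nbhs_ballP [r r0 hr] := open_nbhs_nbhs (conj oA Ax).
by exists r => // y yr; apply: hr; rewrite -ball_normE /= distrC.
Qed.

Definition Ck_in (k : nat) A u :=
  [/\ open A, partials_exist k A u &
   forall s x, (size s <= k)%N -> A x -> {for x, continuous (dpart s u)}].

Lemma has_grad_dpart k A u s x : Ck_in k A u -> (size s < k)%N -> A x ->
  has_grad setT (dpart s u) x (\row_i dpart (i :: s) u x).
Proof.
move=> [oA pA cA] sk Ax; have [r r0 hr] := open_ballP oA Ax.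
apply: (has_grad_partials r0) => [y i yr|i]; first exact: pA sk (hr _ yr).
exact: (cA (i :: s)).
Qed.

Lemma dpart_swap k A u s i j x : Ck_in k A u -> ((size s).+1 < k)%N -> A x ->
  dpart [:: i, j & s] u x = dpart [:: j, i & s] u x.
Proof.
move=> uA sk Ax; have [oA _ _] := uA; have [r r0 hr] := open_ballP oA Ax.
pose H : 'M[R]_n := \matrix_(j, i) dpart [:: j, i & s] u x.
have : H^T = H.
  apply: (symmetric_second_derivative (h := dpart s u) (G := fun y => \row_i dpart (i :: s) u y) r0).
    by move=> y yr; apply: has_grad_dpart uA (ltnW sk) (hr _ yr).
  move=> p; rewrite (_ : (fun y => _) = dpart (p :: s) u); last by rewrite funeqE => y; rewrite mxE.
  rewrite (_ : _^T = \row_q dpart (q :: p :: s) u x); first exact: (@has_grad_dpart k A u (p :: s) x uA sk Ax).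
  by apply/rowP => q; rewrite !mxE.
by move=> /matrixP /(_ j i); rewrite !mxE.
Qed.

Lemma dpart_rot3 k A u i j l x : Ck_in k A u -> (2 < k)%N -> A x ->
  dpart [:: i; j; l] u x = dpart [:: l; i; j] u x.
Proof.
move=> uA k2 Ax; rewrite (@dpart_swap k A u [:: j] l i x uA k2 Ax).
have [oA _ _] := uA; rewrite /= /partial; apply: near_eq_derive.
have := open_nbhs_nbhs (conj oA Ax); apply: filterS => y Ay.
exact: (@dpart_swap k A u [::] j l y uA (ltnW k2) Ay).
Qed.

Lemma hessian_sym k A u x : Ck_in k A u -> (1 < k)%N -> A x -> (hessian u x)^T = hessian u x.
Proof.
move=> uA k1 Ax; apply/matrixP => i j; rewrite !mxE.
exact: (@dpart_swap k A u [::] j i x uA k1 Ax).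
Qed.

Lemma smooth_on_Ck k A u : open A -> smooth_on A u -> Ck_in k A u.
Proof. by move=> oA [pA cA]; split=> // s x _; exact: cA. Qed.
End ClassicalDerivatives.

(** * Derivatives up to the boundary of a convex set *)

Section UpToClosure.
Context {R : realType} {n : nat}.
Implicit Types (A Om : set 'rV[R]_n) (h u : 'rV[R]_n -> R) (x y v w g : 'rV[R]_n).

(** The form of continuity on a subset whose radii combine with those of [has_grad]. *)
Definition cont_on A h := forall x, A x -> forall e : R, 0 < e ->
  exists2 d : R, 0 < d & forall y, A y -> `|y - x| < d -> `|h y - h x| <= e.

Lemma vector_modulus A (G : 'rV[R]_n -> 'rV[R]_n) x (e : R) :
  (forall i, cont_on A (fun y => G y 0 i)) -> A x -> 0 < e ->
  exists2 d : R, 0 < d & forall y, A y -> `|y - x| < d -> `|G y - G x| <= e.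
Proof.
move=> Gc Ax e0.
have [d d0 hd] : exists2 d : R, 0 < d & forall i y, `|y - x| < d -> A y -> `|G y 0 i - G x 0 i| <= e.
  by apply: common_radius => i; have [d d0 hd] := Gc i x Ax e e0; exists d => // y yd Ay; exact: hd.
exists d => // y Ay yd; apply: norm_rV_le => [|i]; first exact: ltW.
by rewrite !mxE; exact: hd.
Qed.

Definition is_convex A := forall x y (t : R), A x -> A y -> 0 <= t <= 1 -> A (x + t *: (y - x)).

Lemma cont_onP A h : {within A, continuous h} <-> cont_on A h.
Proof.
rewrite subspace_continuousP; split=> hc x Ax.
  move=> e e0; have /cvgrPdist_le /(_ e e0) := hc x Ax.
  rewrite near_withinE => /nbhs_ballP [d /= d0 hd]; exists d => // y Ay yd.
  by rewrite distrC; apply: hd => //; rewrite -ball_normE /= distrC.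
apply/cvgrPdist_le => e e0; have [d d0 hd] := hc x Ax e e0.
rewrite near_withinE; apply/nbhs_ballP; exists d => // y.
by rewrite -ball_normE /= distrC => yd Ay; rewrite distrC; apply: hd.
Qed.

Lemma closureP A x : closure A x <-> (forall e : R, 0 < e -> exists2 y, A y & `|y - x| < e).
Proof.
split=> [clx e e0|hx B /nbhs_ballP [e /= e0 eB]].
  have [y [Ay]] := clx _ (nbhsx_ballx x e e0).
  by rewrite -ball_normE /= distrC => ye; exists y.
have [y Ay ye] := hx e e0; exists y; split=> //; apply: eB.
by rewrite -ball_normE /= distrC.
Qed.

Lemma convex_closure Om : is_convex Om -> is_convex (closure Om).
Proof.
move=> cOm x y t /closureP clx /closureP cly t01; apply/closureP => e e0.
have [x' Ox' xe] := clx (e / 2) (half_pos e0); have [y' Oy' ye] := cly (e / 2) (half_pos e0).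
exists (x' + t *: (y' - x')); first exact: cOm.
have -> : x' + t *: (y' - x') - (x + t *: (y - x)) = (1 - t) *: (x' - x) + t *: (y' - y).
  by apply/rowP => i; rewrite !mxE; ring.
apply: le_lt_trans (ler_normD _ _) _; rewrite !normrZ.
move: t01 => /andP[t0 t1]; rewrite !ger0_norm ?subr_ge0 //; nra.
Qed.

Lemma has_grad_near_eq h k x g (r : R) : 0 < r -> (forall y, `|y - x| < r -> k y = h y) ->
  has_grad setT h x g -> has_grad setT k x g.
Proof.
move=> r0 hk hh e e0; have [d d0 hd] := hh e e0.
exists (Num.min d r); first by rewrite lt_min d0.
move=> y _; rewrite lt_min => /andP[yd yr].
by rewrite hk // (hk x) ?subrr ?normr0 //; apply: hd.
Qed.

(** On segments of [Om] the mean value inequality holds with the modulus of continuity of [G];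
    the endpoints may then tend to points of the closure. *)
Lemma has_grad_closure Om h (G : 'rV[R]_n -> 'rV[R]_n) : is_convex Om ->
  (forall x, Om x -> has_grad setT h x (G x)) -> cont_on (closure Om) h ->
  (forall i, cont_on (closure Om) (fun x => G x 0 i)) ->
  forall x, closure Om x -> has_grad (closure Om) h x (G x).
Proof.
move=> cOm hG hc Gc x clx e e0.
have N0 : 0 < n%:R + 1 :> R by rewrite ltr_wpDl.
pose e' := e / (n%:R + 1); have e'0 : 0 < e' by exact: divr_gt0.
have [d d0 hd] : exists2 d : R, 0 < d & forall y, closure Om y -> `|y - x| < d -> `|G y - G x| <= e'.
  by apply: vector_modulus.
exists d => // y cly yd.
(* the error q is distributed over the approximations of x and y by points of Om *)
suff approx : forall q : R, 0 < q -> `|h y - h x - dotp (G x) (y - x)| <= e * `|y - x| + q.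
  by apply/ler_addgt0Pr.
move=> q q0; pose L := 2 * n%:R * (`|G x| + e') + 1.
have L0 : 0 < L by rewrite ltr_wpDl // mulr_ge0 // ?addr_ge0 ?(ltW e'0) // mulr_ge0.
have q3 : 0 < q / 3 by lra.
have [eta eta0 etaE] : exists2 eta : R, 0 < eta & L * eta = q / 3.
  by exists (q / 3 / L); [exact: divr_gt0 | rewrite mulrC divfK // gt_eqF].
have [dx dx0 hdx] := hc x clx _ q3; have [dy dy0 hdy] := hc y cly _ q3.
pose m := Num.min (Num.min dx dy) (Num.min (d - `|y - x|) eta).
have m0 : 0 < m by rewrite !lt_min dx0 dy0 subr_gt0 yd.
have /closureP /(_ m m0) [x' Ox' xm] := clx; have /closureP /(_ m m0) [y' Oy' ym] := cly.
move: xm ym; rewrite !lt_min => /andP[/andP[xm1 _] /andP[xm3 xm4]] /andP[/andP[_ ym2] /andP[ym3 ym4]].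
have hx' := hdx x' (subset_closure Ox') xm1; have hy' := hdy y' (subset_closure Oy') ym2.
have seg : `|h y' - h x' - dotp (G x) (y' - x')| <= n%:R * e' * `|y' - x'|.
  rewrite -{1}(subrKC x' y'); apply: mvt_le => t t01; have Ot : Om (x' + t *: (y' - x')) by exact: cOm.
  split; first exact: hG.
  apply: hd; first exact: subset_closure.
  have -> : x' + t *: (y' - x') - x = (1 - t) *: (x' - x) + t *: ((y' - y) + (y - x)).
    by apply/rowP => i; rewrite !mxE; ring.
  apply: le_lt_trans (ler_normD _ _) _; rewrite !normrZ.
  have := ler_normD (y' - y) (y - x); have := normr_ge0 (y - x).
  move: t01 => /andP[t0 t1]; rewrite !ger0_norm ?subr_ge0 // => h1 h2.
  have ad : `|x' - x| < d by lra.
  have bd : `|y' - y + (y - x)| < d by lra.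
  move: ad bd; move: `|x' - x| `|y' - y + (y - x)| => a b ad bd.
  by have [ab|ab] := leP a b; nra.
have yx : `|y' - x'| <= `|y - x| + 2 * eta.
  rewrite (_ : y' - x' = (y - x) + ((y' - y) - (x' - x))); last first.
    by apply/rowP => i; rewrite !mxE; ring.
  apply: le_trans (ler_normD _ _) _; rewrite lerD2l; apply: le_trans (ler_normB _ _) _. lra.
have dyx : `|dotp (G x) ((y' - y) - (x' - x))| <= n%:R * (`|G x| * (2 * eta)).
  apply: le_trans (dotp_le_norm _ _) _; rewrite ler_wpM2l // ler_wpM2l //.
  by apply: le_trans (ler_normB _ _) _; lra.
have -> : h y - h x - dotp (G x) (y - x) = (h y' - h x' - dotp (G x) (y' - x'))
   + dotp (G x) ((y' - y) - (x' - x)) - (h y' - h y) + (h x' - h x).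
  by rewrite !dotpBr; ring.
apply: le_trans (ler_normD _ _) _; apply: le_trans (lerD (ler_normB _ _) (lexx _)) _.
apply: le_trans (lerD (lerD (ler_normD _ _) (lexx _)) (lexx _)) _.
have ne' : n%:R * e' <= e.
  by rewrite /e' mulrCA ler_piMr ?ltW // ltr_pdivrMr // mul1r ltrDl.
have e1 : n%:R * e' * `|y' - x'| <= e * `|y - x| + n%:R * e' * (2 * eta).
  apply: le_trans (ler_wpM2l _ yx) _; first by rewrite mulr_ge0 // ltW.
  by rewrite mulrDr lerD2r ler_wpM2r.
have e2 : n%:R * e' * (2 * eta) + n%:R * (`|G x| * (2 * eta)) <= q / 3.
  have -> : n%:R * e' * (2 * eta) + n%:R * (`|G x| * (2 * eta)) = (L - 1) * eta.
    by rewrite /L; ring.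
  by rewrite mulrBl mul1r etaE; lra.
lra.
Qed.

Lemma Ck_closure_in k Om u : open Om -> Ck_closure k Om u -> Ck_in k Om u.
Proof.
move=> oOm [_ pu eu]; split=> // s x sk Ox.
have [g [/cont_onP gc gE]] := eu s sk; have [r r0 hr] := open_ballP oOm Ox.
apply/(@cvgrPdist_le R R _ (nbhs x)) => e e0.
have [d d0 hd] := gc x (subset_closure Ox) e e0.
apply/nbhs_ballP; exists (Num.min d r); first by rewrite /= lt_min d0.
move=> y; rewrite -ball_normE /= distrC lt_min => /andP[yd yr].
by rewrite distrC -!gE //; [apply: hd => //; apply/subset_closure | ]; exact: hr.
Qed.

(** One family for all multi-indices, so that derivatives of an extension can be named as
    extensions. *)
Lemma closure_extension k Om u : open Om -> Ck_closure k Om u ->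
  exists E : seq 'I_n -> 'rV[R]_n -> R, [/\ E [::] = u,
    forall s, (size s <= k)%N -> cont_on (closure Om) (E s) &
    forall s x, (size s <= k)%N -> Om x -> E s x = dpart s u x].
Proof.
move=> oOm [uc pu eu].
have /choice [E hE] : forall s : seq 'I_n, exists g : 'rV[R]_n -> R, (size s <= k)%N ->
    cont_on (closure Om) g /\ (forall x, Om x -> g x = dpart s u x).
  move=> s; have [sk|] := leqP (size s) k; last by exists u.
  by have [g [/cont_onP gc gE]] := eu s sk; exists g.
exists (fun s => if s is [::] then u else E s); split=> // -[|i s] //.
- by move=> _; apply/cont_onP.
- by move=> /hE [].
- by move=> x /hE [_]; exact.
Qed.

Lemma grad_closureE k Om u (E : seq 'I_n -> 'rV[R]_n -> R) x : (0 < k)%N ->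
  (forall s, (size s <= k)%N -> cont_on (closure Om) (E s)) ->
  (forall s x, (size s <= k)%N -> Om x -> E s x = dpart s u x) ->
  closure Om x -> grad_closure Om u x = \row_i E [:: i] x.
Proof.
move=> k0 Ec EE clx; apply/rowP => i; rewrite !mxE.
have : ProperFilter (within Om (nbhs x)).
  split; last exact: within_filter.
  move=> H0; have [y [Oy]] := clx _ H0; exact.
move=> PF; apply: cvg_lim => //.
apply/cvgrPdist_le => e e0; have [d d0 hd] := Ec [:: i] k0 x clx e e0.
rewrite near_withinE; apply/nbhs_ballP; exists d => // y.
rewrite -ball_normE /= distrC => yd Oy.
by rewrite distrC -[partial _ _ _]/(dpart [:: i] u y) -EE //; apply: hd => //; exact: subset_closure.
Qed.

Lemma has_grad_extension k Om u (E : seq 'I_n -> 'rV[R]_n -> R) s x : open Om -> is_convex Om ->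
  Ck_in k Om u ->
  (forall s, (size s <= k)%N -> cont_on (closure Om) (E s)) ->
  (forall s x, (size s <= k)%N -> Om x -> E s x = dpart s u x) ->
  (size s < k)%N -> closure Om x -> has_grad (closure Om) (E s) x (\row_i E (i :: s) x).
Proof.
move=> oOm cOm uk Ec EE sk.
apply: (has_grad_closure cOm (h := E s) (G := fun x => \row_i E (i :: s) x)).
- move=> y Oy; have [r r0 hr] := open_ballP oOm Oy.
  have := has_grad_dpart uk sk Oy.
  rewrite (_ : \row_i _ = \row_i E (i :: s) y); last by apply/rowP => i; rewrite !mxE EE.
  by apply: (has_grad_near_eq r0) => z zr; rewrite EE ?(ltnW sk) //; exact: hr.
- exact: Ec (ltnW sk).
- move=> i; rewrite (_ : (fun _ => _) = E (i :: s)); first exact: Ec.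
  by rewrite funeqE => y; rewrite mxE.
Qed.
End UpToClosure.

(** * The shape operator of a level set *)

Section UnitNormal.
Context {R : realType} {n : nat}.
Implicit Types (A Om : set 'rV[R]_n) (h u rho : 'rV[R]_n -> R) (x y v w g p : 'rV[R]_n).

(** The derivative of the unit normal, in the direction [v], of the level sets of a function
    with gradient [G] and Hessian [H]. *)
Definition weingarten (G : 'rV[R]_n) (H : 'M[R]_n) v : 'rV[R]_n :=
  let nu := (enorm G)^-1 *: G in
  (enorm G)^-1 *: (v *m H - dotp (v *m H) nu *: nu).

Lemma has_grad_unit rho (H : 'M[R]_n) p : H^T = H -> grad rho p != 0 ->
  (forall i, has_grad setT (fun y => grad rho y 0 i) p (col i H)^T) ->
  forall i, exists2 g, has_grad setT (fun y => unit_grad rho y 0 i) p g &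
    forall v, dotp g v = weingarten (grad rho p) H v 0 i.
Proof.
move=> symH G0 hG i; set G := grad rho p; pose N y := enorm (grad rho y).
have N0 : 0 < N p by rewrite enorm_gt0.
have hq : has_grad setT (fun y => dotp (grad rho y) (grad rho y)) p (2 *: (G *m H)).
  have -> : 2 *: (G *m H) = \sum_k (G 0 k *: (col k H)^T + G 0 k *: (col k H)^T).
    apply/rowP => j; rewrite summxE !mxE mulr_sumr; apply: eq_bigr => k _.
    by rewrite !mxE -[H k j]/(H k j) -{1}symH mxE; ring.
  by apply: has_grad_sum => k; exact: has_gradM.
have hN : has_grad setT N p ((N p)^-1 *: (G *m H)).
  rewrite (_ : _ *: _ = (2 * Num.sqrt (dotp G G))^-1 *: (2 *: (G *m H))).
    by apply: has_grad_comp hq; apply: is_derive1_sqrt; rewrite dotp_gt0.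
  by rewrite scalerA; congr (_ *: _); rewrite /N /enorm -/G; field; rewrite gt_eqF // sqrtr_gt0 dotp_gt0.
have hV : has_grad setT (fun y => (N y)^-1) p (- (N p) ^- 2 *: ((N p)^-1 *: (G *m H))).
  by apply: has_gradV hN; rewrite gt_eqF.
have := has_gradM hV (hG i).
rewrite (_ : (fun y => _) = fun y => unit_grad rho y 0 i); last by rewrite funeqE => y; rewrite !mxE.
move=> hg; eexists; first exact: hg.
move=> v; rewrite /weingarten -/G -/(N p) !mxE.
rewrite !dotp_linE (dotp_mulmx_sym G v symH).
have -> : dotp (col i H)^T v = \sum_j v 0 j * H j i.
  by apply: eq_bigr => j _; rewrite !mxE mulrC.
field; exact: lt0r_neq0.
Qed.

Lemma derive_unit_grad rho (H : 'M[R]_n) p v : H^T = H -> grad rho p != 0 ->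
  (forall i, has_grad setT (fun y => grad rho y 0 i) p (col i H)^T) ->
  'D_v (unit_grad rho) p = weingarten (grad rho p) H v.
Proof.
move=> symH G0 hG.
have D i : is_derive p v (fun y => unit_grad rho y 0 i) (weingarten (grad rho p) H v 0 i).
  have [g hg <-] := has_grad_unit symH G0 hG i.
  by apply: (has_grad_derive v hg); exists 1.
rewrite derive_mx; last first.
  by apply/derivable_mxP => i j; rewrite (ord1 i); have [] := D j.
by apply/rowP => j; rewrite mxE; have [] := D j.
Qed.

Lemma has_grad_quadratic A (H : 'M[R]_n) x : H^T = H ->
  has_grad A (fun y => dotp (y *m H) y) x (2 *: (x *m H)).
Proof.
move=> symH; rewrite (_ : (fun y => _) = fun y => \sum_i dotp (col i H)^T (y - 0) * dotp (delta_mx 0 i) (y - 0)).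
  rewrite (_ : _ *: _ = \sum_i (dotp (col i H)^T (x - 0) *: delta_mx 0 i + dotp (delta_mx 0 i) (x - 0) *: (col i H)^T)).
    by apply: has_grad_sum => i; apply: has_gradM; exact: has_grad_affine.
  rewrite big_split /= scaler_nat mulr2n; congr (_ + _).
    rewrite [LHS]row_sum_delta; apply: eq_bigr => i _; congr (_ *: _).
    by rewrite subr0 mxE; apply: eq_bigr => j _; rewrite !mxE mulrC.
  apply/rowP => j; rewrite summxE mxE; apply: eq_bigr => i _.
  rewrite subr0 !mxE -[H j i]/(H j i) -{2}symH mxE; congr (_ * _).
  by rewrite dotp_deltal.
rewrite funeqE => y; apply: eq_bigr => i _; rewrite !subr0; congr (_ * _).
  by rewrite mxE; apply: eq_bigr => j _; rewrite !mxE mulrC.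
by rewrite dotp_deltal.
Qed.

Lemma has_grad_cont_on A B h (G : 'rV[R]_n -> 'rV[R]_n) :
  (forall x, A x -> has_grad B h x (G x)) -> A `<=` B -> cont_on A h.
Proof.
move=> hG AB x Ax e e0; have [d d0 hd] := has_grad_cont (hG x Ax) e0.
by exists d => // y /AB; exact: hd.
Qed.

Lemma closed_level h (c : R) : cont_on setT h -> closed [set x | h x = c].
Proof.
move=> hc x clx; apply/eqP; rewrite /= -subr_eq0 -normr_le0.
apply/ler_addgt0Pr => e e0; rewrite add0r.
have [d d0 hd] := hc x I e e0.
move/closureP: clx => /(_ d d0) [y <- yd]; rewrite distrC; exact: hd.
Qed.

(** The quadratic form attains its minimum on the unit sphere of the tangent space, which is
    compact. *)
Lemma tangent_minimum (H : 'M[R]_n) (nu : 'rV[R]_n) v : H^T = H ->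
  v != 0 -> dotp v nu = 0 ->
  exists w, [/\ w != 0, dotp w nu = 0 &
    forall v, dotp v nu = 0 -> dotp (w *m H) w * dotp v v <= dotp (v *m H) v * dotp w w].
Proof.
move=> symH v0 vnu.
pose T := [set y : 'rV[R]_n | dotp y nu = 0] `&` [set y | dotp y y = 1].
have cH K : K^T = K -> cont_on setT (fun y : 'rV[R]_n => dotp (y *m K) y).
  by move=> symK; apply: (@has_grad_cont_on _ setT _ (fun x => 2 *: (x *m K))) => // x _; exact: has_grad_quadratic.
have cT : compact T.
  apply: bounded_closed_compact.
    exists 1; split=> // M M1 y [_ y1]; apply: le_trans (norm_le_enorm y) _.
    by rewrite /enorm y1 sqrtr1 ltW.
  apply: closedI.
    rewrite (_ : [set y | _] = [set y | dotp nu (y - 0) = 0]); last first.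
      by apply/seteqP; split=> y /=; rewrite subr0 dotpC.
    apply: closed_level; apply: (@has_grad_cont_on _ setT _ (fun=> nu)) => // x _.
    exact: has_grad_affine.
  rewrite (_ : [set y | _] = [set y : 'rV[R]_n | dotp (y *m 1%:M) y = 1]); last first.
    by apply/seteqP; split=> y /=; rewrite mulmx1.
  by apply: closed_level; apply: cH; rewrite trmx1.
have unit (y : 'rV[R]_n) : y != 0 -> dotp y nu = 0 -> T ((enorm y)^-1 *: y).
  by move=> y0 ynu; split => /=; [rewrite dotpZl ynu mulr0 | exact: dotp_normalize].
have [||w] := @EVT_min_rV R n (fun y => dotp (y *m H) y) T _ cT.
- by exists ((enorm v)^-1 *: v); exact: unit.
- apply/cont_onP => x _ e e0; have [d d0 hd] := cH _ symH x I e e0.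
  by exists d => // y _; exact: hd.
rewrite inE => -[/= wnu w1] wmin; exists w; split=> //.
  by rewrite -dotp_eq0 w1 oner_eq0.
move=> y ynu; rewrite w1 mulr1; have [->|y0] := eqVneq y 0.
  by rewrite dotp0l mul0mx dotp0l mulr0.
have /mem_set /wmin := unit y y0 ynu.
rewrite -scalemxAl dotpZl dotpZr mulrA -expr2 exprVn sqr_enorm.
by rewrite -ler_pdivrMl ?invr_gt0 ?dotp_gt0 // invrK mulrC.
Qed.
End UnitNormal.

(** * Defining functions and the curvature of the boundary *)

Section DefiningFunctions.
Context {R : realType} {n : nat}.
Implicit Types (A Om : set 'rV[R]_n) (h u rho : 'rV[R]_n -> R) (x y v w g p : 'rV[R]_n).

Lemma ballP_norm p (r : R) y : ball p r y <-> `|y - p| < r.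
Proof. by rewrite -ball_normE /= distrC. Qed.

Lemma open_closure_boundary Om x : open Om -> closure Om x -> ~ Om x -> boundary Om x.
Proof. by move=> oOm clx nOx; split=> // /interior_subset. Qed.

Lemma boundary_notin Om x : open Om -> boundary Om x -> ~ Om x.
Proof. by move=> /interior_id E [_]; rewrite E. Qed.

Section Local.
Variables (Om : set 'rV[R]_n) (p : 'rV[R]_n) (r : R) (rho : 'rV[R]_n -> R).
Hypotheses (oOm : open Om) (def : local_defining Om p r rho).

Lemma defining_Ck k : Ck_in k (ball p r) rho.
Proof. by case: def => _ sm _ _; apply: smooth_on_Ck sm; exact: ball_open. Qed.

Lemma defining_grad y : `|y - p| < r -> has_grad setT rho y (grad rho y).
Proof.
move=> /ballP_norm yr; have := has_grad_dpart (defining_Ck 1) (s := [::]) isT yr.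
by rewrite /grad /=.
Qed.

Lemma defining_hessian y i : `|y - p| < r ->
  has_grad setT (fun z => grad rho z 0 i) y (col i (hessian rho y))^T.
Proof.
move=> /ballP_norm yr; have := has_grad_dpart (defining_Ck 2) (s := [:: i]) isT yr.
rewrite (_ : (fun z => grad rho z 0 i) = dpart [:: i] rho); last by rewrite funeqE => z; rewrite mxE.
by rewrite (_ : \row_q _ = (col i (hessian rho y))^T) //; apply/rowP => q; rewrite !mxE.
Qed.

Lemma defining_hessian_sym y : `|y - p| < r -> (hessian rho y)^T = hessian rho y.
Proof. by move=> /ballP_norm; exact: hessian_sym (defining_Ck 2) isT. Qed.

Lemma defining_radius : 0 < r. Proof. by case: def. Qed.

Lemma defining_neq0 y : `|y - p| < r -> grad rho y != 0.
Proof. by move=> /ballP_norm; case: def => _ _ + _; exact. Qed.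

Lemma defining_mem y : `|y - p| < r -> Om y <-> rho y < 0.
Proof. by move=> /ballP_norm; case: def => _ _ _; exact. Qed.

Lemma center_near : `|p - p| < r.
Proof. by rewrite subrr normr0; exact: defining_radius. Qed.

Lemma defining_le0 y : `|y - p| < r -> closure Om y -> rho y <= 0.
Proof.
move=> yr /closureP cly; rewrite leNgt; apply/negP => ry.
have [d d0 hd] := has_grad_cont (defining_grad yr) (half_pos ry).
have m0 : 0 < Num.min d (r - `|y - p|) by rewrite lt_min d0 subr_gt0.
have [z Oz] := cly _ m0; rewrite lt_min => /andP[zd zr].
have /defining_mem : `|z - p| < r.
  have := ler_normD (z - y) (y - p); rewrite addrA subrK; lra.
move=> [/(_ Oz) rz _]; have := hd z I zd; rewrite ler_norml; lra.
Qed.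

Lemma defining_eq0 y : `|y - p| < r -> boundary Om y -> rho y = 0.
Proof.
move=> yr By; apply/eqP; rewrite eq_le defining_le0 //=; last by case: By.
rewrite leNgt; apply/negP => /(proj2 (defining_mem yr)); exact: boundary_notin.
Qed.

Lemma inward_mem y v : `|y - p| < r -> rho y = 0 -> dotp (grad rho y) v < 0 ->
  right0 (fun t => Om (y + t *: v)).
Proof.
move=> yr ry0 vneg.
have V0 : 0 < `|v| + 1 by rewrite ltr_wpDl.
have dr : rdiff (rho \o (fun t => y + t *: v)) (rho y) (dotp (grad rho y) v).
  apply: rdiff_comp (defining_grad yr) (rdiff_line y v) _.
  by exists 1.
have e0 : 0 < - dotp (grad rho y) v / 2 by lra.
have r'0 : 0 < (r - `|y - p|) / (`|v| + 1) by rewrite divr_gt0 // subr_gt0.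
have [d d0 hd] := right0_and (dr _ e0) (right0_lt r'0).
exists d => // t td; have [h1 /andP[t0 tr]] := hd t td.
apply/defining_mem.
  rewrite addrAC; apply: le_lt_trans (ler_normD _ _) _; rewrite normrZ gtr0_norm //.
  move: tr; rewrite ltr_pdivlMr //; have := normr_ge0 v; nra.
by move: h1; rewrite /= ry0 subr0 ler_norml /GRing.scale /=; nra.
Qed.

Lemma boundary_of_eq0 y : `|y - p| < r -> rho y = 0 -> boundary Om y.
Proof.
move=> yr ry0; apply: open_closure_boundary => //; last first.
  by move=> /(proj1 (defining_mem yr)); rewrite ry0 ltxx.
apply/closureP => e e0; pose v := - grad rho y.
have v0 : 0 < `|v| by rewrite normr_gt0 oppr_eq0 defining_neq0.
have : dotp (grad rho y) v < 0 by rewrite dotpNr oppr_lt0 dotp_gt0 defining_neq0.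
move=> /(inward_mem yr ry0) /(right0_and (right0_lt (divr_gt0 e0 v0))) /right0_ex [t t0 [/andP[_ te] Ot]].
exists (y + t *: v) => //; rewrite addrC addKr normrZ gtr0_norm //.
by move: te; rewrite ltr_pdivlMr.
Qed.

Lemma defining_recenter y : `|y - p| < r -> local_defining Om y (r - `|y - p|) rho.
Proof.
move=> yr; have sub z : ball y (r - `|y - p|) z -> ball p r z.
  move=> /ballP_norm zy; apply/ballP_norm; have := ler_normD (z - y) (y - p); rewrite addrA subrK; lra.
case: def => r0 [sm1 sm2] nz mem; split.
- by rewrite subr_gt0.
- split=> [k s i z sk /sub|s z /sub]; [exact: sm1 k s i z sk | exact: sm2].
- by move=> z /sub; exact: nz.
- by move=> z /sub; exact: mem.
Qed.

Lemma defining_outward y : `|y - p| < r -> outward_normal Om y (unit_grad rho y).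
Proof. by move=> yr; exists (r - `|y - p|), rho; split=> //; exact: defining_recenter. Qed.

Section Curvature.
Variable kappa : R.
Hypotheses (Bp : boundary Om p) (curv : curvatures_ge Om kappa).

Let G := grad rho p.
Let H := hessian rho p.

(** The curvatures are only known through eigenvectors of the shape operator.  A tangent vector
    that minimises the quotient of the Hessian by the squared length is one: its eigenvalue is
    the minimum of the quotient divided by the length of [G], and the bound at the minimum is
    the bound everywhere. *)
Lemma curvature_form v : dotp v G = 0 -> kappa * enorm G * dotp v v <= dotp (v *m H) v.
Proof.
move=> vG; have [->|v0] := eqVneq v 0; first by rewrite mul0mx !dotp0l mulr0.
have symH : H^T = H by exact: defining_hessian_sym center_near.
have G0 : G != 0 by exact: defining_neq0 center_near.
have eG0 : 0 < enorm G by rewrite enorm_gt0.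
have [w [w0 wG wmin]] := tangent_minimum symH v0 vG.
have ww : 0 < dotp w w by rewrite dotp_gt0.
pose m := dotp (w *m H) w / dotp w w.
(* stationarity at the minimum: w *m H - m *: w is normal to the tangent space *)
have lin y : dotp y G = 0 -> dotp (w *m H - m *: w) y = 0.
  move=> yG; set b := dotp _ _.
  have quad (t : R) : 0 <= 2 * b * t + t ^+ 2 * (dotp (y *m H) y - m * dotp y y).
    have := wmin (w + t *: y); rewrite dotpDl dotpZl wG yG mulr0 addr0 => /(_ erefl).
    rewrite -(ler_pM2r (_ : 0 < (dotp w w)^-1)) ?invr_gt0 // mulfK ?gt_eqF // mulrAC -/m.
    rewrite mulmxDl -scalemxAl !dotp_linE (dotp_mulmx_sym y w symH) (dotpC y w).
    have mE : dotp (w *m H) w = m * dotp w w by rewrite /m divfK // gt_eqF.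
    rewrite mE /b !dotp_linE; lra.
  set c := dotp (y *m H) y - m * dotp y y in quad.
  apply/eqP; rewrite -[_ == _]negbK; apply/negP => b0.
  have c0 : 0 < `|c| + 1 by rewrite ltr_wpDl.
  have := quad (- b / (`|c| + 1)).
  have -> : 2 * b * (- b / (`|c| + 1)) + (- b / (`|c| + 1)) ^+ 2 * c =
     (b / (`|c| + 1)) ^+ 2 * (c - 2 * (`|c| + 1)) by field; rewrite gt_eqF.
  have : 0 < (b / (`|c| + 1)) ^+ 2 by rewrite exprn_even_gt0 //= mulf_neq0 // invr_neq0 // gt_eqF.
  have := ler_norm c; nra.
have [nu nuE] : exists nu, nu = (enorm G)^-1 *: G by eexists.
have nunu : dotp nu nu = 1.
  by rewrite nuE dotpZl dotpZr -sqr_enorm; field; rewrite gt_eqF.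
have wH : w *m H - dotp (w *m H) nu *: nu = m *: w.
  apply/eqP; rewrite -subr_eq0 addrAC -dotp_eq0; apply/eqP.
  set z := w *m H - m *: w - _.
  have znu : dotp z nu = 0.
    have wnu : dotp w nu = 0 by rewrite nuE dotpZr wG mulr0.
    by rewrite /z !dotpBl !dotpZl nunu wnu; ring.
  have zG : dotp z G = 0.
    move: znu; rewrite nuE dotpZr => /eqP; rewrite mulf_eq0 invr_eq0 gt_eqF //= => /eqP ->.
    by [].
  have := lin z zG; rewrite {2}/z => E.
  by rewrite {1}/z dotpBl E dotpZl (dotpC nu z) znu mulr0 subr0.
have pc : principal_curvature Om p (m / enorm G).
  exists r, rho; split=> //; exists w; split=> //.
    by rewrite /unit_grad -/G dotpZr wG mulr0.
  rewrite (derive_unit_grad w symH G0 (fun i => defining_hessian i center_near)).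
  by rewrite /weingarten -/G -nuE wH scalerA mulrC.
have := curv Bp pc; rewrite ler_pdivlMr // => km.
have := wmin v vG; rewrite -ler_pdivrMr // mulrAC -/m.
by apply: le_trans; rewrite ler_wpM2r // dotp_ge0.
Qed.

(** Applied along [v] and [- v], the first-order condition makes [v] tangent.  Along the
    parabola the defining function then grows like [t ^+ 2] times [dotp G w + dotp (v *m H) v /
    2], which is positive because the curvature dominates the acceleration. *)
Lemma no_inner_parabola v w : 0 < kappa -> 2 * enorm w < kappa * dotp v v ->
  ~ right0 (fun t => closure Om (p + t *: v + t ^+ 2 *: w) /\ closure Om (p + t *: (- v) + t ^+ 2 *: w)).
Proof.
move=> k0 wv hin.
have pr := center_near.
have rp0 : rho p = 0 by exact: defining_eq0.
have symH : H^T = H by exact: defining_hessian_sym.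
have eG0 : 0 < enorm G by rewrite enorm_gt0; exact: defining_neq0.
have closeness (v' : 'rV[R]_n) : right0 (fun t => `|t *: v' + t ^+ 2 *: w| < r).
  have V0 : 0 < `|v'| + `|w| + 1 by rewrite ltr_wpDl // addr_ge0.
  have := right0_and (right0_lt ltr01) (right0_lt (divr_gt0 defining_radius V0)).
  move=> [d d0 hd]; exists d => // t /hd [/andP[t0 t1] /andP[_ tr]].
  apply: le_lt_trans (ler_normD _ _) _; rewrite !normrZ !ger0_norm ?sqr_ge0 ?(ltW t0) //.
  move: tr; rewrite ltr_pdivlMr //.
  have : t ^+ 2 * `|w| <= t * `|w| by rewrite ler_wpM2r // expr2 ler_piMl ?ltW.
  lra.
have le0 v' : right0 (fun t => closure Om (p + t *: v' + t ^+ 2 *: w)) ->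
    right0 (fun t => rho (p + t *: v' + t ^+ 2 *: w) <= 0).
  move=> /(right0_and (closeness v')) [d d0 hd]; exists d => // t /hd [tr cl].
  by apply: defining_le0 => //; rewrite -(addrA p) (addrC p) addrK.
have hin1 : right0 (fun t => closure Om (p + t *: v + t ^+ 2 *: w)).
  by have [d d0 hd] := hin; exists d => // t /hd [].
have hin2 : right0 (fun t => closure Om (p + t *: (- v) + t ^+ 2 *: w)).
  by have [d d0 hd] := hin; exists d => // t /hd [].
have first_order v' : right0 (fun t => closure Om (p + t *: v' + t ^+ 2 *: w)) -> dotp G v' <= 0.
  move=> /le0 hle; apply: (rdiff_le (c := rho p) (f := rho \o (fun t => p + t *: v' + t ^+ 2 *: w))).
  - by apply: rdiff_comp (defining_grad pr) (rdiff_quadratic p v' w) _; exists 1.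
  - exact: rdiff_cst.
  - by rewrite rp0.
have Gv : dotp G v = 0.
  have := first_order _ hin1; have := first_order _ hin2; rewrite dotpNr; lra.
have vHv := curvature_form (etrans (dotpC _ _) Gv).
pose a := dotp G w + dotp (v *m H) v / 2.
have a0 : 0 < a.
  have := dotp_le (- G) w; rewrite enormN dotpNl => h1.
  have : enorm G * (2 * enorm w) < enorm G * (kappa * dotp v v) by rewrite ltr_pM2l.
  rewrite /a; nra.
pose M := `|v| + `|w| + 1; have M0 : 0 < M by rewrite ltr_wpDl // addr_ge0.
pose C := `|dotp (w *m H) v| + `|dotp (w *m H) w| + 1.
have C0 : 0 < C by rewrite ltr_wpDl // addr_ge0.
have e0 : 0 < a / 4 / M ^+ 2 by rewrite !divr_gt0 // exprn_gt0.
have [d d0 hd] := taylor2 defining_radius defining_grad (fun i => defining_hessian i pr) e0.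
have := right0_and (le0 _ hin1) (right0_and (right0_lt ltr01)
  (right0_and (right0_lt (divr_gt0 d0 M0)) (right0_lt (divr_gt0 (half_pos a0) C0)))).
move=> /right0_ex [t t0 [rle [/andP[_ t1] [/andP[_ tM] /andP[_ tC]]]]].
have tvw : `|t *: v + t ^+ 2 *: w| <= t * M.
  apply: le_trans (ler_normD _ _) _; rewrite !normrZ !ger0_norm ?sqr_ge0 ?(ltW t0) // /M.
  have : t ^+ 2 * `|w| <= t * `|w| by rewrite ler_wpM2r // expr2 ler_piMl ?ltW.
  by have := normr_ge0 v; lra.
have := hd (t *: v + t ^+ 2 *: w).
rewrite addrA rp0 ltr_pdivlMr // in tM *; move=> /(_ (le_lt_trans tvw tM)).
rewrite mulmxDl -!scalemxAl !dotp_linE Gv (dotp_mulmx_sym v w symH) => h1.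
have h2 : a / 4 / M ^+ 2 * `|t *: v + t ^+ 2 *: w| ^+ 2 <= a / 4 * t ^+ 2.
  apply: le_trans (_ : a / 4 / M ^+ 2 * (t * M) ^+ 2 <= _).
    by rewrite ler_pM2l // ler_pXn2r ?nnegrE // mulr_ge0 // ltW.
  by rewrite exprMn mulrA mulrAC divfK // expf_neq0 // gt_eqF.
have h3 : `|t * dotp (w *m H) v + t ^+ 2 * (dotp (w *m H) w / 2)| <= a / 2.
  apply: le_trans (ler_normD _ _) _.
  have -> : `|t * dotp (w *m H) v| = t * `|dotp (w *m H) v| by rewrite normrM (gtr0_norm t0).
  have -> : `|t ^+ 2 * (dotp (w *m H) w / 2)| = t ^+ 2 * (`|dotp (w *m H) w| / 2).
    by rewrite normrM (ger0_norm (sqr_ge0 t)) normrM (ger0_norm (_ : 0 <= 2^-1)).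
  rewrite ltr_pdivlMr // /C in tC.
  have := normr_ge0 (dotp (w *m H) v); have := normr_ge0 (dotp (w *m H) w).
  move: tC; move: `|dotp (w *m H) v| `|dotp (w *m H) w| => X Y tC Y0 X0.
  have : t ^+ 2 * Y <= t * Y by rewrite ler_wpM2r // expr2 ler_piMl ?ltW.
  have : 0 <= t * Y by rewrite mulr_ge0 // ltW.
  lra.
have t20 : 0 < t ^+ 2 by rewrite exprn_gt0.
move: h1; rewrite ler_norml => /andP[h1 _].
move: h3; rewrite ler_norml => /andP[h3 _].
have : t ^+ 2 * (- (a / 2)) <= t ^+ 2 * (t * dotp (w *m H) v + t ^+ 2 * (dotp (w *m H) w / 2)) by rewrite ler_pM2l.
have : 0 < t ^+ 2 * a by rewrite mulr_gt0.
rewrite /a in h1 h2 *; lra.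
Qed.
End Curvature.
End Local.
End DefiningFunctions.

(** * Convexity of the domain *)

Section Convexity.
Context {R : realType} {n : nat}.
Implicit Types (A Om : set 'rV[R]_n) (h u rho : 'rV[R]_n -> R) (x y v w g p : 'rV[R]_n).

Lemma segment_margin Om x v : open Om -> (forall t : R, 0 <= t <= 1 -> Om (x + t *: v)) ->
  exists2 r : R, 0 < r & forall (t : R) y, 0 <= t <= 1 -> `|y - (x + t *: v)| < r -> Om y.
Proof.
move=> oOm hseg; have /compact_near_coveringP cK := @segment_compact R 0 1.
have V0 : 0 < `|v| + 1 by rewrite ltr_wpDl.
have := cK R (0^'+) (fun r t => forall y, `|y - (x + t *: v)| < r -> Om y) _.
case=> [t|d /= d0 hd].
  rewrite /= in_itv /= => /hseg /(open_ballP oOm) [s s0 hs].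
  exists ([set t' | `|t' - t| < s / 2 / (`|v| + 1)], [set r | r < s / 2]).
    split => /=.
      by apply/nbhs_ballP; exists (s / 2 / (`|v| + 1)); rewrite /= ?divr_gt0 // => t'; rewrite /ball /= distrC.
    by apply: nbhs_right_lt; lra.
  move=> [t' r] /= [ht' hr] y hy; apply: hs.
  rewrite (_ : y - _ = (y - (x + t' *: v)) + (t' - t) *: v); last first.
    by apply/rowP => i; rewrite !mxE; ring.
  apply: le_lt_trans (ler_normD _ _) _; rewrite normrZ.
  move: ht'; rewrite ltr_pdivlMr // => ht'.
  have : `|t' - t| * `|v| <= `|t' - t| * (`|v| + 1) by rewrite ler_wpM2l // lerDl.
  lra.
exists (d / 2); first exact: half_pos.
move=> t y t01; have := hd (d / 2); rewrite /= sub0r normrN gtr0_norm ?half_pos //.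
by move=> /(_ ltac:(lra) isT t); rewrite /= in_itv /=; apply.
Qed.

Lemma no_touch Om (kappa : R) p v w : open Om -> smooth_boundary Om ->
  curvatures_ge Om kappa -> 0 < kappa -> boundary Om p ->
  2 * enorm w < kappa * dotp v v ->
  ~ right0 (fun t => closure Om (p + t *: v + t ^+ 2 *: w) /\ closure Om (p + t *: (- v) + t ^+ 2 *: w)).
Proof.
move=> oOm sOm curv k0 Bp; have [r [rho def]] := sOm p Bp.
exact: (no_inner_parabola oOm def Bp curv k0).
Qed.

(** For a fixed [x], the points whose segment from [x] stays in [Om] form an open set, by
    compactness of segments.  They are also closed in [Om]: a limit segment lies in the closure,
    and where it met the boundary a straight line would touch the boundary from inside.
    Connectedness concludes. *)
Lemma convex_domain Om (kappa : R) : domain Om -> smooth_boundary Om ->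
  curvatures_ge Om kappa -> 0 < kappa -> is_convex Om.
Proof.
move=> [oOm conn _] sOm curv k0 x y t Ox.
pose S := [set y | forall t : R, 0 <= t <= 1 -> Om (x + t *: (y - x))].
pose C := [set y | forall t : R, 0 <= t <= 1 -> closure Om (x + t *: (y - x))].
have SOm z : S z -> Om z.
  by move=> /(_ 1); rewrite scale1r subrKC; apply; rewrite lexx ler01.
have openS : open S.
  rewrite openE => z /(segment_margin oOm) [r r0 hr].
  apply/nbhs_ballP; exists r => // z' /ballP_norm zz' s s01.
  apply: (hr s) => //.
  rewrite (_ : x + s *: (z' - x) - (x + s *: (z - x)) = s *: (z' - z)); last by apply/rowP => i; rewrite !mxE; ring.
  by rewrite normrZ; move: s01 => /andP[s0 s1]; rewrite ger0_norm //; apply: le_lt_trans zz'; rewrite ler_piMl.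
have closedC : closed C.
  move=> z /closureP clz s s01; apply/closureP => e e0.
  have [z' Cz' ze] := clz (e / 2) (half_pos e0).
  have /closureP /(_ _ (half_pos e0)) [y' Oy' ye] := Cz' s s01.
  exists y' => //; rewrite (_ : y' - (x + s *: (z - x)) = (y' - (x + s *: (z' - x))) + s *: (z' - z)); last first.
    by apply/rowP => i; rewrite !mxE; ring.
  apply: le_lt_trans (ler_normD _ _) _; rewrite normrZ.
  move: s01 => /andP[s0 s1]; rewrite (ger0_norm s0).
  have : s * `|z' - z| <= `|z' - z| by rewrite ler_piMl.
  lra.
have SC : S = Om `&` C.
  apply/seteqP; split=> [z Sz|z [Oz Cz] s s01].
    by split=> [|s s01]; [exact: SOm | exact/subset_closure/Sz].
  have [//|nO] := pselect (Om (x + s *: (z - x))); exfalso.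
  have Bp : boundary Om (x + s *: (z - x)) by apply: open_closure_boundary => //; exact: Cz.
  have s0 : 0 < s.
    move: s01 => /andP[]; rewrite le_eqVlt => /orP[/eqP s0|//].
    by case: nO; rewrite -s0 scale0r addr0.
  have s1 : s < 1.
    move: s01 => /andP[_]; rewrite le_eqVlt => /orP[/eqP s1|//].
    by case: nO; rewrite s1 scale1r subrKC.
  have v0 : z - x != 0.
    by apply/eqP => v0; case: nO; rewrite v0 scaler0 addr0.
  apply: (no_touch oOm sOm curv k0 Bp (v := z - x) (w := 0)).
    by rewrite /enorm dotp0l sqrtr0 mulr0 mulr_gt0 // dotp_gt0.
  exists (Num.min s (1 - s)); first by rewrite lt_min s0 subr_gt0.
  move=> q; rewrite lt_min => /andP[q0 /andP[qs qs1]]; rewrite !scaler0 !addr0; split.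
    by rewrite -addrA -scalerDl; apply: Cz; apply/andP; split; lra.
  by rewrite scalerN -scaleNr -addrA -scalerDl; apply: Cz; apply/andP; split; lra.
suff SE : S = Om by move=> Oy; have : S y; [rewrite SE | apply].
apply: conn.
- by exists x => s _; rewrite subrr scaler0 addr0.
- by exists S => //; apply/seteqP; split=> [z Sz|z []//]; split=> //; exact: SOm.
- by exists C.
Qed.

(** The defining function is nonpositive along the segment from [p] to [y], which stays in the
    closure. *)
Lemma supporting_hyperplane Om p (r : R) rho y : open Om -> is_convex Om ->
  local_defining Om p r rho -> boundary Om p -> closure Om y ->
  dotp (grad rho p) (y - p) <= 0.
Proof.
move=> oOm cOm def Bp cly; have pr := center_near def.
have rp := defining_eq0 oOm def pr Bp.
have V0 : 0 < `|y - p| + 1 by rewrite ltr_wpDl.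
apply: (rdiff_le (c := rho p) (f := rho \o (fun t => p + t *: (y - p))) (k := fun=> rho p)).
- by apply: rdiff_comp (defining_grad def pr) (rdiff_line p (y - p)) _; exists 1.
- exact: rdiff_cst.
have [d d0 hd] := right0_and (right0_lt ltr01) (right0_lt (divr_gt0 (defining_radius def) V0)).
exists d => // t /hd [/andP[t0 t1] /andP[_ tr]]; rewrite rp.
apply: (defining_le0 def).
  rewrite addrC addKr normrZ (gtr0_norm t0); move: tr; rewrite ltr_pdivlMr // => tr.
  by apply: le_lt_trans tr; rewrite ler_wpM2l ?(ltW t0) // lerDl.
by apply: convex_closure => //; [case: Bp | rewrite (ltW t0) (ltW t1)].
Qed.

End Convexity.

(** * The diameter of the domain *)

Section Diameter.
Context {R : realType}.

Lemma orthogonal_unit n (e : 'rV[R]_n) : (2 <= n)%N ->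
  exists2 e' : 'rV[R]_n, dotp e' e' = 1 & dotp e e' = 0.
Proof.
move=> n2; have [v v0 ve] := common_kernel (e^T : 'M[R]_(n, 1)) n2.
exists ((enorm v)^-1 *: v); first exact: dotp_normalize.
by rewrite dotpZr dotpC dotpE ve mxE mulr0.
Qed.

(** Among the circular arcs through [(-r, 0)] and [(r, 0)], the point [(X, Y)] lies on the one
    centred at height [h(X, Y) = (X ^+ 2 + Y ^+ 2 - r ^+ 2) / (2 Y)].  Minimising [h] over the
    points with [Y > 0] that lie outside of [U] gives the first arc that leaves [U]. *)
Lemma first_arc (U : set 'rV[R]_2) (r : R) : 0 < r -> open U -> bounded_set U ->
  (forall z : 'rV[R]_2, z 0 1 = 0 -> `|z 0 0| <= r -> U z) ->
  exists (z : 'rV[R]_2) (h : R), [/\ 0 < z 0 1, ~ U z,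
    z 0 0 ^+ 2 + z 0 1 ^+ 2 - r ^+ 2 = 2 * h * z 0 1 &
    forall y : 'rV[R]_2, 0 < y 0 1 -> y 0 0 ^+ 2 + y 0 1 ^+ 2 - r ^+ 2 < 2 * h * y 0 1 -> U y].
Proof.
move=> r0 oU bU hseg.
pose pt (X Y : R) : 'rV[R]_2 := \row_i (if i == 0 then X else Y).
have ptX X Y : pt X Y 0 0 = X by rewrite mxE.
have ptY X Y : pt X Y 0 1 = Y by rewrite mxE.
have normE (z : 'rV[R]_2) (c : R) : 0 <= c -> `|z 0 0| <= c -> `|z 0 1| <= c -> `|z| <= c.
  move=> c0 hX hY; apply: norm_rV_le => // -[[|[|//]] hj].
    by rewrite (_ : Ordinal hj = 0) //; apply: val_inj.
  by rewrite (_ : Ordinal hj = 1) //; apply: val_inj.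
have [Y1 Y10 nUY1] : exists2 Y1 : R, 0 < Y1 & ~ U (pt 0 Y1).
  case: bU => M [_ hM]; pose Y1 := `|M| + 2.
  have Y10 : 0 < Y1 by rewrite ltr_wpDl.
  exists Y1 => // UY1; have := hM (`|M| + 1) _ _ UY1.
  have M1 : M < `|M| + 1 by have := ler_norm M; lra.
  move=> /(_ M1) h; have := coord_le_norm (pt 0 Y1) 1; rewrite ptY gtr0_norm // /Y1.
  by have := le_trans (coord_le_norm (pt 0 Y1) 1) h; rewrite ptY gtr0_norm // /Y1; lra.
pose hb := Y1 / 2; have hb0 : 0 < hb by exact: half_pos.
have [mu mu0 hmu] : exists2 mu : R, 0 < mu & forall (t : R) y, 0 <= t <= 1 ->
    `|y - (pt (- r) 0 + t *: pt (2 * r) 0)| < mu -> U y.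
  apply: segment_margin => // t /andP[t0 t1]; apply: hseg; rewrite !mxE /= ?mulr0 ?addr0 //.
  by rewrite ler_norml; apply/andP; split; nra.
pose delta := Num.min (Num.min (r * mu / (4 * hb)) (mu / 4)) Y1.
have [d0 d1 d2 d3] : [/\ 0 < delta, delta <= r * mu / (4 * hb), delta <= mu / 4 & delta <= Y1].
  split; rewrite /delta ?lt_min ?ge_min ?lexx ?orbT // Y10 !divr_gt0 // !mulr_gt0 //.
have near_segment (y : 'rV[R]_2) : 0 < y 0 1 < delta ->
    y 0 0 ^+ 2 + y 0 1 ^+ 2 - r ^+ 2 <= 2 * hb * y 0 1 -> U y.
  move=> /andP[y0 yd] yh.
  have X2 : `|y 0 0| < r + mu / 4.
    rewrite -(ltr_pXn2r (n := 2)) ?nnegrE //; last by lra.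
    rewrite real_normK ?num_real //.
    have : 2 * hb * y 0 1 <= r * mu / 2.
      apply: le_trans (_ : 2 * hb * (r * mu / (4 * hb)) <= _).
        by rewrite ler_pM2l ?mulr_gt0 //; lra.
      by rewrite le_eqVlt; apply/orP; left; apply/eqP; field; rewrite gt_eqF.
    by have := sqr_ge0 (y 0 1); have := sqr_ge0 mu; nra.
  pose c := if r < y 0 0 then r else if y 0 0 < - r then - r else y 0 0.
  have [cr cX] : - r <= c <= r /\ `|y 0 0 - c| < mu / 4.
    move: X2; rewrite ltr_norml => /andP[x1 x2]; rewrite /c.
    case: ltP => h1; first by split; [lra | rewrite ltr_norml; lra].
    case: ltP => h2; first by split; [lra | rewrite ltr_norml; lra].
    by rewrite subrr normr0; split; lra.
  apply: (hmu ((c + r) / (2 * r))).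
    by rewrite divr_ge0 ?ler_pdivrMr ?mulr_gt0 //; lra.
  apply: le_lt_trans (_ : mu / 2 < _); last by lra.
  have cE : - r + (c + r) / (2 * r) * (2 * r) = c by field; rewrite gt_eqF.
  apply: normE; first lra; rewrite !mxE /=.
    by rewrite cE; lra.
  by rewrite mulr0 addr0 subr0 gtr0_norm //; lra.
pose L := r + Y1.
pose E := [set z : 'rV[R]_2 | [/\ delta <= z 0 1, `|z| <= L & ~ U z]].
have cE : compact E.
  apply: bounded_closed_compact.
    exists L; split; first exact: num_real.
    by move=> M LM z [_ zL _]; apply: le_trans zL (ltW LM).
  move=> z /closureP clz; split.
  - apply/ler_addgt0Pr => e e0; have [y [yd _ _] ye] := clz e e0.
    have := le_trans (coord_le_norm (y - z) 1) (ltW ye); rewrite !mxE ler_norml; lra.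
  - apply/ler_addgt0Pr => e e0; have [y [_ yL _] ye] := clz e e0.
    by have := ler_normD (z - y) y; rewrite subrK distrC; lra.
  - move=> /(open_ballP oU) [s s0 hs]; have [y [_ _ nUy] ys] := clz s s0.
    exact/nUy/hs.
pose q (z : 'rV[R]_2) := z 0 0 ^+ 2 + z 0 1 ^+ 2 - r ^+ 2.
pose h (z : 'rV[R]_2) := q z * (2 * z 0 1)^-1.
have hq (z : 'rV[R]_2) : 0 < z 0 1 -> q z = 2 * h z * z 0 1.
  by move=> z0; rewrite /h; field; rewrite gt_eqF.
have hlt (z : 'rV[R]_2) (c : R) : 0 < z 0 1 -> q z < 2 * c * z 0 1 -> h z < c.
  move=> z0; rewrite hq // => lt; rewrite -(ltr_pM2r z0) -(ltr_pM2l (_ : 0 < 2)) //; lra.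
have Y1E : E (pt 0 Y1).
  split=> //; first by rewrite ptY.
  by apply: normE; rewrite /L ?ptX ?ptY ?normr0 ?gtr0_norm //; lra.
have hY1 : h (pt 0 Y1) <= hb.
  rewrite /h /q ptX ptY /hb expr0n /= add0r ler_pdivrMr ?mulr_gt0 //.
  by have := sqr_ge0 r; lra.
have [||z] := @EVT_min_rV R 2 h E _ cE.
- by exists (pt 0 Y1).
- apply/cont_onP.
  have grad_h z : E z -> exists g, has_grad setT h z g.
    move=> [zd _ _]; have z0 : 0 < z 0 1 by apply: lt_le_trans zd.
    have hX := has_grad_coord setT z 0; have hY := has_grad_coord setT z 1.
    have hq' := has_gradD (has_gradD (has_gradM hX hX) (has_gradM hY hY)) (has_grad_cst setT (- r ^+ 2) z).
    have h2Y := has_gradV (_ : 2 * z 0 1 != 0) (has_gradZ 2 hY).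
    eexists; rewrite (_ : h = fun y => (y 0 0 * y 0 0 + y 0 1 * y 0 1 + - r ^+ 2) * (2 * y 0 1)^-1).
      by apply: has_gradM hq' _; apply: h2Y; rewrite mulf_neq0 // gt_eqF.
    by rewrite funeqE.
  move=> z Ez; have [g hg] := grad_h z Ez => e e0.
  by have [d dd hd] := has_grad_cont hg e0; exists d => // y _; exact: hd.
rewrite inE => -[zd zL nUz] zmin; have z0 : 0 < z 0 1 by apply: lt_le_trans zd.
have hzb : h z <= hb by apply: le_trans hY1; apply: zmin; rewrite inE.
exists z, (h z); split=> //; first exact: hq.
move=> y y0 yh; have [//|nUy] := pselect (U y); exfalso; apply: nUy.
have yhb : y 0 0 ^+ 2 + y 0 1 ^+ 2 - r ^+ 2 < 2 * hb * y 0 1.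
  apply: lt_le_trans yh _; rewrite ler_pM2r //; lra.
have [yd|yd] := ltP (y 0 1) delta; first by apply: near_segment; [rewrite y0 | exact: ltW].
have [//|nUy] := pselect (U y).
have : E y.
  split=> //; apply: normE; rewrite /L.
  - lra.
  - rewrite -(ler_pXn2r (n := 2)) ?nnegrE //; last lra.
    rewrite real_normK ?num_real //.
    have : (y 0 1 - hb) ^+ 2 + y 0 0 ^+ 2 < r ^+ 2 + hb ^+ 2 by lra.
    have := sqr_ge0 (y 0 1 - hb); rewrite /hb; nra.
  - rewrite -(ler_pXn2r (n := 2)) ?nnegrE //; last lra.
    rewrite real_normK ?num_real //.
    have := sqr_ge0 (y 0 0); move: yhb; rewrite /hb; nra.
move=> /mem_set /zmin; rewrite leNgt => /negP []; exact: hlt.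
Qed.

(** In a plane through two points at distance [2 * r], the first arc through them that leaves
    [Om] is part of a circle of radius at least [r], and it touches the boundary from inside.
    Were [r] larger than [1 / kappa], this circle would contain a parabola of curvature below
    [kappa], which cannot touch the boundary. *)
Lemma diameter_le n (Om : set 'rV[R]_n) (kappa : R) p q : (2 <= n)%N -> open Om -> is_convex Om ->
  smooth_boundary Om -> curvatures_ge Om kappa -> 0 < kappa -> bounded_set Om ->
  Om p -> Om q -> enorm (q - p) <= 2 / kappa.
Proof.
move=> n2 oOm cOm sOm curv k0 bOm Op Oq; rewrite leNgt; apply/negP => long.
pose r := enorm (q - p) / 2.
have k1 : 0 < 1 / kappa by rewrite divr_gt0.
have rk : 1 / kappa < r by rewrite /r; lra.
have r0 : 0 < r by lra.
have [e1 e1E] : exists e1 : 'rV[R]_n, e1 = (2 * r)^-1 *: (q - p) by eexists.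
have e11 : dotp e1 e1 = 1.
  rewrite e1E dotpZl dotpZr -sqr_enorm (_ : enorm (q - p) = 2 * r); last by rewrite /r; field.
  by field; rewrite gt_eqF.
have [e2 e22 e12] := orthogonal_unit e1 n2.
pose m : 'rV[R]_n := p + r *: e1.
pose P (z : 'rV[R]_2) := m + (z 0 0 *: e1 + z 0 1 *: e2).
have Pdiff (z y : 'rV[R]_2) : P z - P y = (z 0 0 - y 0 0) *: e1 + (z 0 1 - y 0 1) *: e2.
  by rewrite /P; apply/rowP => i; rewrite !mxE; ring.
have unitP (e : 'rV[R]_n) : dotp e e = 1 -> `|e| <= 1.
  by move=> ee; apply: le_trans (norm_le_enorm e) _; rewrite /enorm ee sqrtr1.
have Plip (z y : 'rV[R]_2) : `|P z - P y| <= 2 * `|z - y|.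
  rewrite Pdiff; apply: le_trans (ler_normD _ _) _; rewrite !normrZ.
  have hc i (e : 'rV[R]_n) : dotp e e = 1 -> `|z 0 i - y 0 i| * `|e| <= `|z - y|.
    move=> ee; rewrite -[leRHS]mulr1; apply: ler_pM => //; last exact: unitP.
    by have := coord_le_norm (z - y) i; rewrite !mxE.
  by apply: le_trans (lerD (hc 0 _ e11) (hc 1 _ e22)) _; rewrite mulr_natl mulr2n.
pose U := P @^-1` Om.
have coordP (z : 'rV[R]_2) : z 0 0 = dotp e1 (P z - m) /\ z 0 1 = dotp e2 (P z - m).
  rewrite /P [m + _]addrC addrK !dotp_linE e11 e22 e12 (dotpC e2 e1) e12; split; ring.
have oU : open U.
  rewrite openE => z /(open_ballP oOm) [s s0 hs]; apply/nbhs_ballP; exists (s / 2); first exact: half_pos.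
  by move=> y /ballP_norm yz; apply: hs; have := Plip y z; lra.
have bU : bounded_set U.
  case: bOm => M [_ hM]; pose M' := `|M| + 1.
  have MM : M < M' by have := ler_norm M; rewrite /M'; lra.
  exists (n%:R * (`|e1| + `|e2|) * (M' + `|m|)); split; first exact: num_real.
  move=> N hN z Uz; apply: le_trans (ltW hN).
  have zM : `|P z - m| <= M' + `|m| by apply: le_trans (ler_normB _ _) _; rewrite lerD2r; exact: hM Uz.
  have bnd e : `|dotp e (P z - m)| <= n%:R * `|e| * (M' + `|m|).
    by apply: le_trans (dotp_le_norm _ _) _; rewrite -mulrA ler_wpM2l // ler_wpM2l.
  have M0 : 0 <= M' + `|m| by apply: le_trans zM.
  apply: norm_rV_le; first by rewrite mulr_ge0 // mulr_ge0 // addr_ge0.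
  move=> -[[|[|//]] hj].
    rewrite (_ : Ordinal hj = 0); last exact: val_inj.
    rewrite (coordP z).1; apply: le_trans (bnd _) _.
    by rewrite ler_wpM2r // ler_wpM2l // lerDl.
  rewrite (_ : Ordinal hj = 1); last exact: val_inj.
  rewrite (coordP z).2; apply: le_trans (bnd _) _.
  by rewrite ler_wpM2r // ler_wpM2l // lerDr.
have segU (z : 'rV[R]_2) : z 0 1 = 0 -> `|z 0 0| <= r -> U z.
  move=> z1; rewrite ler_norml => /andP[zl zr].
  rewrite /U /= /P z1 scale0r addr0.
  have -> : m + z 0 0 *: e1 = p + ((r + z 0 0) / (2 * r)) *: (q - p).
    by rewrite /m -addrA -scalerDl e1E scalerA.
  by apply: cOm => //; rewrite divr_ge0 ?ler_pdivrMr ?mulr_gt0 //; lra.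
have [z [h [z0 nUz hz arc]]] := first_arc r0 oU bU segU.
(* Nv and Tv are the unit normal and tangent vectors of the touching circle, of radius c *)
pose c := Num.sqrt (r ^+ 2 + h ^+ 2).
have c2 : c ^+ 2 = r ^+ 2 + h ^+ 2 by rewrite sqr_sqrtr // addr_ge0 // sqr_ge0.
have rc : r <= c.
  by rewrite -(ler_pXn2r (n := 2)) ?nnegrE ?sqrtr_ge0 ?(ltW r0) // c2 lerDl sqr_ge0.
have c0 : 0 < c by lra.
pose Nx := z 0 0 / c; pose Ny := (z 0 1 - h) / c.
have zx : z 0 0 = c * Nx by rewrite /Nx mulrC divfK // gt_eqF.
have zy : z 0 1 = h + c * Ny by rewrite /Ny mulrC divfK ?gt_eqF // subrKC.
have N1 : Nx ^+ 2 + Ny ^+ 2 = 1.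
  have c20 : 0 < c ^+ 2 by rewrite exprn_gt0.
  apply: (mulfI (lt0r_neq0 c20)); move: hz; rewrite zx zy => hz.
  by rewrite mulr1; lra.
(* a parabola of acceleration - beta *: Nv stays inside this circle, as 2 * c * beta > 1, and
   has a curvature below kappa *)
pose beta := (1 / (2 * r) + kappa / 2) / 2.
have [b1 b2] : 1 / (2 * r) < beta /\ 2 * beta < kappa.
  have : 1 / (2 * r) < kappa / 2.
    by rewrite ltr_pdivrMr ?mulr_gt0 //; move: rk; rewrite ltr_pdivrMr //; lra.
  by rewrite /beta; lra.
have b0 : 0 < beta by apply: lt_trans b1; rewrite divr_gt0 // mulr_gt0.
have cb : 1 < 2 * c * beta.
  apply: lt_le_trans (_ : 2 * r * beta <= _); last by rewrite ler_pM2r //; lra.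
  by move: b1; rewrite ltr_pdivrMr ?mulr_gt0 //; lra.
pose Tv : 'rV[R]_n := (- Ny) *: e1 + Nx *: e2.
pose Nv : 'rV[R]_n := Nx *: e1 + Ny *: e2.
have TT : dotp Tv Tv = 1 by rewrite -[RHS]N1 /Tv !dotp_linE e11 e22 e12 (dotpC e2 e1) e12; ring.
have NN : dotp Nv Nv = 1 by rewrite -[RHS]N1 /Nv !dotp_linE e11 e22 e12 (dotpC e2 e1) e12; ring.
have inside (s : R) : `|s| = 1 ->
    right0 (fun t => Om (P z + t *: (s *: Tv) + t ^+ 2 *: (- beta *: Nv))).
  move=> s1; have s2 : s ^+ 2 = 1 by rewrite -[s ^+ 2]real_normK ?num_real // s1 expr1n.
  have K0 : 0 < 1 + beta + beta ^+ 2 by rewrite ltr_wpDr ?sqr_ge0 //; lra.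
  pose mm := Num.min (z 0 1) (2 * c * beta - 1).
  have m0 : 0 < mm by rewrite lt_min z0; lra.
  have [m1 m2] : mm <= z 0 1 /\ mm <= 2 * c * beta - 1.
    by split; rewrite ge_min lexx ?orbT.
  have [d d0 hd] := right0_and (right0_lt ltr01) (right0_lt (divr_gt0 m0 K0)).
  exists d => // t /hd [/andP[t0 t1] /andP[_]]; rewrite ltr_pdivlMr // => tm.
  pose y : 'rV[R]_2 := \row_i (if i == 0 then z 0 0 + t * s * (- Ny) - t ^+ 2 * beta * Nx
     else z 0 1 + t * s * Nx - t ^+ 2 * beta * Ny).
  have yX : y 0 0 = z 0 0 + t * s * (- Ny) - t ^+ 2 * beta * Nx by rewrite mxE.
  have yY : y 0 1 = z 0 1 + t * s * Nx - t ^+ 2 * beta * Ny by rewrite mxE.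
  have -> : P z + t *: (s *: Tv) + t ^+ 2 *: (- beta *: Nv) = P y.
    by rewrite /P yX yY /Tv /Nv; apply/rowP => i; rewrite !mxE; ring.
  have tb : t ^+ 2 * beta <= t * beta by rewrite ler_pM2r // expr2 ler_piMl ?(ltW t0) ?(ltW t1).
  have tb2 : t ^+ 2 * beta ^+ 2 <= t * beta ^+ 2.
    by rewrite ler_wpM2r ?sqr_ge0 // expr2 ler_piMl ?(ltW t0) ?(ltW t1).
  have tb0 : 0 <= t ^+ 2 * beta by rewrite mulr_ge0 ?sqr_ge0 // ltW.
  have tbb0 : 0 <= t * beta by rewrite mulr_ge0 // ltW.
  have tb20 : 0 <= t * beta ^+ 2 by rewrite mulr_ge0 ?sqr_ge0 // ltW.
  have unit1 (a b : R) : a ^+ 2 + b ^+ 2 = 1 -> `|a| <= 1.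
    move=> ab; rewrite -(ler_pXn2r (n := 2)) ?nnegrE // real_normK ?num_real // expr1n.
    by have := sqr_ge0 b; lra.
  have nx := unit1 _ _ N1; have ny := unit1 _ _ (etrans (addrC _ _) N1).
  apply: arc.
    have h1 : `|t * s * Nx| <= t.
      by rewrite (normrM (t * s)) (normrM t) s1 mulr1 (gtr0_norm t0) ler_piMr // ltW.
    have h2 : `|t ^+ 2 * beta * Ny| <= t * beta.
      by rewrite (normrM (t ^+ 2 * beta)) (ger0_norm tb0); apply: le_trans tb; rewrite ler_piMr.
    move: h1 h2; rewrite yY !ler_norml; lra.
  rewrite -subr_lt0.
  have -> : y 0 0 ^+ 2 + y 0 1 ^+ 2 - r ^+ 2 - 2 * h * y 0 1 =
     ((c - t ^+ 2 * beta) ^+ 2 + t ^+ 2 * s ^+ 2) * (Nx ^+ 2 + Ny ^+ 2) - (r ^+ 2 + h ^+ 2).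
    by rewrite yX yY zx zy; ring.
  rewrite N1 s2 -c2.
  have -> : ((c - t ^+ 2 * beta) ^+ 2 + t ^+ 2 * 1) * 1 - c ^+ 2 = t ^+ 2 * (1 - 2 * c * beta + t ^+ 2 * beta ^+ 2) by ring.
  by rewrite pmulr_rlt0 ?exprn_gt0 //; lra.
have Bz : boundary Om (P z).
  apply: open_closure_boundary => //; apply/closureP => e e0.
  have K0 : 0 < `|Tv| + `|- beta *: Nv| + 1 by rewrite ltr_wpDl // addr_ge0.
  have := right0_and (right0_and (right0_lt ltr01) (right0_lt (divr_gt0 e0 K0))) (inside 1 (normr1 _)).
  move=> /right0_ex [t t0 [[/andP[_ t1] /andP[_]]]]; rewrite ltr_pdivlMr // => te Ot.
  exists (P z + t *: (1 *: Tv) + t ^+ 2 *: (- beta *: Nv)) => //.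
  rewrite -(addrA (P z)) (addrC (P z)) addrK scale1r; apply: le_lt_trans (ler_normD _ _) _.
  rewrite (normrZ t) (normrZ (t ^+ 2)) (gtr0_norm t0) (ger0_norm (sqr_ge0 t)).
  have : t ^+ 2 * `|- beta *: Nv| <= t * `|- beta *: Nv|.
    by rewrite ler_wpM2r // expr2 ler_piMl ?ltW.
  lra.
apply: (no_touch oOm sOm curv k0 Bz (v := Tv) (w := - beta *: Nv)).
  by rewrite enormZ normrN (gtr0_norm b0) /enorm NN sqrtr1 TT !mulr1.
have [d d0 hd] := right0_and (inside 1 (normr1 _)) (inside (-1) (normrN1 _)).
exists d => // t /hd; rewrite scale1r scaleN1r => -[h1 h2]; split; exact: subset_closure.
Qed.
End Diameter.

(** * Interior balls and curves in the boundary *)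

Section BoundaryGeometry.
Context {R : realType} {n : nat}.
Implicit Types (A Om : set 'rV[R]_n) (h u rho : 'rV[R]_n -> R) (x y v w g p : 'rV[R]_n).

Lemma sup_norm_le A h (M : R) x : (sup_norm A h <= M%:E)%E -> A x -> `|h x| <= M.
Proof.
move=> hM Ax; rewrite -lee_fin; apply: le_trans hM; apply: ereal_sup_ubound.
by exists x.
Qed.

Lemma Ck_norm_le k A h (M : R) s x : (Ck_norm k A h <= M%:E)%E -> (size s <= k)%N -> A x ->
  `|dpart s h x| <= M.
Proof.
move=> hM sk; apply: sup_norm_le; apply: le_trans hM; apply: ereal_sup_ubound.
by exists s.
Qed.

Lemma compact_closure Om : bounded_set Om -> compact (closure Om).
Proof.
move=> [M [_ hM]]; apply: bounded_closed_compact; last exact: closed_closure.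
exists (M + 1); split; first exact: num_real.
move=> N MN y /closureP cly; apply/ler_addgt0Pr => e e0; have [z Oz ze] := cly e e0.
have := hM N _ _ Oz; have MN' : M < N by lra.
move=> /(_ MN') /= zN; have := ler_normD (y - z) z; rewrite subrK distrC => h.
by apply: le_trans h _; rewrite addrC lerD // ltW.
Qed.

Lemma boundary_nonempty Om (i : 'I_n) : open Om -> Om !=set0 -> bounded_set Om ->
  exists p, boundary Om p.
Proof.
move=> oOm [x Ox] bOm; have cK := compact_closure bOm.
have [||p] := @EVT_max_rV R n (fun y => y 0 i) _ _ cK.
- by exists x; exact: subset_closure.
- apply/cont_onP => y _ e e0.
  by have [d d0 hd] := has_grad_cont (has_grad_coord setT y i) e0; exists d => // z _; exact: hd.
rewrite inE => clp pmax; exists p; apply: open_closure_boundary => //.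
move=> /(open_ballP oOm) [r r0 hr].
have Oq : Om (p + (r / 2) *: delta_mx 0 i).
  apply: hr; rewrite addrC addKr normrZ gtr0_norm ?half_pos //.
  by have := @norm_delta_le1 R n i; nra.
have := pmax _ (mem_set (subset_closure Oq)); rewrite !mxE !eqxx /=; lra.
Qed.

(** The constant involves the first two derivatives only, so it is controlled by the C^2 bound
    on the domain. *)
Lemma quadratic_bound rho p (K : R) : 0 < K -> Ck_in 2 (ball p K^-1) rho ->
  (Ck_norm 2 (ball p K^-1) rho <= K%:E)%E ->
  forall v, `|v| < K^-1 -> `|rho (p + v) - rho p - dotp (grad rho p) v| <= n%:R ^+ 2 * K * `|v| ^+ 2.
Proof.
move=> K0 rho2 rhoK v vK.
have inb (w : 'rV[R]_n) (t : R) : `|w| <= `|v| -> 0 <= t <= 1 -> ball p K^-1 (p + t *: w).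
  move=> wv /andP[t0 t1]; apply/ballP_norm; rewrite addrC addKr normrZ ger0_norm //.
  apply: le_lt_trans vK; apply: le_trans wv; by rewrite ler_piMl.
have G_lip (w : 'rV[R]_n) : `|w| <= `|v| -> `|grad rho (p + w) - grad rho p| <= n%:R * K * `|v|.
  move=> wv; apply: norm_rV_le => [|i]; first by rewrite mulr_ge0 // mulr_ge0 // ltW.
  rewrite !mxE.
  apply: le_trans (_ : n%:R * K * `|w| <= _); last by rewrite ler_wpM2l // mulr_ge0 // ltW.
  have := @mvt_le _ _ (dpart [:: i] rho) (fun z => \row_q dpart [:: q; i] rho z) p w 0 K.
  rewrite dotp0l subr0; apply => t t01; have bt := inb w t wv t01.
  split; first exact: (@has_grad_dpart _ _ 2 _ rho [:: i] _ rho2 isT bt).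
  rewrite subr0; apply: norm_rV_le => [|q]; first exact: ltW.
  rewrite mxE; exact: (Ck_norm_le (s := [:: q; i]) rhoK isT bt).
have := @mvt_le _ _ rho (grad rho) p v (grad rho p) (n%:R * K * `|v|).
rewrite (_ : n%:R * (n%:R * K * `|v|) * `|v| = n%:R ^+ 2 * K * `|v| ^+ 2); last by ring.
apply => t t01; split.
  by have := has_grad_dpart rho2 (s := [::]) isT (inb v t (lexx _) t01); rewrite /grad.
by apply: G_lip; move: t01 => /andP[t0 t1]; rewrite normrZ ger0_norm // ler_piMl.
Qed.

(** A ball of this radius, centred twice as deep along the normal, stays within the scale
    [K^-1], and there the quadratic error of the defining function is at most half of its linear
    decrease. *)
Definition inner_radius (K : R) : R := Num.min (1 / (9 * n%:R ^+ 2 * K ^+ 2)) (1 / (2 * K)) / 2.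

Lemma inner_radius_gt0 K : (0 < n)%N -> 0 < K -> 0 < inner_radius K.
Proof.
move=> n0 K0; have nn : 0 < n%:R :> R by rewrite ltr0n.
apply: divr_gt0 => //; rewrite lt_min; apply/andP; split; apply: divr_gt0 => //.
  by rewrite !mulr_gt0 // exprn_gt0.
exact: mulr_gt0.
Qed.

Lemma interior_ball Om (K : R) p : (0 < n)%N -> open Om -> 0 < K -> boundary Om p ->
  C2_boundary_le Om K -> exists x1, forall w, enorm w <= inner_radius K -> Om (x1 + w).
Proof.
move=> n0 oOm K0 Bp C2; have [rho [def rhoK Glow]] := C2 p Bp.
have pr := center_near def; have rp := defining_eq0 oOm def pr Bp.
set G := grad rho p; pose nu := (enorm G)^-1 *: G.
have GK : K^-1 <= enorm G by apply: Glow; apply/ballP_norm.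
have Ki : 0 < K^-1 by rewrite invr_gt0.
have G0 : 0 < enorm G by lra.
have nunu : enorm nu = 1 by rewrite enormZ ger0_norm ?invr_ge0 ?ltW // mulVf // gt_eqF.
pose s := 2 * inner_radius K; have s0 : 0 < s by rewrite mulr_gt0 // inner_radius_gt0.
have nn0 : 0 < n%:R :> R by rewrite ltr0n.
have [s1 s2] : s * (9 * n%:R ^+ 2 * K ^+ 2) <= 1 /\ s * (2 * K) <= 1.
  have sE : s = Num.min (1 / (9 * n%:R ^+ 2 * K ^+ 2)) (1 / (2 * K)).
    by rewrite /s /inner_radius mulrC divfK.
  have h1 : s <= 1 / (9 * n%:R ^+ 2 * K ^+ 2) by rewrite sE ge_min lexx.
  have h2 : s <= 1 / (2 * K) by rewrite sE ge_min lexx orbT.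
  by move: h1 h2; rewrite !ler_pdivlMr ?mulr_gt0 ?exprn_gt0.
exists (p - s *: nu) => w ws.
pose v := w - s *: nu.
have vn : `|v| <= 3 / 2 * s.
  apply: le_trans (norm_le_enorm _) _; apply: le_trans (enormB _ _) _.
  by rewrite enormZ nunu gtr0_norm // /s; lra.
have vK : `|v| < K^-1.
  apply: le_lt_trans vn _; rewrite -[ltRHS]mul1r ltr_pdivlMr //; nra.
have -> : p - s *: nu + w = p + v by rewrite /v addrAC addrA.
apply/(defining_mem def); first by rewrite addrC addKr.
have := quadratic_bound K0 (defining_Ck def 2) rhoK vK; rewrite rp subr0.
have Gv : dotp G v <= - (s / 2) * enorm G.
  have Gnu : dotp G nu = enorm G by rewrite /nu dotpZr -sqr_enorm; field; rewrite gt_eqF.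
  rewrite /v dotpBr dotpZr Gnu; have := dotp_le G w.
  have : enorm G * enorm w <= enorm G * (s / 2).
    by rewrite ler_pM2l // /s; lra.
  lra.
have : n%:R ^+ 2 * K * `|v| ^+ 2 <= s / 4 * K^-1.
  apply: le_trans (_ : n%:R ^+ 2 * K * (3 / 2 * s) ^+ 2 <= _).
    by rewrite ler_wpM2l ?mulr_ge0 ?sqr_ge0 ?(ltW K0) // ler_pXn2r ?nnegrE //; apply: le_trans vn.
  rewrite ler_pdivlMr //.
  have -> : n%:R ^+ 2 * K * (3 / 2 * s) ^+ 2 * K = s / 4 * (s * (9 * n%:R ^+ 2 * K ^+ 2)) by field.
  by rewrite ler_piMr // divr_ge0 // ltW.
have : s / 2 * K^-1 <= s / 2 * enorm G by rewrite ler_pM2l // half_pos.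
have : 0 < s / 4 * K^-1 by rewrite mulr_gt0 //; lra.
rewrite ler_norml -/G; lra.
Qed.

(** The ball lies behind the supporting hyperplane at [p]. *)
Lemma starshaped Om p (r r1 : R) rho x1 : open Om -> is_convex Om ->
  local_defining Om p r rho -> boundary Om p ->
  0 <= r1 -> (forall w, enorm w <= r1 -> Om (x1 + w)) -> r1 <= dotp (p - x1) (unit_grad rho p).
Proof.
move=> oOm cOm def Bp r10 ballx1; set nu := unit_grad rho p.
have G0 : 0 < enorm (grad rho p).
  by rewrite enorm_gt0; apply: (defining_neq0 def); exact: center_near def.
have nunu : enorm nu = 1 by rewrite enormZ ger0_norm ?invr_ge0 ?ltW // mulVf // gt_eqF.
have := supporting_hyperplane oOm cOm def Bp (y := x1 + r1 *: nu).
have cl : closure Om (x1 + r1 *: nu).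
  by apply: subset_closure; apply: ballx1; rewrite enormZ nunu mulr1 ger0_norm.
move=> /(_ cl) h.
have : dotp nu (x1 + r1 *: nu - p) <= 0.
  by rewrite /nu /unit_grad dotpZl pmulr_rle0 // invr_gt0.
rewrite (_ : x1 + r1 *: nu - p = r1 *: nu - (p - x1)); last first.
  by apply/rowP => i; rewrite !mxE; ring.
by rewrite dotpBr dotpZr -sqr_enorm nunu (dotpC nu) expr1n; lra.
Qed.

(** The tangent line is corrected along the normal by an amount of order [t ^+ 2], which the
    intermediate value theorem provides because the quadratic bound on [rho] fixes the signs of
    [rho] at the two ends. *)
Lemma boundary_curve Om p (r B : R) rho v : open Om -> local_defining Om p r rho -> boundary Om p ->
  0 <= B ->
  (forall w, `|w| < r -> `|rho (p + w) - rho p - dotp (grad rho p) w| <= B * `|w| ^+ 2) ->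
  dotp (grad rho p) v = 0 ->
  exists c : R -> 'rV[R]_n, rdiff c p v /\ right0 (fun t => boundary Om (c t) /\ `|c t - p| < r).
Proof.
move=> oOm def Bp B0 hB Gv; set G := grad rho p in hB Gv *; pose nu := (enorm G)^-1 *: G.
have pr := center_near def; have rp := defining_eq0 oOm def pr Bp.
have r0 := defining_radius def.
have G0 : 0 < enorm G by rewrite enorm_gt0; exact: (defining_neq0 def).
have nunu : enorm nu = 1 by rewrite enormZ ger0_norm ?invr_ge0 ?ltW // mulVf // gt_eqF.
have Gnu : dotp G nu = enorm G by rewrite /nu dotpZr -sqr_enorm; field; rewrite gt_eqF.
pose V := `|v| + 1; have V0 : 0 < V by rewrite ltr_wpDl.
pose C := (B + 1) * V ^+ 2 / enorm G + 1.
have C0 : 0 < C by rewrite ltr_wpDl // divr_ge0 ?ltW // mulr_gt0 ?exprn_gt0 //; lra.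
have CG : B * V ^+ 2 < C * enorm G.
  rewrite /C mulrDl divfK ?gt_eqF // mul1r mulrDl mul1r.
  by have : 0 < V ^+ 2; [rewrite exprn_gt0 | lra].
have iC : 0 < 1 / C by rewrite divr_gt0.
have [d d0 hd] := right0_and (right0_lt iC) (right0_lt (divr_gt0 r0 V0)).
have nu1 : `|nu| <= 1 by rewrite -nunu; exact: norm_le_enorm.
clearbody nu.
have main t : exists s : R, 0 < t < d ->
    [/\ `|s| <= C * t ^+ 2, rho (p + (t *: v + s *: nu)) = 0 & `|t *: v + s *: nu| < r].
  case: (boolP (0 < t < d)) => [/hd [/andP[t0 tC] /andP[_ tV]]|]; last by exists 0.
  rewrite ltr_pdivlMr // in tC; rewrite ltr_pdivlMr // in tV.
  have t2 : 0 < t ^+ 2 by rewrite exprn_gt0.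
  pose b := C * t ^+ 2; have b0 : 0 < b by rewrite mulr_gt0.
  have bt : b <= t by rewrite /b expr2 mulrA (mulrC C) ler_piMl ?ltW.
  have small (s : R) : `|s| <= b -> `|t *: v + s *: nu| <= t * V.
    move=> sb; apply: le_trans (ler_normD _ _) _; rewrite !normrZ (gtr0_norm t0).
    have : `|s| * `|nu| <= t * 1 by apply: ler_pM => //; apply: le_trans bt.
    by rewrite /V; lra.
  have smallr s (sb : `|s| <= b) : `|t *: v + s *: nu| < r := le_lt_trans (small s sb) tV.
  pose f s := rho (p + (t *: v + s *: nu)).
  have fE s (sb : `|s| <= b) : `|f s - s * enorm G| <= t ^+ 2 * (B * V ^+ 2).
    have := hB _ (smallr s sb); rewrite rp subr0 dotpDr !dotpZr Gv Gnu mulr0 add0r => h.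
    apply: le_trans h _; rewrite [leRHS]mulrCA -exprMn; apply: ler_wpM2l => //.
    by rewrite ler_pXn2r ?nnegrE ?mulr_ge0 ?(ltW t0) ?(ltW V0) // small.
  have bG : t ^+ 2 * (B * V ^+ 2) < b * enorm G.
    have -> : b * enorm G = t ^+ 2 * (C * enorm G) by rewrite /b; ring.
    by rewrite ltr_pM2l.
  have [s] : exists2 s, s \in `[- b, b]%R & f s = 0.
    apply: IVT; first by lra.
      apply: derivable_within_continuous => s; rewrite in_itv /= => sb.
      have {}sb : `|s| <= b by rewrite ler_norml.
      have fl : f = (fun s => rho ((p + t *: v) + s *: nu)).
        by rewrite funeqE => u; rewrite /f addrA.
      have := @is_derive_line _ _ setT rho (p + t *: v) nu s (grad rho (p + t *: v + s *: nu)).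
      rewrite -fl; case=> //; last by exists 1.
      by apply: (defining_grad def); rewrite -(addrA p) (addrC p) addrK; exact: smallr.
    have fb : 0 < f b.
      have bb : `|b| <= b by rewrite (ger0_norm (ltW b0)).
      have := fE b bb; rewrite ler_norml; lra.
    have fnb : f (- b) < 0.
      have bb : `|- b| <= b by rewrite normrN (ger0_norm (ltW b0)).
      have := fE (- b) bb; rewrite ler_norml; lra.
    by rewrite ge_min le_max (ltW fb) (ltW fnb) orbT.
  rewrite in_itv /= -ler_norml => sb fs; exists s => _; split => //.
  exact: smallr.
have [s hs] := choice main.
exists (fun t => p + (t *: v + s t *: nu)); split.
  move=> e e0; have [d' d'0 hd'] := right0_and (right0_lt d0) (right0_lt (divr_gt0 e0 C0)).
  exists d' => // t /hd' [td /andP[t0 te]]; have [sC _ _] := hs t td.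
  rewrite (addrC p) addrK (addrC (t *: v)) addrK normrZ.
  apply: le_trans (_ : C * t ^+ 2 * 1 <= _); first by apply: ler_pM.
  rewrite ltr_pdivlMr // in te.
  by rewrite mulr1 expr2 mulrA ler_pM2r // mulrC ltW.
exists d => // t td; have [_ rs smalls] := hs t td.
have cr : `|p + (t *: v + s t *: nu) - p| < r by rewrite (addrC p) addrK.
by split=> //; exact: (boundary_of_eq0 oOm def cr rs).
Qed.
End BoundaryGeometry.

(** * Interior maxima *)

Section Interior.
Context {R : realType} {n : nat}.
Implicit Types (A Om : set 'rV[R]_n) (h u f : 'rV[R]_n -> R) (x y v w g p xi : 'rV[R]_n).

Lemma hessian_le0_at_max h (G : 'rV[R]_n -> 'rV[R]_n) (H : 'M[R]_n) x (r : R) : 0 < r ->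
  (forall y, `|y - x| < r -> has_grad setT h y (G y)) ->
  (forall i, has_grad setT (fun y => G y 0 i) x (col i H)^T) ->
  (forall y, `|y - x| < r -> h y <= h x) -> forall v, dotp (v *m H) v <= 0.
Proof.
move=> r0 hG hH hmax v; rewrite leNgt; apply/negP => vHv.
have V0 : 0 < `|v| + 1 by rewrite ltr_wpDl.
have e0 : 0 < dotp (v *m H) v / 4 / (`|v| + 1) ^+ 2 by rewrite !divr_gt0 // exprn_gt0.
have [d d0 hd] := taylor2 r0 hG hH e0.
have := right0_and (right0_lt (divr_gt0 d0 V0)) (right0_lt (divr_gt0 r0 V0)).
move=> /right0_ex [t t0 [/andP[_ td] /andP[_ tr]]].
rewrite ltr_pdivlMr // in td; rewrite ltr_pdivlMr // in tr.
have tv : `|t *: v| <= t * (`|v| + 1) by rewrite normrZ gtr0_norm // ler_pM2l // lerDl.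
have := hd (t *: v) (le_lt_trans tv td).
have := hd (- (t *: v)); rewrite normrN => /(_ (le_lt_trans tv td)).
have := hmax (x + t *: v); have := hmax (x + - (t *: v)).
rewrite !(addrC x) !addrK normrN => /(_ (le_lt_trans tv tr)) h1 /(_ (le_lt_trans tv tr)) h2.
rewrite !(mulNmx, dotpNl, dotpNr, opprK) -!scalemxAl !dotp_linE.
have : dotp (v *m H) v / 4 / (`|v| + 1) ^+ 2 * `|t *: v| ^+ 2 <= dotp (v *m H) v / 4 * t ^+ 2.
  apply: le_trans (_ : dotp (v *m H) v / 4 / (`|v| + 1) ^+ 2 * (t * (`|v| + 1)) ^+ 2 <= _).
    by rewrite ler_pM2l // ler_pXn2r ?nnegrE // mulr_ge0 ?ltW.
  by rewrite exprMn mulrA mulrAC divfK // expf_neq0 // gt_eqF.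
move=> h3; rewrite !ler_norml => /andP[h4 _] /andP[h5 _].
have : 0 < t ^+ 2 * dotp (v *m H) v by rewrite mulr_gt0 // exprn_gt0.
lra.
Qed.

Lemma quadratic_form_perturbation (H0 B Er : 'M[R]_n) (c t : R) v : 0 < c -> 0 < t ->
  (forall v, dotp (v *m B) v <= - (2 * c) * dotp v v) ->
  `|Er| <= c / (n%:R ^+ 2 + 1) * t ->
  dotp (v *m (H0 + t *: B + Er)) v <= dotp (v *m H0) v - c * t * dotp v v.
Proof.
move=> c0 t0 neg hE; have N0 : 0 < n%:R ^+ 2 + 1 :> R by rewrite ltr_wpDl // sqr_ge0.
rewrite !mulmxDr -scalemxAr !dotpDl dotpZl.
have hEr : dotp (v *m Er) v <= c * t * dotp v v.
  apply: le_trans (ler_norm _) _; apply: le_trans (dotp_le_norm _ _) _.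
  have h1 : `|v *m Er| <= n%:R * (`|v| * `|Er|).
    apply: norm_rV_le => [|j]; first by rewrite !mulr_ge0.
    rewrite mxE; apply: le_trans (ler_norm_sum _ _ _) _.
    apply: le_trans (_ : \sum_(k < n) (`|v| * `|Er|) <= _).
      apply: ler_sum => k _; rewrite normrM; apply: ler_pM => //; first exact: coord_le_norm.
      by rewrite [leRHS]/Num.norm /= mx_normrE; apply: (le_bigmax _ (fun ij => `|Er ij.1 ij.2|) (k, j)).
    by rewrite sumr_const card_ord mulr_natl.
  apply: le_trans (_ : n%:R * (n%:R * (`|v| * (c / (n%:R ^+ 2 + 1) * t)) * `|v|) <= _).
    rewrite ler_wpM2l // ler_wpM2r //; apply: le_trans h1 _.
    by rewrite ler_wpM2l // ler_wpM2l.
  have -> : n%:R * (n%:R * (`|v| * (c / (n%:R ^+ 2 + 1) * t)) * `|v|) =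
      c * t * ((n%:R ^+ 2 / (n%:R ^+ 2 + 1)) * `|v| ^+ 2) by field; rewrite gt_eqF.
  rewrite ler_pM2l ?mulr_gt0 //; apply: le_trans (_ : `|v| ^+ 2 <= _).
    by rewrite ler_piMl ?sqr_ge0 // ler_pdivrMr // mul1r lerDl.
  by rewrite -sqr_enorm ler_pXn2r ?nnegrE ?enorm_ge0 // norm_le_enorm.
have hB : t * dotp (v *m B) v <= t * (- (2 * c) * dotp v v) by rewrite ler_pM2l.
lra.
Qed.

Section Phase.
Variables (Theta : R) (hn : (2 <= n)%N).

(** If the derivative of the Hessian were so negative, the eigenvalues of the Hessian at [x + t
    *: xi] would be dominated by those at [x] lowered by [c * t].  Hence [Theta] is at most the
    sum of [atan ((l0 i - c * t) / f)] at this point, whose derivative in [t] at 0 is negative: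
    the variation of [f] contributes a multiple of [\sum_i X i / (1 + X i ^+ 2)], where [X i =
    l0 i / f x], and this is absorbed.  In this way the equation is differentiated without
    differentiating eigenvalues. *)
Lemma phase_third_derivative (C L c : R) Om u f x xi gf :
  (forall l : 'I_n -> R, \sum_i atan (l i) = Theta ->
    `|\sum_i l i / (1 + l i ^+ 2)| <= C * \sum_i (1 + l i ^+ 2)^-1) ->
  Ck_in 3 Om u -> Om x -> dotp xi xi = 1 ->
  (forall y, Om y -> 0 < f y) -> has_grad setT f x gf -> `|dotp gf xi| <= L ->
  (forall y, Om y -> exists l : 'I_n -> R,
      eigenvalues (hessian u y) l /\ \sum_(i < n) atan (l i / f y) = Theta) ->
  0 <= C -> 0 < c -> L * C < c ->
  ~ forall v, dotp (v *m \matrix_(i, j) \sum_k xi 0 k * dpart [:: i; j; k] u x) v <= - (2 * c) * dotp v v.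
Proof.
move=> hC uC Ox xi1 fpos fg gL eqn C0 c0 LC neg.
have [oOm _ _] := uC.
have [l0 [e0 s0]] := eqn x Ox.
pose H0 := hessian u x; pose B : 'M[R]_n := \matrix_(i, j) \sum_k xi 0 k * dpart [:: i; j; k] u x.
have [r r0 hr] := open_ballP oOm Ox.
have xi0 : 0 < `|xi| + 1 by rewrite ltr_wpDl.
have inOm : right0 (fun t => Om (x + t *: xi)).
  have [d d0 hd] := right0_lt (divr_gt0 r0 xi0); exists d => // t /hd /andP[t0]; rewrite ltr_pdivlMr // => tr.
  apply: hr; rewrite addrC addKr normrZ gtr0_norm //; apply: le_lt_trans tr.
  by rewrite ler_pM2l // lerDl.
have N0 : 0 < n%:R ^+ 2 + 1 :> R by rewrite ltr_wpDl // sqr_ge0.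
have ce : 0 < c / (n%:R ^+ 2 + 1) by rewrite divr_gt0.
have expand : right0 (fun t => `|hessian u (x + t *: xi) - H0 - t *: B| <= c / (n%:R ^+ 2 + 1) * t).
  have [d d0 hd] : exists2 d : R, 0 < d & forall (ij : 'I_n * 'I_n) t, t < d -> 0 < t ->
      `|dpart [:: ij.1; ij.2] u (x + t *: xi) - dpart [:: ij.1; ij.2] u x - t * B ij.1 ij.2| <= c / (n%:R ^+ 2 + 1) * t.
    apply: common_radius => ij; have hg := @has_grad_dpart _ _ 3 Om u [:: ij.1; ij.2] x uC isT Ox.
    have tT : right0 (fun t => [set: 'rV[R]_n] (x + t *: xi)) by exists 1.
    have [d d0 hd] := rdiff_comp hg (rdiff_line x xi) tT ce.
    exists d => // t td t0; have := hd t; rewrite t0 td => /(_ isT); rewrite (_ : dotp _ xi = B ij.1 ij.2) //.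
    rewrite [RHS]mxE; apply: eq_bigr => k _.
    by rewrite [X in X * _]mxE (dpart_rot3 ij.1 ij.2 k uC isT Ox) mulrC.
  exists d => // t /andP[t0 td].
  rewrite [leLHS]/Num.norm /= mx_normrE; apply: bigmax_le; first by rewrite mulr_ge0 // ltW.
  move=> ij _; rewrite !mxE; have := hd ij t td t0.
  by rewrite !mxE.
have loewner : right0 (fun t => forall v,
    dotp (v *m hessian u (x + t *: xi)) v <= dotp (v *m H0) v - c * t * dotp v v).
  have [d d0 hd] := expand; exists d => // t td v; have := hd t td.
  move: td => /andP[t0 _] hE; set Er := _ - _ - _ in hE.
  have -> : hessian u (x + t *: xi) = H0 + t *: B + Er.
    have sub3 (a b e : 'M[R]_n) : a = b + e + (a - b - e) by rewrite -[a - b - e]addrA -opprD subrKC.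
    exact: sub3.
  exact: quadratic_form_perturbation.
(* S is the phase with the eigenvalues of H0, lowered at speed c along xi, in place of the true
   ones; by monotonicity it is an upper bound along xi *)
pose S y := \sum_i atan ((l0 i - c * dotp xi (y - x)) * (f y)^-1).
have Sge : right0 (fun t => Theta <= (S \o (fun t => x + t *: xi)) t).
  have [d d0 hd] := right0_and loewner inOm; exists d => // t /hd [hL Ot].
  have [l1 [e1 s1]] := eqn _ Ot; have ft := fpos _ Ot.
  rewrite /= /S addrC addKr -s1.
  have := @loewner_sum _ _ H0 (hessian u (x + t *: xi)) l0 l1 (c * t) (fun q => atan (q / f (x + t *: xi))).
  rewrite dotpZr xi1 mulr1; apply => //.
  - by move=> a b ab; apply: le_atan; rewrite ler_pM2r // invr_gt0.
  - exact: hessian_sym uC isT Ox.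
  - exact: hessian_sym uC isT Ot.
have f0 := fpos x Ox.
pose X i := l0 i / f x.
have Sgrad : has_grad setT S x (\sum_i (1 + X i ^+ 2)^-1 *: ((l0 i * - f x ^- 2) *: gf + (- c * (f x)^-1) *: xi)).
  apply: has_grad_sum => i.
  have h1 : has_grad setT (fun y => l0 i - c * dotp xi (y - x)) x (- c *: xi).
    rewrite (_ : (fun y => _) = fun y => l0 i + (- c) * dotp xi (y - x)); last by rewrite funeqE => y; rewrite mulNr.
    by rewrite -[X in has_grad _ _ _ X]add0r; apply: has_gradD (has_grad_cst _ _ _) (has_gradZ _ (has_grad_affine _ _ _ _)).
  have fx0 : f x != 0 by rewrite gt_eqF.
  have := has_gradM h1 (has_gradV fx0 fg); rewrite subrr dotp0r mulr0 subr0.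
  move=> h2; have h3 : is_derive ((l0 i - c * dotp xi (x - x)) * (f x)^-1) 1 atan (1 + X i ^+ 2)^-1.
    by rewrite subrr dotp0r mulr0 subr0; exact: is_derive1_atan.
  have := has_grad_comp h3 h2; rewrite (_ : _ *: gf = l0 i *: (- f x ^- 2 *: gf)) ?scalerA //.
  by rewrite (mulrC (- c)) -scalerA.
have Sx : S x = Theta.
  by rewrite -s0 /S; apply: eq_bigr => i _; rewrite subrr dotp0r mulr0 subr0.
have tT : right0 (fun t => [set: 'rV[R]_n] (x + t *: xi)) by exists 1.
have := rdiff_comp Sgrad (rdiff_line x xi) tT; rewrite Sx => dS.
have := rdiff_le (rdiff_cst Theta) dS Sge.
have -> : dotp (\sum_i (1 + X i ^+ 2)^-1 *: ((l0 i * - f x ^- 2) *: gf + (- c * (f x)^-1) *: xi)) xi =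
    - (f x)^-1 * (dotp gf xi * \sum_i X i / (1 + X i ^+ 2) + c * \sum_i (1 + X i ^+ 2)^-1).
  rewrite dotpC !mulr_sumr -big_split /= mulr_sumr.
  rewrite dotp_sumr; apply: eq_bigr => i _; rewrite dotpZr dotpDr !dotpZr xi1 (dotpC xi gf) /X.
  have X0 : 1 + (l0 i / f x) ^+ 2 != 0 by rewrite gt_eqF // ltr_wpDr ?sqr_ge0.
  move: X0; set a := 1 + _ => X0; field; rewrite X0 /=; exact: lt0r_neq0.
rewrite mulNr oppr_ge0 pmulr_rle0 ?invr_gt0 // leNgt => /negP; apply.
have T0 : 0 < \sum_i (1 + X i ^+ 2)^-1.
  rewrite (bigD1 (Ordinal (leq_trans (isT : (0 < 2)%N) hn))) //= ltr_wpDr //.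
    by apply: sumr_ge0 => i _; rewrite invr_ge0 addr_ge0 // sqr_ge0.
  by rewrite invr_gt0 ltr_wpDr // sqr_ge0.
have := hC X s0; set T := \sum_i (1 + _)^-1; set SS := \sum_i _ / _ => hS.
have : - (L * (C * T)) <= dotp gf xi * SS.
  rewrite lerNl; apply: le_trans (ler_norm _) _; rewrite normrN normrM.
  by apply: ler_pM.
have : L * C * T < c * T by rewrite ltr_pM2r.
lra.
Qed.
End Phase.
End Interior.

(** * Boundary maxima *)

Section ClosureFacts.
Context {R : realType} {n : nat}.
Implicit Types (A Om : set 'rV[R]_n) (h u f : 'rV[R]_n -> R) (x y v w g p xi : 'rV[R]_n).

Lemma cont_onD A h k : cont_on A h -> cont_on A k -> cont_on A (fun x => h x + k x).
Proof.
move=> hh hk x Ax e e0; have [d d0 hd] := hh x Ax _ (half_pos e0).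
have [d' d'0 hd'] := hk x Ax _ (half_pos e0).
exists (Num.min d d'); first by rewrite lt_min d0.
move=> y Ay; rewrite lt_min => /andP[yd yd']; rewrite opprD addrACA.
by apply: le_trans (ler_normD _ _) _; have := hd y Ay yd; have := hd' y Ay yd'; lra.
Qed.

Lemma cont_onZ A h (c : R) : cont_on A h -> cont_on A (fun x => c * h x).
Proof.
move=> hh x Ax e e0; have c0 : 0 < `|c| + 1 by rewrite ltr_wpDl.
have [d d0 hd] := hh x Ax _ (divr_gt0 e0 c0); exists d => // y Ay yd.
rewrite -mulrBr normrM; apply: le_trans (_ : (`|c| + 1) * (e / (`|c| + 1)) <= _).
  by apply: ler_pM => //; [rewrite lerDl | exact: hd].
by rewrite mulrC divfK // gt_eqF.
Qed.

Lemma cont_on_sum A (I : finType) (h : I -> 'rV[R]_n -> R) :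
  (forall i, cont_on A (h i)) -> cont_on A (fun x => \sum_i h i x).
Proof.
move=> hh; elim: (index_enum I) => [|i s IH].
  rewrite (_ : (fun _ => _) = fun=> 0); last by rewrite funeqE => y; rewrite big_nil.
  by move=> x Ax e e0; exists 1 => // y _ _; rewrite subrr normr0 ltW.
rewrite (_ : (fun _ => _) = fun y => h i y + \sum_(j <- s) h j y); first exact: cont_onD.
by rewrite funeqE => y; rewrite big_cons.
Qed.

Lemma cont_on_bilinear A (M : 'rV[R]_n -> 'M[R]_n) v w : (forall i j, cont_on A (fun x => M x i j)) ->
  cont_on A (fun x => dotp (v *m M x) w).
Proof.
move=> hM; rewrite (_ : (fun x => _) = fun x => \sum_j \sum_i (v 0 i * w 0 j) * M x i j).
  by apply: cont_on_sum => j; apply: cont_on_sum => i; exact: cont_onZ.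
rewrite funeqE => x; apply: eq_bigr => j _; rewrite mxE mulr_suml; apply: eq_bigr => i _; ring.
Qed.

Lemma closure_ge0 Om h : cont_on (closure Om) h -> (forall x, Om x -> 0 <= h x) ->
  forall x, closure Om x -> 0 <= h x.
Proof.
move=> hc hpos x clx; rewrite leNgt; apply/negP => hx.
have hx0 : 0 < - h x / 2 by lra.
have [d d0 hd] := hc x clx _ hx0; have /closureP /(_ d d0) [y Oy yd] := clx.
have := hd y (subset_closure Oy) yd; have := hpos y Oy; rewrite ler_norml; lra.
Qed.

Lemma closure_max Om h : Om !=set0 -> bounded_set Om -> cont_on (closure Om) h ->
  exists2 x, closure Om x & forall y, closure Om y -> h y <= h x.
Proof.
move=> [z Oz] bOm hc; have [||x] := @EVT_max_rV R n h _ _ (compact_closure bOm).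
- by exists z; exact: subset_closure.
- exact/cont_onP.
by rewrite inE => clx hmax; exists x => // y cly; apply: hmax; rewrite inE.
Qed.

Lemma closure_diameter Om (D : R) : (forall x y, Om x -> Om y -> enorm (y - x) <= D) ->
  forall x y, closure Om x -> closure Om y -> enorm (y - x) <= D.
Proof.
move=> hD x y clx cly; apply/ler_addgt0Pr => e e0.
have N0 : 0 < 2 * n%:R + 1 :> R by rewrite ltr_wpDl // mulr_ge0.
have e'0 : 0 < e / (2 * n%:R + 1) by rewrite divr_gt0.
have /closureP /(_ _ e'0) [x' Ox' xe] := clx; have /closureP /(_ _ e'0) [y' Oy' ye] := cly.
rewrite (_ : y - x = (y' - x') + ((x' - x) - (y' - y))); last first.
  by apply/rowP => i; rewrite !mxE; ring.
apply: le_trans (enormD _ _) _; apply: lerD; first exact: hD.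
apply: le_trans (enormB _ _) _.
have := enorm_le_norm (x' - x); have := enorm_le_norm (y' - y) => h1 h2.
have h3 : n%:R * `|x' - x| <= n%:R * (e / (2 * n%:R + 1)) by rewrite ler_wpM2l // ltW.
have h4 : n%:R * `|y' - y| <= n%:R * (e / (2 * n%:R + 1)) by rewrite ler_wpM2l // ltW.
have : (2 * n%:R + 1) * (e / (2 * n%:R + 1)) = e by rewrite mulrC divfK // gt_eqF.
move: (e / (2 * n%:R + 1)) e'0 h3 h4 => e' e'0 h3 h4; lra.
Qed.

Section FirstOrder.
Variables (Om : set 'rV[R]_n) (x : 'rV[R]_n) (r : R) (rho : 'rV[R]_n -> R).
Hypotheses (oOm : open Om) (def : local_defining Om x r rho) (Bx : boundary Om x).

(** The inward normal segment stays in the domain. *)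
Lemma boundary_max_normal h m : has_grad (closure Om) h x m ->
  (forall y, closure Om y -> h y <= h x) -> 0 <= dotp m (unit_grad rho x).
Proof.
move=> hm hmax; have xr := center_near def.
have G0 := defining_neq0 def xr.
have inw : right0 (fun t => closure Om (x + t *: (- grad rho x))).
  have Gneg : dotp (grad rho x) (- grad rho x) < 0 by rewrite dotpNr oppr_lt0 dotp_gt0.
  have [d d0 hd] := inward_mem def xr (defining_eq0 oOm def xr Bx) Gneg.
  by exists d => // t /hd; exact: subset_closure.
have hle : right0 (fun t => (h \o (fun t => x + t *: (- grad rho x))) t <= h x).
  by have [d d0 hd] := inw; exists d => // t /hd; exact: hmax.
have := rdiff_le (rdiff_comp hm (rdiff_line x _) inw) (rdiff_cst (h x)) hle.
by rewrite dotpNr oppr_le0 /unit_grad dotpZr => h0; rewrite mulr_ge0 // invr_ge0 enorm_ge0.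
Qed.

Variable B : R.
Hypotheses (B0 : 0 <= B)
  (hB : forall w, `|w| < r -> `|rho (x + w) - rho x - dotp (grad rho x) w| <= B * `|w| ^+ 2).

(** A tangent direction is the velocity of a curve in the boundary, on which the maximum is also
    attained. *)
Lemma boundary_max_tangent h m v : has_grad (closure Om) h x m ->
  (forall y, closure Om y -> h y <= h x) -> dotp (grad rho x) v = 0 -> dotp m v <= 0.
Proof.
move=> hm hmax Gv; have [c [hc [d d0 hd]]] := boundary_curve oOm def Bx B0 hB Gv.
have incl : right0 (fun t => closure Om (c t)) by exists d => // t /hd [[]].
have hle : right0 (fun t => (h \o c) t <= h x).
  by exists d => // t td; apply: hmax; case: (hd t td) => -[].
exact: (rdiff_le (rdiff_comp hm hc incl) (rdiff_cst (h x)) hle).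
Qed.

(** Both sides of the boundary condition are differentiated along a boundary curve with velocity
    [v]; the second term on the left comes from the turning of the normal. *)
Lemma boundary_condition_derivative (U : 'rV[R]_n -> 'rV[R]_n) (H : 'M[R]_n) b gb v :
  (forall j, has_grad (closure Om) (fun y => U y 0 j) x (col j H)^T) ->
  has_grad (closure Om) b x gb ->
  (forall y, boundary Om y -> `|y - x| < r -> dotp (U y) (unit_grad rho y) = b y) ->
  dotp (grad rho x) v = 0 ->
  dotp (v *m H) (unit_grad rho x) + dotp (U x) (weingarten (grad rho x) (hessian rho x) v) = dotp gb v.
Proof.
move=> hU hb hbc Gv; have xr := center_near def.
have [c [hc [d d0 hd]]] := boundary_curve oOm def Bx B0 hB Gv.
have incl : right0 (fun t => closure Om (c t)) by exists d => // t /hd [[]].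
have /choice [gn hgn] : forall i, exists g, has_grad setT (fun y => unit_grad rho y 0 i) x g /\
    forall v, dotp g v = weingarten (grad rho x) (hessian rho x) v 0 i.
  move=> i; have [g h1 h2] := has_grad_unit (defining_hessian_sym def xr) (defining_neq0 def xr)
    (fun i => defining_hessian def i xr) i.
  by exists g.
have hUn : has_grad (closure Om) (fun y => dotp (U y) (unit_grad rho y)) x
    (\sum_i (U x 0 i *: gn i + unit_grad rho x 0 i *: (col i H)^T)).
  apply: has_grad_sum => i; apply: has_gradM (hU i) _.
  by apply: (has_grad_subset _ (hgn i).1).
have d1 := rdiff_comp hUn hc incl; have d2 := rdiff_comp hb hc incl.
rewrite /= (hbc x Bx xr) in d1.
have eq12 : right0 (fun t => dotp (U (c t)) (unit_grad rho (c t)) = b (c t)).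
  by exists d => // t /hd [Bc cr]; exact: hbc.
have le1 := rdiff_le d1 d2; have le2 := rdiff_le d2 d1.
have E : dotp (\sum_i (U x 0 i *: gn i + unit_grad rho x 0 i *: (col i H)^T)) v = dotp gb v.
  apply/eqP; rewrite eq_le; apply/andP; split.
    by apply: le1; have [d' d'0 hd'] := eq12; exists d' => // t /hd' /= ->.
  by apply: le2; have [d' d'0 hd'] := eq12; exists d' => // t /hd' /= ->.
rewrite -E big_split /= dotpDl addrC.
rewrite !(dotpC _ v) !dotp_sumr; congr (_ + _); apply: eq_bigr => i _; rewrite dotpC dotpZl.
  by rewrite (hgn i).2.
rewrite mulrC; congr (_ * _); rewrite mxE; apply: eq_bigr => j _.
by rewrite !mxE mulrC.
Qed.
End FirstOrder.
End ClosureFacts.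

(** * The auxiliary function of the gradient estimate *)

Section GradientOnClosure.
Context {R : realType} {n : nat}.
Implicit Types (A Om : set 'rV[R]_n) (h u f b phi : 'rV[R]_n -> R) (x y v w g p xi : 'rV[R]_n)
  (U V : 'rV[R]_n -> 'rV[R]_n) (H : 'rV[R]_n -> 'M[R]_n).

Lemma enorm_dist v w : `|enorm v - enorm w| <= enorm (v - w).
Proof.
have h1 := enormD (v - w) w; have h2 := enormD (w - v) v.
rewrite !subrK in h1 h2; rewrite -(enormN (w - v)) opprB in h2.
by rewrite ler_norml; apply/andP; split; lra.
Qed.

Lemma cont_on_enorm A V : (forall i, cont_on A (fun x => V x 0 i)) ->
  cont_on A (fun x => enorm (V x)).
Proof.
move=> hV x Ax e e0; have N0 : 0 < n%:R + 1 :> R by rewrite ltr_wpDl.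
have [d d0 hd] := vector_modulus hV Ax (divr_gt0 e0 N0).
exists d => // y Ay yd; apply: le_trans (enorm_dist _ _) _; apply: le_trans (enorm_le_norm _) _.
apply: le_trans (_ : (n%:R + 1) * (e / (n%:R + 1)) <= _); last by rewrite mulrC divfK // gt_eqF.
by apply: ler_pM => //; [rewrite lerDl | exact: hd].
Qed.

Lemma has_grad_interior Om h x g : open Om -> Om x -> has_grad (closure Om) h x g ->
  has_grad setT h x g.
Proof.
move=> oOm Ox hg e e0; have [d d0 hd] := hg e e0; have [r r0 hr] := open_ballP oOm Ox.
exists (Num.min d r); first by rewrite lt_min d0.
by move=> y _; rewrite lt_min => /andP[yd yr]; apply: hd => //; apply/subset_closure/hr.
Qed.

Lemma has_grad_slope A U (H : 'M[R]_n) x xi :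
  (forall j, has_grad A (fun y => U y 0 j) x (col j H)^T) -> H^T = H ->
  has_grad A (fun y => dotp (U y) xi) x (xi *m H).
Proof.
move=> hU symH; have -> : xi *m H = \sum_j xi 0 j *: (col j H)^T.
  apply/rowP => i; rewrite mxE summxE; apply: eq_bigr => j _.
  by rewrite !mxE -[in RHS]symH !mxE.
rewrite (_ : (fun y => _) = fun y => \sum_j xi 0 j * U y 0 j); last first.
  by rewrite funeqE => y; apply: eq_bigr => j _; rewrite mulrC.
by apply: has_grad_sum => j; apply: has_gradZ.
Qed.

(** The length of the vector field [U y - a *: (y - x1)] is replaced by its component in the
    fixed direction [xi], which touches it from below at a point where [xi] is its direction,
    and which is differentiable. *)
Lemma has_grad_auxiliary A U (H : 'M[R]_n) x x1 xi (a a' : R) :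
  (forall j, has_grad A (fun y => U y 0 j) x (col j H)^T) -> H^T = H ->
  has_grad A (fun y => dotp (U y - a *: (y - x1)) xi + a' * (dotp (y - x1) (y - x1) / 2)) x
    (xi *m H - a *: xi + a' *: (x - x1)).
Proof.
move=> hU symH; apply: has_gradD; last exact/has_gradZ/has_grad_sqdist.
rewrite (_ : (fun y => _) = fun y => dotp (U y) xi + (- a) * dotp xi (y - x1)); last first.
  by rewrite funeqE => y; rewrite dotpBl dotpZl (dotpC (y - x1)) mulNr.
apply: has_gradD; first exact: has_grad_slope.
by rewrite -scaleNr; apply/has_gradZ/has_grad_affine.
Qed.

Lemma interior_max_auxiliary Om u x x1 xi (a a' : R) : Ck_in 3 Om u -> Om x ->
  (forall y, Om y -> dotp (grad u y - a *: (y - x1)) xi + a' * (dotp (y - x1) (y - x1) / 2) <=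
     dotp (grad u x - a *: (x - x1)) xi + a' * (dotp (x - x1) (x - x1) / 2)) ->
  forall v, dotp (v *m \matrix_(i, j) \sum_k xi 0 k * dpart [:: i; j; k] u x) v <= - a' * dotp v v.
Proof.
move=> uC Ox hmax v; have [oOm _ _] := uC; have [r r0 hr] := open_ballP oOm Ox.
have gU y j : Om y -> has_grad setT (fun y => grad u y 0 j) y (col j (hessian u y))^T.
  move=> Oy; rewrite (_ : (fun y => _) = dpart [:: j] u); last by rewrite funeqE => z; rewrite mxE.
  rewrite (_ : (_)^T = \row_i dpart [:: i; j] u y); last by apply/rowP => i; rewrite !mxE.
  exact: (@has_grad_dpart _ _ 3 Om u [:: j] y uC isT Oy).
set M := \matrix_(i, j) _.
have := @hessian_le0_at_max _ _ _
  (fun y => xi *m (hessian u y)^T - a *: xi + a' *: (y - x1)) (M + a'%:M) x r r0 _ _ _ v.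
rewrite mulmxDr mul_mx_scalar dotpDl dotpZl => h; rewrite mulNr -subr_le0 opprK.
apply: h => [y yr|i|y yr]; last exact/hmax/hr.
  have symH : (hessian u y)^T = hessian u y by exact: hessian_sym uC _ (hr y yr).
  by rewrite symH; apply: has_grad_auxiliary => // j; exact/gU/hr.
have -> : (col i (M + a'%:M))^T = \sum_k xi 0 k *: (\row_j dpart [:: j; i; k] u x) + a' *: delta_mx 0 i.
  apply/rowP => j; rewrite !mxE summxE; congr (_ + _).
    by apply: eq_bigr => k _; rewrite !mxE.
  by rewrite mulr_natr.
rewrite (_ : (fun y => _) = fun y => \sum_k xi 0 k * dpart [:: i; k] u y +
   ((a' * dotp (delta_mx 0 i) (y - x1)) + - (a * xi 0 i))); last first.
  rewrite funeqE => y; rewrite !mxE -addrA; congr (_ + _).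
    by apply: eq_bigr => k _; rewrite !mxE.
  rewrite addrC; congr (a' * _ + _).
  by rewrite dotp_deltal !mxE.
apply: has_gradD; first by apply: has_grad_sum => k; apply/has_gradZ/(has_grad_dpart uC).
by rewrite -[X in has_grad _ _ _ X]addr0; apply: has_gradD (has_grad_cst _ _ _); apply/has_gradZ/has_grad_affine.
Qed.
End GradientOnClosure.

Section ClosureData.
Context {R : realType} {n : nat}.
Implicit Types (A Om : set 'rV[R]_n) (h u f b phi : 'rV[R]_n -> R) (x y v w g p xi : 'rV[R]_n)
  (U V : 'rV[R]_n -> 'rV[R]_n) (H : 'rV[R]_n -> 'M[R]_n).

Lemma closure_norm_le Om h (M : R) : cont_on (closure Om) h -> (forall x, Om x -> `|h x| <= M) ->
  forall x, closure Om x -> `|h x| <= M.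
Proof.
move=> hc hM x clx; apply/ler_addgt0Pr => e e0; have [d d0 hd] := hc x clx e e0.
have /closureP /(_ d d0) [y Oy yd] := clx.
rewrite -[h x](subKr (h y)); apply: le_trans (ler_normB _ _) _; apply: lerD; first exact: hM.
by apply: hd => //; exact: subset_closure.
Qed.

Lemma C1_closure_data k Om phi (M : R) : open Om -> is_convex Om -> (0 < k)%N ->
  Ck_closure k Om phi -> (Ck_norm k Om phi <= M%:E)%E ->
  exists gphi : 'rV[R]_n -> 'rV[R]_n, forall x, closure Om x ->
    [/\ has_grad (closure Om) phi x (gphi x), `|phi x| <= M & `|gphi x| <= M].
Proof.
move=> oOm cvx k0 phiC phiM; have [E [E0 Ec EE]] := closure_extension oOm phiC.
have phiI := Ck_closure_in oOm phiC.
have EM s x : (size s <= k)%N -> closure Om x -> `|E s x| <= M.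
  move=> sk; apply: closure_norm_le; first exact: Ec.
  by move=> y Oy; rewrite EE //; exact: Ck_norm_le phiM sk Oy.
exists (fun x => \row_i E [:: i] x) => x clx; split.
- by rewrite -E0; apply: (has_grad_extension oOm cvx phiI Ec EE).
- by rewrite -E0; exact: EM.
- apply: norm_rV_le => [|i]; first by apply: le_trans (EM [::] x _ clx).
  by rewrite mxE; exact: EM.
Qed.

(** [U] and [H] are the continuous extensions of the gradient and of the Hessian; they still
    give first-order expansions of [u] and of [U] at boundary points, relative to the closed
    domain. *)
Lemma C2_closure_data Om u : open Om -> is_convex Om -> Ck_closure 3 Om u ->
  exists U H, [/\ forall x, closure Om x -> has_grad (closure Om) u x (U x),
    forall x j, closure Om x -> has_grad (closure Om) (fun y => U y 0 j) x (col j (H x))^T,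
    forall i j, cont_on (closure Om) (fun x => H x i j),
    forall x, closure Om x -> (H x)^T = H x &
    (forall x, closure Om x -> grad_closure Om u x = U x) /\
    (forall x, Om x -> U x = grad u x /\ H x = hessian u x)].
Proof.
move=> oOm cvx uC; have [E [E0 Ec EE]] := closure_extension oOm uC.
have uI := Ck_closure_in oOm uC.
exists (fun x => \row_i E [:: i] x), (fun x => \matrix_(i, j) E [:: i; j] x).
have HE x : Om x -> \matrix_(i, j) E [:: i; j] x = hessian u x.
  by move=> Ox; apply/matrixP => i j; rewrite !mxE EE.
have HC i j : cont_on (closure Om) (fun x => (\matrix_(i, j) E [:: i; j] x) i j).
  rewrite (_ : (fun x => _) = E [:: i; j]); first exact: Ec.
  by rewrite funeqE => x; rewrite mxE.
split=> //.
- by move=> x clx; rewrite -E0; apply: (has_grad_extension oOm cvx uI Ec EE).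
- move=> x j clx; rewrite (_ : (fun y => _) = E [:: j]); last by rewrite funeqE => y; rewrite mxE.
  rewrite (_ : (_)^T = \row_i E [:: i; j] x); last by apply/rowP => i; rewrite !mxE.
  exact: (has_grad_extension oOm cvx uI Ec EE).
- move=> x clx; apply/matrixP => i j; rewrite !mxE; apply/eqP.
  rewrite -subr_eq0 -normr_le0; move: x clx.
  apply: closure_norm_le => [|x Ox].
    rewrite (_ : (fun x => _) = fun x => E [:: j; i] x + (-1) * E [:: i; j] x).
      by apply: cont_onD; [exact: Ec | apply/cont_onZ/Ec].
    by rewrite funeqE => x; rewrite mulN1r.
  have /matrixP /(_ i j) := hessian_sym uI isT Ox.
  by rewrite -HE // !mxE => ->; rewrite subrr normr0.
- split=> [x clx|x Ox]; first exact: (grad_closureE (k := 3)).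
  by rewrite HE //; split=> //; apply/rowP => i; rewrite !mxE EE.
Qed.

Lemma two_plane_closure Om H : (forall i j, cont_on (closure Om) (fun x => H x i j)) ->
  (forall x e1 e2, Om x -> dotp e1 e1 = 1 -> dotp e2 e2 = 1 -> dotp e1 e2 = 0 ->
    0 <= dotp (e1 *m H x) e1 + dotp (e2 *m H x) e2) ->
  forall x e1 e2, closure Om x -> dotp e1 e1 = 1 -> dotp e2 e2 = 1 -> dotp e1 e2 = 0 ->
    0 <= dotp (e1 *m H x) e1 + dotp (e2 *m H x) e2.
Proof.
move=> Hc h x e1 e2 clx h1 h2 h12; move: x clx; apply: closure_ge0.
  by apply: cont_onD; exact: cont_on_bilinear.
by move=> x Ox; exact: h.
Qed.

End ClosureData.

(** * The bound on eps u from the Neumann condition *)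

Section Estimates.
Context {R : realType} {n : nat}.
Implicit Types (A Om : set 'rV[R]_n) (h u f b phi : 'rV[R]_n -> R) (x y v w g p xi : 'rV[R]_n)
  (U V : 'rV[R]_n -> 'rV[R]_n) (H : 'rV[R]_n -> 'M[R]_n).

(** The paraboloid [B |x - x1|^2 / 2] added to [u] excludes interior maxima, and at a boundary
    maximum the outward derivative is nonnegative, which the Neumann condition turns into a
    bound on [eps * u].  The result is used for [u] and for [- u]. *)
Lemma neumann_upper_bound Om u U H phi x1 (eps B D Mp : R) :
  open Om -> bounded_set Om -> smooth_boundary Om -> Om x1 ->
  (forall x y, closure Om x -> closure Om y -> enorm (y - x) <= D) -> 0 <= B -> 0 < eps <= 1 ->
  (forall x, closure Om x -> has_grad (closure Om) u x (U x)) ->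
  (forall x j, closure Om x -> has_grad (closure Om) (fun y => U y 0 j) x (col j (H x))^T) ->
  (forall x, closure Om x -> phi x <= Mp) ->
  (forall x nu, boundary Om x -> outward_normal Om x nu -> dotp (U x) nu = - eps * u x + phi x) ->
  (forall x, Om x -> ~ forall v, dotp (v *m H x) v <= - B * dotp v v) ->
  forall x, closure Om x -> eps * u x <= Mp + B * D + B * (D ^+ 2 / 2).
Proof.
move=> oOm bOm sb Ox1 hD B0 /andP[eps0 eps1] uU UH phiM bc noint x clx.
have cl1 : closure Om x1 by exact: subset_closure.
have hg y : closure Om y ->
    has_grad (closure Om) (fun y => u y + B * (dotp (y - x1) (y - x1) / 2)) y (U y + B *: (y - x1)).
  by move=> cly; apply: has_gradD (uU y cly) _; apply/has_gradZ/has_grad_sqdist.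
have qD y : closure Om y -> dotp (y - x1) (y - x1) <= D ^+ 2.
  by move=> cly; rewrite -sqr_enorm ler_pXn2r ?nnegrE ?hD ?enorm_ge0 // (le_trans _ (hD _ _ cl1 cly)) ?enorm_ge0.
have Om0 : Om !=set0 by exists x1.
have [x0 cl0 hmax] := closure_max Om0 bOm (has_grad_cont_on hg (@subset_refl _ _)).
have Bx0 : boundary Om x0.
  apply: open_closure_boundary => // Ox0; apply: (noint x0 Ox0) => v.
  have [r r0 hr] := open_ballP oOm Ox0.
  have := @hessian_le0_at_max _ _ _ (fun y => U y + B *: (y - x1)) (H x0 + B%:M) x0 r r0 _ _ _ v.
  rewrite mulmxDr mul_mx_scalar dotpDl dotpZl => h; rewrite mulNr -subr_le0 opprK.
  apply: h => [y yr|i|y yr]; last exact/hmax/subset_closure/hr.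
    by apply: has_grad_interior (hr y yr) (hg y _) => //; exact/subset_closure/hr.
  have -> : (col i (H x0 + B%:M))^T = (col i (H x0))^T + B *: delta_mx 0 i.
    by apply/rowP => j; rewrite !mxE eqxx andTb mulr_natr.
  rewrite (_ : (fun y => _) = fun y => U y 0 i + B * dotp (delta_mx 0 i) (y - x1)); last first.
    rewrite funeqE => y; rewrite !mxE; congr (_ + B * _).
    by rewrite dotp_deltal !mxE.
  apply: has_gradD; last exact/has_gradZ/has_grad_affine.
  by apply: has_grad_interior (UH x0 i cl0).
have [r [rho def]] := sb x0 Bx0; have xr := center_near def.
have := boundary_max_normal oOm def Bx0 (hg x0 cl0) hmax.
rewrite dotpDl (bc x0 _ Bx0 (defining_outward def xr)) dotpZl.
have := dotp_unit_le (dotp_normalize (defining_neq0 def xr)) (hD _ _ cl1 cl0).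
have := phiM x0 cl0; have := hmax x clx; have := qD x0 cl0; have := dotp_ge0 (x - x1).
move: (dotp (x - x1) (x - x1)) (dotp (x0 - x1) (x0 - x1)) (dotp (x0 - x1) (unit_grad rho x0)) => a b c.
move: (u x) (u x0) (phi x0) => ux u0 p0 a0 bD h1 h2 cD h3.
have h4 : B * c <= B * D by rewrite ler_wpM2l.
have h5 : ux <= u0 + B * (D ^+ 2 / 2) by nra.
have h6 : eps * ux <= eps * u0 + eps * (B * (D ^+ 2 / 2)) by rewrite -mulrDr ler_wpM2l // ltW.
have h7 : eps * (B * (D ^+ 2 / 2)) <= B * (D ^+ 2 / 2).
  by rewrite ler_piMl // mulr_ge0 // divr_ge0 // sqr_ge0.
lra.
Qed.
End Estimates.

(** * The gradient at a boundary maximum *)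

Section BoundaryAlgebra.
Context {R : realType} {n : nat}.
Implicit Types (A Om : set 'rV[R]_n) (h u f : 'rV[R]_n -> R) (x y v w g p xi : 'rV[R]_n).

(** In coordinates adapted to the normal [nu] and to the tangential part [v] of the
    gradient: [a] is the normal component, [q] the length of [v], and [b], [N], [T] are the
    values of the Hessian on [(v, nu)], [(nu, nu)], [(v, v)].  For a large [q] the curvature
    makes [b] very negative, so [a * N] is large; as [a] is between [- B1] and 0,
    [N] is negative and at least of the order of [q ^+ 2], and then the two-plane inequality contradicts the
    bound on [T]. *)
Lemma boundary_scalars (A Y B1 C1 kappa q a b N T e : R) :
  0 <= A -> 0 <= Y -> 0 < B1 -> 0 <= C1 -> 1 <= q -> - B1 <= a <= 0 -> e <= 2 * Y * q ->
  b <= C1 * q - kappa * q ^+ 2 -> - e <= b + a * N - A * a ->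
  T + a * b - A * q ^+ 2 <= e * q -> 0 <= T + q ^+ 2 * N ->
  q * kappa <= C1 + 2 * A * B1 + 2 * Y + 2 * B1 * Y + B1 ^+ 2 * C1.
Proof.
move=> A0 Y0 B10 C10 q1 /andP[aB a0] eY hb hN hT hplane.
set W := C1 + _ + _ + _ + _; rewrite leNgt; apply/negP => qW.
have q0 : 0 < q by lra.
pose Z := kappa * q ^+ 2 - C1 * q - A * B1 - 2 * Y * q.
have aN : Z <= a * N.
  have : - (A * B1) <= A * a by rewrite -mulrN ler_wpM2l.
  by rewrite /Z; lra.
have Zbig : B1 * A + 2 * (B1 * Y) + B1 ^+ 2 * C1 < Z.
  have : W * q < kappa * q ^+ 2 by rewrite expr2 mulrA ltr_pM2r // mulrC.
  have mul_ge (c : R) : 0 <= c -> c <= c * q by move=> c0; rewrite ler_peMr.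
  have := mul_ge _ (mulr_ge0 A0 (ltW B10)); have := mul_ge _ (mulr_ge0 (ltW B10) Y0).
  have := mul_ge _ (mulr_ge0 (sqr_ge0 B1) C10).
  rewrite /Z /W; lra.
clearbody Z.
have Z0 : 0 < Z.
  have := mulr_ge0 (ltW B10) A0; have := mulr_ge0 (ltW B10) Y0.
  have := mulr_ge0 (sqr_ge0 B1) C10; lra.
have aneg : a < 0 by rewrite lt_neqAle a0 andbT; apply/eqP => aE; move: aN; rewrite aE mul0r leNgt Z0.
have Nneg : N < 0.
  by rewrite -(nmulr_rgt0 _ aneg); apply: lt_le_trans aN.
have BN : B1 * N <= - Z.
  have : - N * (- a) <= - N * B1 by rewrite ler_pM2l //; lra.
  lra.
have hab : - (a * b) <= B1 * C1 * q ^+ 2.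
  have h1 : b <= C1 * q.
    have : 0 < kappa * q ^+ 2.
      rewrite mulr_gt0 ?exprn_gt0 //; have : 0 <= W.
        have := mulr_ge0 (ltW B10) A0; have := mulr_ge0 (ltW B10) Y0.
        have := mulr_ge0 (sqr_ge0 B1) C10; rewrite /W; lra.
      by move=> /le_lt_trans /(_ qW); rewrite pmulr_rgt0.
    lra.
  have h2 : - a * b <= - a * (C1 * q) by rewrite ler_pM2l //; lra.
  have h3 : - a * (C1 * q) <= B1 * (C1 * q) by rewrite ler_wpM2r ?mulr_ge0 ?(ltW q0) //; lra.
  have h4 : B1 * C1 * q <= B1 * C1 * q ^+ 2.
    by rewrite ler_wpM2l ?mulr_ge0 ?(ltW B10) // expr2 ler_peMr // ltW.
  lra.
have hT' : T <= (A + 2 * Y + B1 * C1) * q ^+ 2.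
  have : e * q <= 2 * Y * q ^+ 2 by rewrite expr2 mulrA ler_pM2r.
  lra.
have : 0 <= q ^+ 2 * (B1 * (A + 2 * Y + B1 * C1) + B1 * N).
  have : B1 * T <= B1 * ((A + 2 * Y + B1 * C1) * q ^+ 2) by rewrite ler_pM2l.
  have : 0 <= B1 * (T + q ^+ 2 * N) by rewrite mulr_ge0 // ltW.
  lra.
rewrite pmulr_rge0 ?exprn_gt0 //; lra.
Qed.

(** The scalar inequalities are applied to the splitting [p = v + a *: nu]; [p] may be assumed
    so long that [v] carries at least half of its length, since the normal component is bounded. *)
Lemma boundary_algebra (D A A' B1 C1 kappa : R) (H : 'M[R]_n) (nu p : 'rV[R]_n) :
  0 <= D -> 0 <= A -> 0 <= A' -> 0 < B1 -> 0 <= C1 -> 0 < kappa ->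
  H^T = H -> dotp nu nu = 1 -> - B1 <= dotp p nu <= 0 ->
  - (A' * enorm p * D) <= dotp (p *m H) nu - A * dotp p nu ->
  (forall v, dotp v nu = 0 -> dotp (p *m H) v - A * dotp p v <= A' * enorm p * D * enorm v) ->
  (let v := p - dotp p nu *: nu in dotp (v *m H) nu <= C1 * enorm v - kappa * enorm v ^+ 2) ->
  (forall e1 e2, dotp e1 e1 = 1 -> dotp e2 e2 = 1 -> dotp e1 e2 = 0 ->
    0 <= dotp (e1 *m H) e1 + dotp (e2 *m H) e2) ->
  enorm p <= 2 * B1 + 2 + 2 * ((C1 + 2 * A * B1 + 2 * A' * D + 2 * B1 * A' * D + B1 ^+ 2 * C1) / kappa).
Proof.
move=> D0 A0 A'0 B10 C10 k0 symH nunu /andP[aB a0] hN hT hb hplane.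
set W := C1 + _ + _ + _ + _; have W0 : 0 <= W by rewrite /W !addr_ge0 // !mulr_ge0 // ?sqr_ge0 ltW.
set a := dotp p nu in aB a0 hN hb; set P := enorm p in hN hT *.
have P0 : 0 <= P by exact: enorm_ge0.
rewrite leNgt; apply/negP => big.
have Wk : 0 <= W / kappa by rewrite divr_ge0 // ltW.
have [v vE] : exists v, v = p - a *: nu by eexists.
rewrite -vE /= in hb; set q := enorm v in hb.
have vnu : dotp v nu = 0 by rewrite vE dotpBl dotpZl nunu mulr1 subrr.
have pE : p = v + a *: nu by rewrite vE subrK.
have q2 : q ^+ 2 = P ^+ 2 - a ^+ 2.
  rewrite /q /P !sqr_enorm vE !dotp_linE (dotpC nu p) -/a nunu; ring.
have qP : P <= 2 * q.
  rewrite -(ler_pXn2r (n := 2)) ?nnegrE ?mulr_ge0 ?enorm_ge0 // exprMn q2.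
  by clear hT hplane; nra.
have q1 : 1 <= q by lra.
have qW : W / kappa < q by lra.
have pHnu : dotp (p *m H) nu = dotp (v *m H) nu + a * dotp (nu *m H) nu.
  by rewrite {1}pE mulmxDl -scalemxAl !dotp_linE.
have pHv : dotp (p *m H) v = dotp (v *m H) v + a * dotp (v *m H) nu.
  by rewrite {1}pE mulmxDl -scalemxAl !dotp_linE (dotp_mulmx_sym nu v symH).
have pv : dotp p v = q ^+ 2 by rewrite {1}pE !dotp_linE (dotpC nu) vnu sqr_enorm; ring.
have := hT v vnu; rewrite pHv pv -/q => {}hT.
rewrite pHnu in hN.
have {}hplane : 0 <= dotp (v *m H) v + q ^+ 2 * dotp (nu *m H) nu.
  have q0 : 0 < q by lra.
  have e11 : dotp (q^-1 *: v) (q^-1 *: v) = 1.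
    by rewrite dotpZl dotpZr -sqr_enorm -/q; field; rewrite gt_eqF.
  have e12 : dotp (q^-1 *: v) nu = 0 by rewrite dotpZl vnu mulr0.
  have := hplane _ _ e11 nunu e12.
  rewrite -scalemxAl dotpZl dotpZr => h'.
  have -> : dotp (v *m H) v + q ^+ 2 * dotp (nu *m H) nu =
     q ^+ 2 * (q^-1 * (q^-1 * dotp (v *m H) v) + dotp (nu *m H) nu) by field; rewrite gt_eqF.
  by rewrite mulr_ge0 // sqr_ge0.
move: hN hT hb hplane; move: (dotp (v *m H) nu) (dotp (nu *m H) nu) (dotp (v *m H) v) => b N T hN hT hb hplane.
have {}qW : W < q * kappa by rewrite -ltr_pdivrMr.
move: qW; rewrite ltNge => /negP; apply.
have -> : W = C1 + 2 * A * B1 + 2 * (A' * D) + 2 * B1 * (A' * D) + B1 ^+ 2 * C1.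
  by rewrite /W; ring.
have Y0 : 0 <= A' * D by exact: mulr_ge0.
apply: (boundary_scalars A0 Y0 B10 C10 q1 _ _ hb hN hT hplane); first by rewrite aB.
have : A' * D * P <= A' * D * (2 * q) by rewrite ler_wpM2l.
lra.
Qed.
End BoundaryAlgebra.

Section BoundaryEstimate.
Context {R : realType} {n : nat}.
Implicit Types (A Om : set 'rV[R]_n) (h u f b phi rho : 'rV[R]_n -> R) (x y v w g p xi G : 'rV[R]_n)
  (U V : 'rV[R]_n -> 'rV[R]_n) (H : 'M[R]_n).

Lemma enorm_projection_le w nu : dotp nu nu = 1 -> enorm (w - dotp w nu *: nu) <= enorm w.
Proof.
move=> nunu; rewrite -(ler_pXn2r (n := 2)) ?nnegrE ?enorm_ge0 // !sqr_enorm.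
rewrite !dotp_linE nunu (dotpC nu w) -subr_ge0 (_ : _ - _ = dotp w nu ^+ 2) ?sqr_ge0 //; ring.
Qed.

Lemma weingarten_orthogonal G H v : G != 0 -> dotp ((enorm G)^-1 *: G) (weingarten G H v) = 0.
Proof.
move=> G0; rewrite /weingarten; set nu := _ *: G.
by rewrite dotpZr dotpBr dotpZr dotp_normalize // mulr1 (dotpC nu) subrr mulr0.
Qed.

Lemma enorm_mulmx_le v H (K : R) : (forall i j, `|H i j| <= K) ->
  enorm (v *m H) <= n%:R ^+ 2 * K * enorm v.
Proof.
move=> HK; case: (boolP [exists i, v 0 i != 0]) => [/existsP[i _]|/existsPn v0]; last first.
  suff -> : v = 0 by rewrite mul0mx /enorm dotp0l sqrtr0 mulr0.
  by apply/rowP => i; rewrite mxE; apply/eqP; have := v0 i; rewrite negbK.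
have K0 : 0 <= K by apply: le_trans (HK i i).
apply: le_trans (enorm_le_norm _) _; rewrite expr2 -!mulrA ler_wpM2l //.
apply: norm_rV_le => [|j]; first by rewrite !mulr_ge0 // enorm_ge0.
rewrite mxE; apply: le_trans (ler_norm_sum _ _ _) _.
apply: le_trans (_ : \sum_(l < n) (K * enorm v) <= _); last by rewrite sumr_const card_ord mulr_natl.
by apply: ler_sum => l _; rewrite normrM mulrC ler_pM // coord_le_enorm.
Qed.

Lemma weingarten_le G H v (K : R) : 0 < K -> K^-1 <= enorm G -> (forall i j, `|H i j| <= K) ->
  enorm (weingarten G H v) <= n%:R ^+ 2 * K ^+ 2 * enorm v.
Proof.
move=> K0 GK HK; have G0 : 0 < enorm G by apply: lt_le_trans GK; rewrite invr_gt0.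
rewrite /weingarten enormZ ger0_norm ?invr_ge0 ?enorm_ge0 //.
rewrite (_ : _ * _ = K * (n%:R ^+ 2 * K * enorm v)); last by ring.
apply: ler_pM; rewrite ?invr_ge0 ?enorm_ge0 //.
  by rewrite -[leRHS]invrK lef_pV2 ?posrE // invr_gt0.
apply: le_trans (enorm_mulmx_le _ HK); apply: enorm_projection_le.
by apply: dotp_normalize; rewrite -enorm_gt0.
Qed.

(** The first-order conditions at the maximum control the Hessian on the pairs formed by [p] and
    a normal or tangent vector.  The tangential derivative of the Neumann condition controls it
    on [(v, nu)], where the curvature contributes [- kappa * enorm v ^+ 2]. *)
Lemma boundary_gradient_bound Om u U H phi gphi x0 x1 (eps A A' B1 C1 D M K kappa : R) :
  (2 <= n)%N -> open Om -> 0 < K -> C2_boundary_le Om K -> curvatures_ge Om kappa -> 0 < kappa ->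
  boundary Om x0 -> enorm (x0 - x1) <= D -> 0 <= A -> 0 <= A' -> 0 < B1 -> 0 < eps <= 1 ->
  has_grad (closure Om) u x0 (U x0) ->
  (forall j, has_grad (closure Om) (fun y => U y 0 j) x0 (col j H)^T) -> H^T = H ->
  (forall e1 e2, dotp e1 e1 = 1 -> dotp e2 e2 = 1 -> dotp e1 e2 = 0 ->
    0 <= dotp (e1 *m H) e1 + dotp (e2 *m H) e2) ->
  has_grad (closure Om) phi x0 gphi -> `|gphi| <= M ->
  (forall x nu, boundary Om x -> outward_normal Om x nu -> dotp (U x) nu = - eps * u x + phi x) ->
  let p := U x0 - A *: (x0 - x1) in
  (forall nu, outward_normal Om x0 nu -> - B1 <= dotp p nu <= 0) ->
  (forall y, closure Om y ->
     dotp (U y - A *: (y - x1)) p + A' * enorm p * (dotp (y - x1) (y - x1) / 2) <=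
     dotp p p + A' * enorm p * (dotp (x0 - x1) (x0 - x1) / 2)) ->
  C1 = A * D + n%:R * M + A * D * (n%:R ^+ 2 * K ^+ 2) ->
  enorm p <= 2 * B1 + 2 + 2 * ((C1 + 2 * A * B1 + 2 * A' * D + 2 * B1 * A' * D + B1 ^+ 2 * C1) / kappa).
Proof.
move=> n2 oOm K0 C2 curv kappa0 Bx0 xD A0 A'0 B10 /andP[eps0 eps1] uU UH symH plane hphi gM bc p pnu hmax C1E.
have [rho [def rhoK GK]] := C2 x0 Bx0; have xr := center_near def.
have G0 := defining_neq0 def xr.
have D0 : 0 <= D by apply: le_trans xD; exact: enorm_ge0.
have M0 : 0 <= M by apply: le_trans gM.
have K1 : 0 <= n%:R ^+ 2 * K ^+ 2 :> R by rewrite mulr_ge0 ?sqr_ge0.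
have P0 := enorm_ge0 p.
have hm := has_grad_auxiliary x1 p A (A' * enorm p) UH symH.
have rhoC : Ck_in 2 (ball x0 K^-1) rho by exact: (defining_Ck def 2).
have hB := quadratic_bound K0 rhoC rhoK.
have n2K : 0 <= n%:R ^+ 2 * K :> R by rewrite mulr_ge0 ?sqr_ge0 // ltW.
have [nu nuE] : exists nu, nu = unit_grad rho x0 by eexists.
have nunu : dotp nu nu = 1 by rewrite nuE; exact: dotp_normalize.
have Gnu v : dotp v nu = 0 -> dotp (grad rho x0) v = 0.
  move=> h; rewrite dotpC; apply/eqP; move/eqP: h; rewrite nuE dotpZr mulf_eq0.
  by rewrite invr_eq0 enorm_eq0 (negbTE G0) orFb.
apply: (boundary_algebra (H := H) (nu := nu)) => //.
- by rewrite C1E; apply: addr_ge0; [apply: addr_ge0|]; apply: mulr_ge0 => //; exact: mulr_ge0.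
- by apply: pnu; rewrite nuE; exact: (defining_outward def xr).
- have := boundary_max_normal oOm def Bx0 hm hmax.
  rewrite -nuE dotpDl dotpBl !dotpZl => h.
  have := ler_wpM2l (mulr_ge0 A'0 P0) (dotp_unit_le nunu xD); lra.
- move=> v vnu; have := boundary_max_tangent oOm def Bx0 n2K hB hm hmax (Gnu v vnu).
  rewrite dotpDl dotpBl !dotpZl => h.
  have := ler_wpM2l (mulr_ge0 A'0 P0) (dotp_ge v xD); lra.
rewrite /=; set v := p - dotp p nu *: nu; have vE : v = p - dotp p nu *: nu by [].
clearbody v; have vnu : dotp v nu = 0 by rewrite vE dotpBl dotpZl nunu mulr1 subrr.
have hb : has_grad (closure Om) (fun y => - eps * u y + phi y) x0 (- eps *: U x0 + gphi).
  by apply: has_gradD hphi; exact: has_gradZ.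
have bc' y : boundary Om y -> `|y - x0| < K^-1 -> dotp (U y) (unit_grad rho y) = - eps * u y + phi y.
  by move=> By yr; apply: bc By (defining_outward def yr).
have := boundary_condition_derivative oOm def Bx0 n2K hB UH hb bc' (Gnu v vnu).
rewrite -nuE; set W := weingarten _ _ v => E.
have WnuE : dotp nu W = 0 by rewrite nuE; exact: weingarten_orthogonal.
have pE : U x0 = v + dotp p nu *: nu + A *: (x0 - x1) by rewrite vE subrK /p subrK.
have vW : kappa * enorm v ^+ 2 <= dotp v W.
  have := curvature_form def Bx0 curv (etrans (dotpC _ _) (Gnu v vnu)).
  rewrite /W /weingarten dotpZr dotpBr dotpZr -/(unit_grad rho x0) -nuE vnu mulr0 subr0 sqr_enorm => h.
  rewrite (dotpC v (v *m _)) ler_pdivlMl ?enorm_gt0 //.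
  by rewrite mulrA (mulrC (enorm _)).
have WB : enorm W <= n%:R ^+ 2 * K ^+ 2 * enorm v.
  apply: weingarten_le => // [|i j]; first by apply: GK; rewrite -ball_normE /= subrr normr0 invr_gt0.
  rewrite mxE; apply: (Ck_norm_le rhoK) => //.
  by rewrite -ball_normE /= subrr normr0 invr_gt0.
have xW : - (D * (n%:R ^+ 2 * K ^+ 2 * enorm v)) <= dotp (x0 - x1) W.
  by apply: le_trans (dotp_ge W xD); rewrite lerN2 ler_wpM2l.
have xv := dotp_ge v xD.
have gv : dotp gphi v <= n%:R * (M * enorm v).
  apply: le_trans (ler_norm _) _; apply: le_trans (dotp_le_norm _ _) _.
  by rewrite ler_wpM2l // ler_pM // norm_le_enorm.
move: E; rewrite dotpDl dotpZl {1 2}pE !dotpDl !dotpZl WnuE (dotpC nu v) vnu => E.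
have := ler_wpM2l A0 xW; have := ler_wpM2l A0 xv => hxv hxW.
have vv := dotp_ge0 v.
have heps : eps * (dotp v v + dotp p nu * 0 + A * dotp (x0 - x1) v) >= - (A * (D * enorm v)).
  have ADv : 0 <= A * (D * enorm v) by rewrite !mulr_ge0 // enorm_ge0.
  rewrite mulr0 addr0; apply: le_trans (_ : eps * - (A * (D * enorm v)) <= _).
    by rewrite mulrN lerN2 ler_piMl.
  by rewrite ler_pM2l //; lra.
rewrite C1E; clear hmax plane; lra.
Qed.

End BoundaryEstimate.

(** * The gradient estimate *)

Section GradientEstimate.
Context {R : realType}.

(** All eigenvalues would be at least [F * X], which makes each arctangent exceed [Theta / n]. *)
Lemma phase_hessian_not_large n (H : 'M[R]_n) (l : 'I_n -> R) (Theta F X f : R) :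
  (0 < n)%N -> eigenvalues H l -> 0 < f <= F -> 0 <= X -> Theta / n%:R < atan X ->
  \sum_i atan (l i / f) = Theta -> ~ forall v, F * X * dotp v v <= dotp (v *m H) v.
Proof.
move=> n0 eigH /andP[f0 fF] X0 TX S hH.
have n0' : 0 < n%:R :> R by rewrite ltr0n.
suff : Theta < Theta by rewrite ltxx.
apply: lt_le_trans (_ : n%:R * atan X <= _).
  by rewrite mulrC -ltr_pdivrMr.
rewrite -S -[n in n%:R]card_ord mulr_natl -sumr_const; apply: ler_sum => i _; apply: le_atan.
rewrite ler_pdivlMr // mulrC; apply: le_trans (eigenvalue_ge eigH hH i).
by rewrite ler_wpM2r.
Qed.

Section Maximum.
Context {n : nat}.
Variables (Om : set 'rV[R]_n) (f phi u : 'rV[R]_n -> R) (gphi U : 'rV[R]_n -> 'rV[R]_n)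
  (H : 'rV[R]_n -> 'M[R]_n) (x1 : 'rV[R]_n)
  (eps A B1 C1 L Cph D M K kappa Theta : R).
Hypotheses (hn : (2 <= n)%N) (oOm : open Om) (bOm : bounded_set Om) (Ox1 : Om x1)
  (hD : forall x y, closure Om x -> closure Om y -> enorm (y - x) <= D)
  (K0 : 0 < K) (C2 : C2_boundary_le Om K) (kappa0 : 0 < kappa) (curv : curvatures_ge Om kappa)
  (uI : Ck_in 3 Om u)
  (uU : forall x, closure Om x -> has_grad (closure Om) u x (U x))
  (UH : forall x j, closure Om x -> has_grad (closure Om) (fun y => U y 0 j) x (col j (H x))^T)
  (symH : forall x, closure Om x -> (H x)^T = H x)
  (Ugrad : forall x, Om x -> U x = grad u x)
  (plane : forall x e1 e2, closure Om x -> dotp e1 e1 = 1 -> dotp e2 e2 = 1 -> dotp e1 e2 = 0 ->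
    0 <= dotp (e1 *m H x) e1 + dotp (e2 *m H x) e2)
  (f0 : forall x, Om x -> 0 < f x)
  (fL : forall x, Om x -> exists2 gf, has_grad setT f x gf & forall xi, dotp xi xi = 1 -> `|dotp gf xi| <= L)
  (phase : forall x, Om x -> exists l : 'I_n -> R,
      eigenvalues (hessian u x) l /\ \sum_(i < n) atan (l i / f x) = Theta)
  (Cph0 : 0 <= Cph) (L0 : 0 <= L)
  (hCph : forall l : 'I_n -> R, \sum_i atan (l i) = Theta ->
    `|\sum_i l i / (1 + l i ^+ 2)| <= Cph * \sum_i (1 + l i ^+ 2)^-1)
  (hphi : forall x, closure Om x -> has_grad (closure Om) phi x (gphi x) /\ `|gphi x| <= M)
  (heps : 0 < eps <= 1)
  (bc : forall x nu, boundary Om x -> outward_normal Om x nu -> dotp (U x) nu = - eps * u x + phi x)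
  (A0 : 0 <= A) (B10 : 0 < B1)
  (slope : forall x nu, boundary Om x -> outward_normal Om x nu ->
     - B1 <= dotp (U x - A *: (x - x1)) nu <= 0)
  (C1E : C1 = A * D + n%:R * M + A * D * (n%:R ^+ 2 * K ^+ 2)).

Let A' := 2 * (L * Cph + 1).
Let M0 := 2 * B1 + 2 + 2 * ((C1 + 2 * A * B1 + 2 * A' * D + 2 * B1 * A' * D + B1 ^+ 2 * C1) / kappa).

(** At an interior maximum of [enorm (V y) + A' * q y], the third derivatives of [u] in the
    direction of [V] would be more negative than the equation allows, by the choice of [A']; at
    a boundary maximum [V] is bounded by [M0]. *)
Lemma gradient_estimate x : closure Om x -> enorm (U x) <= M0 + A' * (D ^+ 2 / 2) + A * D.
Proof.
move=> clx; have cl1 : closure Om x1 by exact: subset_closure.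
have c0 : 0 < L * Cph + 1 by rewrite ltr_wpDl // mulr_ge0.
have A'0 : 0 < A' by rewrite mulr_gt0.
have D0 : 0 <= D by apply: le_trans (hD cl1 cl1); exact: enorm_ge0.
have M_0 : 0 <= M by apply: le_trans (hphi cl1).2.
have C10 : 0 <= C1.
  rewrite C1E; apply: addr_ge0; [apply: addr_ge0|]; apply: mulr_ge0 => //; first exact: mulr_ge0.
  by apply: mulr_ge0; rewrite sqr_ge0.
have M00 : 0 <= M0.
  have W0 : 0 <= C1 + 2 * A * B1 + 2 * A' * D + 2 * B1 * A' * D + B1 ^+ 2 * C1.
    by rewrite !addr_ge0 // !mulr_ge0 // ?sqr_ge0 // ltW.
  have W1 : 0 <= (C1 + 2 * A * B1 + 2 * A' * D + 2 * B1 * A' * D + B1 ^+ 2 * C1) / kappa.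
    by rewrite divr_ge0 // ltW.
  have B1_0 := ltW B10; rewrite /M0; apply: addr_ge0; last exact: mulr_ge0.
  by apply: addr_ge0 => //; exact: mulr_ge0.
pose V y := U y - A *: (y - x1); pose q y := dotp (y - x1) (y - x1) / 2.
have qD y : closure Om y -> q y <= D ^+ 2 / 2.
  move=> cly; rewrite /q ler_pM2r ?invr_gt0 // -sqr_enorm.
  by rewrite ler_pXn2r ?nnegrE ?hD ?enorm_ge0.
have q0 y : 0 <= q y by rewrite divr_ge0 // dotp_ge0.
have Gcont : cont_on (closure Om) (fun y => enorm (V y) + A' * q y).
  apply: cont_onD.
    apply: cont_on_enorm => i; rewrite (_ : (fun y => _) = fun y => U y 0 i + (- A) * dotp (delta_mx 0 i) (y - x1)).
      apply: (@has_grad_cont_on _ _ _ (closure Om) _ (fun y => (col i (H y))^T + (- A) *: delta_mx 0 i)) => // y cly.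
      by apply: has_gradD (UH _ cly) _; apply/has_gradZ/has_grad_affine.
    rewrite funeqE => y; rewrite !mxE mulNr; congr (_ - A * _).
    by rewrite dotp_deltal !mxE.
  apply/cont_onZ; apply: (@has_grad_cont_on _ _ _ (closure Om) _ (fun y => y - x1)) => // y cly.
  exact: has_grad_sqdist.
have Om0 : Om !=set0 by exists x1.
have [x0 cl0 Gmax] := closure_max Om0 bOm Gcont.
have Vx0 : enorm (V x0) <= M0.
  have [p0|p0] := eqVneq (V x0) 0; first by rewrite p0 /enorm dotp0l sqrtr0.
  have P0 : 0 < enorm (V x0) by rewrite enorm_gt0.
  have [Ox0|nOx0] := pselect (Om x0).
    exfalso; have [xi xiE] : exists xi, xi = (enorm (V x0))^-1 *: V x0 by eexists.
    have xi1 : dotp xi xi = 1 by rewrite xiE dotp_normalize.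
    have [gf hgf gfL] := fL Ox0.
    have cL : L * Cph < L * Cph + 1 by rewrite ltrDl.
    have := phase_third_derivative hn hCph uI Ox0 xi1 f0 hgf (gfL _ xi1) phase Cph0 c0 cL; apply.
    apply: (interior_max_auxiliary (x1 := x1) (a := A) uI Ox0) => y Oy.
    have cly : closure Om y by exact: subset_closure.
    rewrite -!Ugrad // -/(V y) -/(V x0) -/(q y) -/(q x0).
    have h1 : dotp (V x0) xi = enorm (V x0).
      rewrite xiE dotpZr -sqr_enorm expr2 mulrA mulVf ?mul1r // enorm_eq0 //.
    rewrite h1; apply: le_trans (Gmax y cly); rewrite lerD2r.
    exact: dotp_unit_le.
  have Bx0 : boundary Om x0 by exact: open_closure_boundary.
  apply: (boundary_gradient_bound hn oOm K0 C2 curv kappa0 Bx0 (hD cl1 cl0) A0 (ltW A'0) B10 heps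
    (uU cl0) (fun j => UH j cl0) (symH cl0) (fun e1 e2 => plane cl0) (hphi cl0).1 (hphi cl0).2 bc _ _ C1E).
    by move=> nu; exact: slope.
  move=> y cly; rewrite -/(V y) -/(V x0) -/(q y) -/(q x0) -sqr_enorm.
  have h1 := dotp_le (V y) (V x0); have := ler_wpM2r (ltW P0) (Gmax y cly); lra.
have -> : U x = V x + A *: (x - x1) by rewrite /V subrK.
apply: le_trans (enormD _ _) _; rewrite enormZ (ger0_norm A0); apply: lerD; last by rewrite ler_wpM2l // hD.
have h1 := Gmax x clx; have h2 := ler_wpM2l (ltW A'0) (qD _ cl0); have h3 := mulr_ge0 (ltW A'0) (q0 x).
rewrite /= in h1; lra.
Qed.
End Maximum.
End GradientEstimate.

Theorem lemma3p3 (R : realType) (n : nat) (hn : (2 <= n)%N)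
    (Theta : R)
    (hTheta : (n%:R - 2) * pi / 2 <= Theta < n%:R * pi / 2)
    (Mphi Mf Minv K kappa : R) (hkappa : 0 < kappa) :
  exists eps0 C : R, [/\ 0 < eps0, 0 < C &
    forall (Om : set 'rV[R]_n) (f phi : 'rV[R]_n -> R),
      domain Om -> bounded_set Om -> smooth_boundary Om ->
      strictly_convex Om -> curvatures_ge Om kappa -> C2_boundary_le Om K ->
      smooth_closure Om f -> (forall x, closure Om x -> 0 < f x) ->
      smooth_closure Om phi ->
      (Ck_norm 3 Om phi <= Mphi%:E)%E ->
      (Ck_norm 1 Om f <= Mf%:E)%E ->
      (sup_norm Om (fun x => (f x)^-1)%R <= Minv%:E)%E ->
      forall (eps : R) (u : 'rV[R]_n -> R),
        0 < eps < eps0 -> Ck_closure 3 Om u ->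
        solves_neumann Om f phi Theta eps u ->
        forall x, closure Om x -> enorm (grad_closure Om u x) <= C].
Proof.
have n0 : (0 < n)%N by exact: ltn_trans hn.
have n0' : 0 < n%:R :> R by rewrite ltr0n.
(* for K <= 0 there is no domain: a bounded one has boundary points, where 0 < K^-1 *)
have [K0|K0] := ltP 0 K; last first.
  exists 1, 1; split=> // Om f phi [oOm _ Om0] bOm _ _ _ C2.
  have [p Bp] := boundary_nonempty (Ordinal n0) oOm Om0 bOm.
  by have [rho [[]]] := C2 p Bp; rewrite invr_gt0 ltNge K0.
have [Cph Cph0 hCph] := phase_sum_bound hn hTheta.
have [X X0 TX] : exists2 X, 0 <= X & Theta / n%:R < atan X.
  apply: atan_above; rewrite ltr_pdivrMr // (_ : pi / 2 * _ = n%:R * pi / 2); last by ring.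
  by case/andP: hTheta.
(* B0 bounds the right-hand side of the Neumann condition, and A, B1 are such that
   u - A |x - x1|^2 / 2 has its outward derivative between - B1 and 0 *)
pose D := 2 / kappa; pose r1 := @inner_radius R n K; pose F := `|Mf| + 1; pose Mp := `|Mphi|.
pose B0 := Mp + (Mp + (F * X + 1) * (D + D ^+ 2 / 2)).
pose A := B0 / r1; pose B1 := B0 + A * D + 1; pose L := n%:R * `|Mf|.
pose C1 := A * D + n%:R * Mp + A * D * (n%:R ^+ 2 * K ^+ 2).
pose A' := 2 * (L * Cph + 1).
pose M0 := 2 * B1 + 2 + 2 * ((C1 + 2 * A * B1 + 2 * A' * D + 2 * B1 * A' * D + B1 ^+ 2 * C1) / kappa).
pose C := M0 + A' * (D ^+ 2 / 2) + A * D.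
have D0 : 0 <= D by rewrite divr_ge0 // ltW.
have r10 : 0 < r1 by exact: inner_radius_gt0.
have F0 : 0 < F by rewrite ltr_wpDl.
have FX0 : 0 <= F * X by rewrite mulr_ge0 // ltW.
have Mp0 : 0 <= Mp by exact: normr_ge0.
have DD0 : 0 <= D + D ^+ 2 / 2 by rewrite addr_ge0 // divr_ge0 // sqr_ge0.
have B00 : 0 <= B0.
  by rewrite addr_ge0 // addr_ge0 // mulr_ge0 // addr_ge0.
have A0 : 0 <= A by rewrite divr_ge0 // ltW.
have AD0 : 0 <= A * D by rewrite mulr_ge0.
have B10 : 0 < B1 by rewrite /B1 ltr_wpDl // addr_ge0.
have L0 : 0 <= L by rewrite mulr_ge0.
have CC0 : 0 < `|C| + 1 by rewrite ltr_wpDl.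
exists 1, (`|C| + 1); split=> //.
move=> Om f phi dom bOm sb sc curv C2 fC f0 phiC phiM fM _ eps u /andP[eps0 eps1] uC [phase bc0] x clx.
have [oOm _ Om0] := dom.
have cvx := convex_domain dom sb curv hkappa.
have [p Bp] := boundary_nonempty (Ordinal n0) oOm Om0 bOm.
have [x1 ballx1] := interior_ball n0 oOm K0 Bp C2.
have Ox1 : Om x1 by rewrite -[x1]addr0; apply: ballx1; rewrite /enorm dotp0l sqrtr0 ltW.
have hD : forall y z, closure Om y -> closure Om z -> enorm (z - y) <= D.
  by apply: closure_diameter => y z; exact: diameter_le.
have uI := Ck_closure_in oOm uC.
have [U [H [uU UH HC symH [Ucl UHin]]]] := C2_closure_data oOm cvx uC.
have [gphi phiP] := C1_closure_data (k := 3) oOm cvx isT (phiC 3) phiM.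
have fI := Ck_closure_in oOm (fC 1).
have fpos y : Om y -> 0 < f y by move=> /subset_closure; exact: f0.
have heps : 0 < eps <= 1 by rewrite eps0 ltW.
have plane0 y e1 e2 : Om y -> dotp e1 e1 = 1 -> dotp e2 e2 = 1 -> dotp e1 e2 = 0 ->
    0 <= dotp (e1 *m H y) e1 + dotp (e2 *m H y) e2.
  move=> Oy; have [l [eigl S]] := phase y Oy; rewrite (UHin y Oy).2.
  have [T1 _] := andP hTheta.
  exact: (two_plane_trace_ge0 (hessian_sym uI isT Oy) eigl (fpos y Oy) T1 S).
have plane := two_plane_closure HC plane0.
have bc y nu : boundary Om y -> outward_normal Om y nu -> dotp (U y) nu = - eps * u y + phi y.
  by move=> By hnu; rewrite -Ucl ?bc0 //; case: By.
have phiB y : closure Om y -> `|phi y| <= Mp.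
  by move=> cly; have [_ h _] := phiP y cly; exact: le_trans (ler_norm _).
(* an orthonormal pair, on which a negative Hessian violates the two-plane inequality *)
have [e1 e11 _] := orthogonal_unit (0 : 'rV[R]_n) hn.
have [e2 e22 e12] := orthogonal_unit e1 hn.
have upper y : closure Om y -> eps * u y <= Mp + 1 * D + 1 * (D ^+ 2 / 2).
  apply: (neumann_upper_bound oOm bOm sb Ox1 hD ler01 heps uU UH _ bc).
    by move=> z /phiB; apply: le_trans; exact: ler_norm.
  move=> z Oz h; have := plane0 z e1 e2 Oz e11 e22 e12; have := h e1; have := h e2.
  rewrite e11 e22; lra.
have lower y : closure Om y -> eps * (- 1 * u y) <= Mp + F * X * D + F * X * (D ^+ 2 / 2).
  apply: (neumann_upper_bound (u := fun z => - 1 * u z) (U := fun z => - 1 *: U z) (H := fun z => - 1 *: H z)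
    (phi := fun z => - 1 * phi z) oOm bOm sb Ox1 hD FX0 heps).
  - by move=> z clz; apply/has_gradZ/uU.
  - move=> z j clz; rewrite (_ : (fun y => _) = fun y => - 1 * U y 0 j); last first.
      by rewrite funeqE => w; rewrite !mxE.
    rewrite (_ : (_)^T = - 1 *: (col j (H z))^T); last by apply/rowP => i; rewrite !mxE.
    exact/has_gradZ/UH.
  - by move=> z /phiB; rewrite mulN1r -normrN; apply: le_trans; exact: ler_norm.
  - by move=> z nu Bz hnu; rewrite dotpZl (bc z nu Bz hnu); ring.
  move=> z Oz h; have [l [eigl S]] := phase z Oz.
  apply: (phase_hessian_not_large n0 eigl _ X0 TX S (F := F)).
    rewrite fpos //=; have := Ck_norm_le fM (s := [::]) isT Oz; rewrite /= ger0_norm ?(ltW (fpos z Oz)) // => h1.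
    by apply: le_trans h1 _; rewrite /F; have := ler_norm Mf; lra.
  move=> v; have := h v; rewrite (UHin z Oz).2 -scalemxAr dotpZl !mulNr mul1r lerN2.
  by [].
have bB y : closure Om y -> `|- eps * u y + phi y| <= B0.
  move=> cly; have := upper y cly; have := lower y cly; have := phiB y cly.
  have -> : Mp + F * X * D + F * X * (D ^+ 2 / 2) = Mp + F * X * (D + D ^+ 2 / 2) by ring.
  have -> : Mp + 1 * D + 1 * (D ^+ 2 / 2) = Mp + (D + D ^+ 2 / 2) by ring.
  have -> : B0 = Mp + (Mp + (F * X * (D + D ^+ 2 / 2) + (D + D ^+ 2 / 2))) by rewrite /B0; ring.
  have : 0 <= F * X * (D + D ^+ 2 / 2) by rewrite mulr_ge0.
  have -> : eps * (- 1 * u y) = - (eps * u y) by ring.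
  have -> : - eps * u y = - (eps * u y) by ring.
  move: (D + D ^+ 2 / 2) DD0 (Mp) (eps * u y) (phi y) (F * X * _).
  clear; move=> d d0 m e q t t0; rewrite !ler_norml => /andP[? ?] ? ?; apply/andP; split; lra.
have slope y nu : boundary Om y -> outward_normal Om y nu ->
    - B1 <= dotp (U y - A *: (y - x1)) nu <= 0.
  move=> By hnu; rewrite dotpBl dotpZl (bc y nu By hnu).
  have cly : closure Om y by case: By.
  have := bB y cly; rewrite ler_norml => /andP[b1 b2].
  have [r [rho [def nuE]]] := hnu.
  have nunu : dotp nu nu = 1.
    by rewrite nuE; apply: dotp_normalize; exact: (defining_neq0 def (center_near def)).
  have h1 := starshaped oOm cvx def By (ltW r10) ballx1; rewrite -nuE in h1.
  have h2 := ler_wpM2l A0 h1; have h3 : A * r1 = B0 by rewrite /A divfK // gt_eqF.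
  have h4 := ler_wpM2l A0 (dotp_unit_le nunu (hD _ _ (subset_closure Ox1) cly)).
  by rewrite h3 in h2; rewrite /B1; apply/andP; split; lra.
have fL y : Om y -> exists2 gf, has_grad setT f y gf &
    forall xi, dotp xi xi = 1 -> `|dotp gf xi| <= L.
  move=> Oy; exists (\row_i dpart [:: i] f y).
    exact: (@has_grad_dpart _ _ 1 Om f [::] y fI isT Oy).
  move=> xi xi1; apply: le_trans (dotp_le_norm _ _) _; rewrite ler_wpM2l //.
  rewrite -[leRHS]mulr1; apply: ler_pM => //; last first.
    by apply: le_trans (norm_le_enorm _) _; rewrite /enorm xi1 sqrtr1.
  apply: norm_rV_le => // j; rewrite mxE; apply: le_trans (ler_norm Mf); exact: (Ck_norm_le fM (s := [:: j]) isT Oy).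
rewrite Ucl //; apply: le_trans (_ : C <= _); last by have := ler_norm C; lra.
apply: (gradient_estimate hn oOm bOm Ox1 hD K0 C2 hkappa curv uI uU UH symH
  (fun y Oy => (UHin y Oy).1) plane fpos fL phase Cph0 L0 hCph _ heps bc A0 B10 slope erefl clx).
by move=> y cly; have [h1 _ h3] := phiP y cly; split; [exact: h1 | exact: le_trans (ler_norm _)].
Qed.
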